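(* Let $M$ and $N$ be second-countable manifolds and let $\pi:M\times N\to M$ be the trivial bundle over $M$ with fiber $N$. The map $$\Phi^{\mathrm{bun}}_{M\times N}:M\times N\to\mathcal B_{sp}(\mathrm{Dirac}_\pi(M\times N)),\qquad \Phi^{\mathrm{bun}}_{M\times N}(x,y)=\llbracket E_y,f\rrbracket|_x,$$ where $f\in C^\infty_c(M)$ is any function whose germ at $x$ is $1$, is an isomorphism of trivial bundles over $M$; that is, it is a diffeomorphism satisfying $\pi_{sp}\circ\Phi^{\mathrm{bun}}_{M\times N}=\pi$.
   Context: Manifolds are smooth, Hausdorff and paracompact; functions are $\mathbb C$-valued unless indicated. $C^\infty(M\times N)$ has the Fréchet topology of uniform convergence of all derivatives on compact sets; $C^\infty_c(M)$ has the LF-topology (inductive limit of the Fréchet spaces $C^\infty_c(L)$, $L\subset M$ compact). If $E,F$ are locally convex spaces which are $A$-modules, $\mathrm{Hom}_A(E,F)$ is the space of continuous $A$-linear maps with the topology of uniform convergence on bounded subsets of $E$. **The coalgebra.** Let $\mathcal E'_\pi(M\times N)=\mathrm{Hom}_{C^\infty_c(M)}(C^\infty(M\times N),C^\infty_c(M))$, with $(f\cdot F)(x,y)=f(x)F(x,y)$ and $(f\cdot T)(F)=T(f\cdot F)$. For $y\in N$, $f\in C^\infty_c(M)$ let $\llbracket E_y,f\rrbracket(F)(x)=f(x)F(x,y)$ (here $E_y=M\times\{y\}$). $D:=\mathrm{Dirac}_\pi(M\times N)\subset\mathcal E'_\pi(M\times N)$ is the linear span of all $\llbracket E_y,f\rrbracket$,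 with the induced topology; each element is $\sum_i\llbracket E_{y_i},f_i\rrbracket$ with distinct $y_i$, uniquely up to zero terms. It is a coalgebra over $C^\infty_c(M)$ with $\Delta(\sum_i\llbracket E_{y_i},f_i\rrbracket)=\sum_i\llbracket E_{y_i},f_i\rrbracket\otimes\llbracket E_{y_i},1_{f_i}\rrbracket$ and $\epsilon(\sum_i\llbracket E_{y_i},f_i\rrbracket)=\sum_if_i$, where $1_f\in C^\infty_c(M)$ is any function with $1_ff=f$. **Underlying set and projection.** For $x\in M$ let $I_x\subset C^\infty_c(M)$ be the ideal of functions with zero germ at $x$, $C^\infty_c(M)_x=C^\infty_c(M)/I_x$, $D_x=D/I_xD$ with the induced coalgebra structure $(\Delta_x,\epsilon_x)$ over $C^\infty_c(M)_x$; $u|_x\in D_x$ is the class of $u\in D$. Let $G(D_x)=\{\xi\in D_x:\Delta_x(\xi)=\xi\otimes\xi,\ \epsilon_x(\xi)=1\}$. Let $\mathcal E_{sp}(D)=\bigsqcup_{x\in M}G(D_x)$ with projection $\pi_{sp}:\mathcal E_{sp}(D)\to M$ sending $G(D_x)$ to $x$. **Dual algebra.** $D'=\mathrm{Hom}_{C^\infty_c(M)}(D,C^\infty_c(M))$ is an algebra with product $(\phi\cdot\psi)(u)=(\phi\otimes\psi)(\Delta(u))$, where $(\phi\otimes\psi)(\sum_iu_i'\otimes u_i'')=\sum_i\phi(u_i')\psi(u_i'')$. For $u=\sum_i\llbracket E_{y_i},f_i\rrbracket$ let $\overline u=\sum_i\llbracket E_{y_i},\overline{f_i}\rrbracket$,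 let $\overline\phi(u)=\overline{\phi(\overline u)}$, and let $D'_{\mathbb R}=\{\phi\in D':\overline\phi=\phi\}$, an $\mathbb R$-algebra (isomorphic to $C^\infty(M\times N,\mathbb R)$ via $F\mapsto\hat F$, $\hat F(u)=u(F)$). **Smooth structure.** For an $\mathbb R$-algebra $R$, $\mathrm{Spec}(R)$ is the set of nontrivial multiplicative homomorphisms $R\to\mathbb R$ with the relative weak-$*$ topology. If $R\cong C^\infty(Q,\mathbb R)$ for a second-countable manifold $Q$, $\mathrm{Spec}(R)$ has the natural smooth structure whose smooth real functions are exactly the functions $\chi\mapsto\chi(r)$, $r\in R$ (for $R=C^\infty(Q,\mathbb R)$ it makes $q\mapsto\delta_q$, evaluation at $q$, a diffeomorphism $Q\to\mathrm{Spec}(R)$). There is a bijection $\Theta_{M\times N}:\mathcal E_{sp}(D)\to\mathrm{Spec}(D'_{\mathbb R})$, $\Theta_{M\times N}(\llbracket E_y,f\rrbracket|_x)(\phi)=\phi(\llbracket E_y,f\rrbracket)(x)$, where $f$ has germ $1$ at $x$. The **spectral bundle** $\mathcal B_{sp}(D)$ is the set $\mathcal E_{sp}(D)$ with projection $\pi_{sp}$ and the topology and smooth structure for which $\Theta_{M\times N}$ is a diffeomorphism. *)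

(* Defs.v *)
From HB Require Import structures.
From mathcomp Require Import all_boot all_order all_algebra ring_quotient.
From mathcomp Require Import all_classical all_reals all_analysis.
From mathcomp.real_closed Require Import complex.

Set Implicit Arguments.
Unset Strict Implicit.
Unset Printing Implicit Defensive.

Import Order.TTheory GRing.Theory Num.Theory.
Import numFieldNormedType.Exports.

Local Open Scope classical_set_scope.
Local Open Scope ring_scope.
Local Open Scope complex_scope.
Local Open Scope quotient_scope.

Section Euclidean.
Variable R : realType.

Definition basis_vec n (i : 'I_n) : 'rV[R]_n := delta_mx ord0 i.

Fixpoint Ck n (U : set 'rV[R]_n) (k : nat) (f : 'rV[R]_n -> R) : Prop :=
  (forall z, U z -> {for z, continuous f}) /\
  (if k is k'.+1 then
     forall i, (forall z, U z -> derivable f z (basis_vec i)) /\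
               Ck U k' (fun z => 'D_(basis_vec i) f z)
   else True).

Definition smooth_on n (U : set 'rV[R]_n) (f : 'rV[R]_n -> R) :=
  forall k, Ck U k f.

Definition partials n (s : seq 'I_n) (f : 'rV[R]_n -> R) : 'rV[R]_n -> R :=
  foldr (fun i g z => 'D_(basis_vec i) g z) f s.

Lemma Ck_continuous n (U : set 'rV[R]_n) k f :
  Ck U k f -> forall z, U z -> {for z, continuous f}.
Proof. by case: k => [|k] []. Qed.

Lemma CkS n (U : set 'rV[R]_n) k f : Ck U k.+1 f -> Ck U k f.
Proof.
elim: k f => [|k IH] f [cf df]; first by [].
by split=> // i; split; [exact: (df i).1|apply: IH; exact: (df i).2].
Qed.

Lemma near_eq_continuous (T S : topologicalType) (f g : T -> S) z :
  (\forall w \near z, f w = g w) -> {for z, continuous f} ->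
  {for z, continuous g}.
Proof.
move=> fg cf.
suff: g @ z --> g z by [].
rewrite -(nbhs_singleton fg).
have gf : g @ z `=>` f @ z by exact: near_eq_cvg.
exact: cvg_trans gf cf.
Qed.

Lemma eq_Ck n (U : set 'rV[R]_n) k f g : open U ->
  (forall z, U z -> f z = g z) -> Ck U k f -> Ck U k g.
Proof.
move=> oU; elim: k f g => [|k IH] f g fg [cf df].
all: have fgz z : U z -> \forall w \near z, f w = g w
  by move=> Uz; apply: filterS fg _; exact: open_nbhs_nbhs.
all: have cg z : U z -> {for z, continuous g}
  by move=> Uz; exact: near_eq_continuous (fgz _ Uz) (cf _ Uz).
  by [].
split=> // i.
split=> [z Uz|]; first by apply: near_eq_derivable ((df i).1 z Uz); exact: fgz.
apply: IH (df i).2 => z Uz.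
by apply: near_eq_derive; exact: fgz.
Qed.

Lemma Ck_cst n (U : set 'rV[R]_n) k (a : R) : Ck U k (fun=> a).
Proof.
elim: k a => [|k IH] a; first by split=> // z _; exact: cst_continuous.
split=> [z _|i]; first exact: cst_continuous.
split=> [z _|]; first exact: derivable_cst.
have -> : (fun z : 'rV[R]_n => 'D_(basis_vec i) (fun=> a) z) = (fun=> 0).
  by apply/funext => z; exact: derive_cst.
exact: IH.
Qed.

Lemma CkD n (U : set 'rV[R]_n) k f g : open U ->
  Ck U k f -> Ck U k g -> Ck U k (f + g).
Proof.
move=> oU; elim: k f g => [|k IH] f g [cf df] [cg dg].
  by split=> // z Uz; apply: continuousD; [exact: cf Uz|exact: cg Uz].
split=> [z Uz|i]; first by apply: continuousD; [exact: cf Uz|exact: cg Uz].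
have [[dfi kfi] [dgi kgi]] := (df i, dg i).
split=> [z Uz|]; first by apply: derivableD; [exact: dfi|exact: dgi].
apply: eq_Ck (IH _ _ kfi kgi) => // z Uz.
by rewrite deriveD; [|exact: dfi|exact: dgi].
Qed.

Lemma CkM n (U : set 'rV[R]_n) k f g : open U ->
  Ck U k f -> Ck U k g -> Ck U k (f * g).
Proof.
move=> oU; elim: k f g => [|k IH] f g.
  move=> [cf _] [cg _].
  by split=> // z Uz; apply: continuousM; [exact: cf Uz|exact: cg Uz].
move=> kf kg; have [[cf df] [cg dg]] := (kf, kg).
split=> [z Uz|i]; first by apply: continuousM; [exact: cf Uz|exact: cg Uz].
have [[dfi kfi] [dgi kgi]] := (df i, dg i).
split=> [z Uz|]; first by apply: derivableM; [exact: dfi|exact: dgi].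
apply: (@eq_Ck _ _ _ (f * (fun z => 'D_(basis_vec i) g z) +
                      g * (fun z => 'D_(basis_vec i) f z))) => //.
  by move=> z Uz; rewrite deriveM; [|exact: dfi|exact: dgi].
by apply: CkD => //; apply: IH => //; exact: CkS.
Qed.

(* Composition with an affine map sending each direction of differentiation
   to a basis vector or to zero, e.g. a projection or a slice. *)
Lemma Ck_affine m n (U : set 'rV[R]_n) (V : set 'rV[R]_m) k
    (h : 'rV[R]_m -> 'rV[R]_n) (l : 'rV[R]_m -> 'rV[R]_n) (f : 'rV[R]_n -> R) :
    open V -> continuous h -> V `<=` h @^-1` U ->
    (forall (t : R) v z, h (t *: v + z) = t *: l v + h z) ->
    (forall i, (exists j, l (basis_vec i) = basis_vec j) \/
               l (basis_vec i) = 0) ->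
  Ck U k f -> Ck V k (f \o h).
Proof.
move=> oV ch VU hl lb; elim: k f => [|k IH] f [cf df].
  split=> // z Vz; apply: continuous_comp; first exact: ch.
  by apply: cf; exact: VU.
split=> [z Vz|i].
  by apply: continuous_comp; [exact: ch|apply: cf; exact: VU].
have E z : (fun t : R => t^-1 *: (((f \o h) \o shift z) (t *: basis_vec i)
              - (f \o h) z)) =
           (fun t : R => t^-1 *: ((f \o shift (h z)) (t *: l (basis_vec i))
              - f (h z))).
  by apply/funext => t /=; rewrite hl.
have D z : derivable (f \o h) z (basis_vec i) =
    derivable f (h z) (l (basis_vec i)) by rewrite /derivable E.
have D' z : 'D_(basis_vec i) (f \o h) z = 'D_(l (basis_vec i)) f (h z).
  by rewrite /derive E.
case: (lb i) => [[j lj]|l0].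
  split=> [z Vz|]; first by rewrite D lj; apply: (df j).1; exact: VU.
  rewrite (_ : (fun z => _) = (fun z => 'D_(basis_vec j) f z) \o h).
    by apply: IH; exact: (df j).2.
  by apply/funext => z; rewrite D' lj.
have Z : forall z, is_derive (h z) 0 f 0.
  move=> z; apply: DeriveDef.
    rewrite /derivable (_ : (fun t => _) = cst 0); first exact: is_cvg_cst.
    by apply/funext => t /=; rewrite scaler0 add0r subrr scaler0.
  rewrite /derive (_ : (fun t => _) = cst 0) ?lim_cst//.
  by apply/funext => t /=; rewrite scaler0 add0r subrr scaler0.
split=> [z Vz|]; first by rewrite D l0; exact: ex_derive.
rewrite (_ : (fun z => _) = (fun=> 0)); first exact: Ck_cst.
by apply/funext => z; rewrite D' l0; exact: derive_val.
Qed.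

End Euclidean.

(* The inverse of a chart is a total function; only its values on the image
   of the domain matter. *)
Record chart (R : realType) (T : topologicalType) (n : nat) := Chart {
  chart_dom : set T;
  chart_map :> T -> 'rV[R]_n;
  chart_inv : 'rV[R]_n -> T }.

Definition chart_img R T n (c : @chart R T n) : set 'rV[R]_n :=
  c @` chart_dom c.

Record is_chart R T n (c : @chart R T n) : Prop := IsChart {
  chart_dom_open : open (chart_dom c);
  chart_img_open : open (chart_img c);
  chartK : forall x, chart_dom c x -> chart_inv c (c x) = x;
  chart_continuous : forall x, chart_dom c x -> {for x, continuous c};
  chart_inv_continuous :
    forall z, chart_img c z -> {for z, continuous (chart_inv c)} }.

Record charted_space (R : realType) := ChartedSpace {
  carrier :> topologicalType;
  dim : nat;
  atlas : set (chart R carrier dim) }.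

Section Manifolds.
Variable R : realType.
Implicit Types X Y : charted_space R.

Definition local_rep T n (V : Type) (c : chart R T n) (f : T -> V)
  : 'rV[R]_n -> V := f \o chart_inv c.

(* Paracompactness is not listed: it follows from second countability for a
   Hausdorff locally Euclidean space. *)
Record is_manifold X : Prop := IsManifold {
  manifold_hausdorff : hausdorff_space X;
  manifold_second_countable : @second_countable X;
  manifold_charts : forall c, atlas c -> @is_chart R X (dim X) c;
  manifold_cover : forall x : X, exists2 c, atlas c & chart_dom c x;
  manifold_compatible : forall c d : chart R X (dim X), atlas c -> atlas d ->
    forall j, smooth_on (c @` (chart_dom c `&` chart_dom d))
                        (local_rep c (fun x => d x ord0 j)) }.

Definition smooth_real X (f : X -> R) :=
  forall c, atlas c -> smooth_on (chart_img c) (local_rep c f).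

Definition smooth_complex X (F : X -> R[i]) :=
  smooth_real (fun x => complex.Re (F x)) /\ smooth_real (fun x => complex.Im (F x)).

Definition smooth_map X Y (f : X -> Y) :=
  continuous f /\
  forall (c : chart R X (dim X)) (d : chart R Y (dim Y)), atlas c -> atlas d ->
  forall j, smooth_on (c @` (chart_dom c `&` f @^-1` chart_dom d))
                      (local_rep c (fun x => d (f x) ord0 j)).

Definition diffeomorphism X Y (f : X -> Y) :=
  exists g : Y -> X,
    [/\ cancel f g, cancel g f, smooth_map f & smooth_map g].

Definition prod_chart X Y (c : chart R X (dim X)) (d : chart R Y (dim Y))
  : chart R (X * Y)%type (dim X + dim Y) :=
  Chart (chart_dom c `*` chart_dom d)
        (fun p => row_mx (c p.1) (d p.2))
        (fun z => (chart_inv c (lsubmx z), chart_inv d (rsubmx z))).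

Definition prod_space X Y : charted_space R :=
  @ChartedSpace R (X * Y)%type (dim X + dim Y)
    [set e | exists c d, [/\ atlas c, atlas d & e = prod_chart c d]].

End Manifolds.

Record manifold (R : realType) := Manifold {
  manifold_space :> charted_space R;
  manifoldP : is_manifold manifold_space }.

Section Product.
Variable R : realType.

Lemma mx_entries_continuous (K : numFieldType) m n
    (h : 'rV[K]_m -> 'rV[K]_n) :
  (forall j, (exists i, forall z, h z ord0 j = z ord0 i) \/
             (exists a, forall z, h z ord0 j = a)) -> continuous h.
Proof.
move=> hE z A /nbhs_ballP[e e0 zA]; apply/nbhs_ballP; exists e => // w zw.
apply: zA; split=> // i j; rewrite (ord1 i).
case: (hE j) => [[k hk]|[a ha]]; first by rewrite !hk; exact: zw.2.
by rewrite !ha; exact: ballxx.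
Qed.

Lemma lsubmx_continuous m n :
  continuous (lsubmx : 'rV[R]_(m + n) -> 'rV[R]_m).
Proof.
apply: mx_entries_continuous => j.
by left; exists (lshift n j) => z; rewrite mxE.
Qed.

Lemma rsubmx_continuous m n :
  continuous (rsubmx : 'rV[R]_(m + n) -> 'rV[R]_n).
Proof.
apply: mx_entries_continuous => j.
by left; exists (rshift m j) => z; rewrite mxE.
Qed.

Lemma row_mx_continuous m n (w : 'rV[R]_n) :
  continuous (fun z : 'rV[R]_m => row_mx z w).
Proof.
apply: mx_entries_continuous => j; case: (split_ordP j) => k ->.
  by left; exists k => z; rewrite row_mxEl.
by right; exists (w ord0 k) => z; rewrite row_mxEr.
Qed.

Lemma lsubmx_basis m n (i : 'I_(m + n)) :
  (exists j, lsubmx (basis_vec R i) = basis_vec R j :> 'rV_m) \/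
  lsubmx (basis_vec R i) = 0 :> 'rV_m.
Proof.
case: (split_ordP i) => k ->; [left; exists k|right];
  by apply/rowP => j; rewrite !mxE /= ?eq_lshift ?eq_lrshift ?andbF.
Qed.

Lemma rsubmx_basis m n (i : 'I_(m + n)) :
  (exists j, rsubmx (basis_vec R i) = basis_vec R j :> 'rV_n) \/
  rsubmx (basis_vec R i) = 0 :> 'rV_n.
Proof.
case: (split_ordP i) => k ->; [right|left; exists k];
  by apply/rowP => j; rewrite !mxE /= ?eq_rshift ?eq_rlshift ?andbF.
Qed.

Lemma row_mx_basis m n (i : 'I_m) :
  row_mx (basis_vec R i) 0 = basis_vec R (lshift n i).
Proof.
apply/rowP => j; rewrite !mxE; case: split_ordP => k ->.
  by rewrite !mxE eq_lshift.
by rewrite !mxE eq_rlshift andbF.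
Qed.

Lemma prod_chart_img (X Y : charted_space R)
    (c : chart R X (dim X)) (d : chart R Y (dim Y)) :
  chart_img (prod_chart c d) =
  lsubmx @^-1` chart_img c `&` rsubmx @^-1` chart_img d.
Proof.
apply/seteqP; split=> [z [[x y] /= [dx dy] <-]|z [/= [x dx cx] [y dy cy]]].
  by rewrite /= row_mxKl row_mxKr; split; [exists x|exists y].
by exists (x, y) => //=; rewrite cx cy hsubmxK.
Qed.

Lemma prod_chartP (X Y : charted_space R)
    (c : chart R X (dim X)) (d : chart R Y (dim Y)) :
  is_chart c -> is_chart d -> is_chart (prod_chart c d).
Proof.
move=> [oc ic cK cc ci] [od id dK dc di].
have oX (A : set X) (B : set Y) : open A -> open B -> open (A `*` B).
  rewrite !openE => oA oB [x y] /= [Ax By].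
  by exists (A, B) => //; split; [exact: oA|exact: oB].
split; first exact: oX.
- rewrite prod_chart_img; apply: openI.
    by apply: open_comp => // z _; exact: lsubmx_continuous.
  by apply: open_comp => // z _; exact: rsubmx_continuous.
- by move=> [x y] [/= cx dy]; rewrite row_mxKl row_mxKr cK// dK.
- move=> [x y] [/= cx dy] A /nbhs_ballP[e e0 zA].
  have bc : nbhs x (c @^-1` ball (c x) e).
    by apply: (cc _ cx); exact: nbhsx_ballx.
  have bd : nbhs y (d @^-1` ball (d y) e).
    by apply: (dc _ dy); exact: nbhsx_ballx.
  exists (c @^-1` ball (c x) e, d @^-1` ball (d y) e) => //= -[x' y'] [/= bx by'].
  apply: zA; split=> // i j; rewrite (ord1 i).
  case: (split_ordP j) => k ->; rewrite ?row_mxEl ?row_mxEr.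
    exact: bx.2.
  exact: by'.2.
- move=> z; rewrite prod_chart_img => -[/= cz dz].
  have h1 : {for z, continuous (chart_inv c \o lsubmx)}.
    by apply: continuous_comp; [exact: lsubmx_continuous|exact: ci].
  have h2 : {for z, continuous (chart_inv d \o rsubmx)}.
    by apply: continuous_comp; [exact: rsubmx_continuous|exact: di].
  exact: cvg_pair h1 h2.
Qed.

Lemma prod_is_manifold (M N : manifold R) : is_manifold (prod_space M N).
Proof.
have [hM sM cM covM cpM] := manifoldP M.
have [hN sN cN covN cpN] := manifoldP N.
split.
- move=> [x y] [x' y'] cl; congr pair.
    apply: hM => A B Ax Bx'.
    have [||[u v] [/= [Au _] [Bu _]]] := cl (A `*` setT) (B `*` setT).
    + by exists (A, setT) => //; split=> //; exact: filterT.
    + by exists (B, setT) => //; split=> //; exact: filterT.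
    + by exists u.
  apply: hN => A B Ay By'.
  have [||[u v] [/= [_ Av] [_ Bv]]] := cl (setT `*` A) (setT `*` B).
  + by exists (setT, A) => //; split=> //; exact: filterT.
  + by exists (setT, B) => //; split=> //; exact: filterT.
  + by exists v.
- have [BM kM [oBM bM]] := sM; have [BN kN [oBN bN]] := sN.
  exists [set AB.1 `*` AB.2 | AB in BM `*` BN].
    by apply: sub_countable (card_image_le _ _) _; exact: countableX.
  split.
    move=> _ [[A B] [/= BA BB] <-]; rewrite openE => -[x y] /= [Ax By].
    exists (A, B) => //; split => /=.
      by apply: open_nbhs_nbhs; split=> //; exact: oBM.
    by apply: open_nbhs_nbhs; split=> //; exact: oBN.
  move=> [x y] W [[A B] /= [nA nB] AB].
  have [A' [BA' A'x] A'A] := bM x A nA.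
  have [B' [BB' B'y] B'B] := bN y B nB.
  exists (A' `*` B') => /=; first by split; [exists (A', B')|].
  by move=> [u v] [/= A'u B'v]; apply: AB; split; [exact: A'A|exact: B'B].
- move=> _ [c [d [Mc Nd ->]]].
  by apply: prod_chartP; [exact: cM|exact: cN].
- move=> [x y]; have [c Mc cx] := covM x; have [d Nd dy] := covN y.
  by exists (prod_chart c d) => //; exists c, d.
- move=> _ _ [c [d [Mc Nd ->]]] [c' [d' [Mc' Nd' ->]]] j k.
  have -> : prod_chart c d @`
      (chart_dom (prod_chart c d) `&` chart_dom (prod_chart c' d')) =
      (lsubmx @^-1` (c @` (chart_dom c `&` chart_dom c'))) `&`
      (rsubmx @^-1` (d @` (chart_dom d `&` chart_dom d'))).
    apply/seteqP; split=> [z [[x y] /= [[cx dy] [cx' dy']] <-]|].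
      by rewrite /= row_mxKl row_mxKr; split; [exists x|exists y].
    move=> z [/= [x [cx cx'] xz] [y [dy dy'] yz]].
    by exists (x, y) => //=; rewrite xz yz hsubmxK.
  have oI X n (e e' : chart R X n) : is_chart e -> is_chart e' ->
      open (e @` (chart_dom e `&` chart_dom e')).
    move=> [oe ie eK ec ei] [oe' _ _ _ _].
    have -> : e @` (chart_dom e `&` chart_dom e') =
              chart_img e `&` chart_inv e @^-1` chart_dom e'.
      apply/seteqP; split=> [_ [x [ex ex'] <-]|_ [[x ex <-] /=]].
        by split; [exists x|rewrite /= eK].
      by rewrite eK// => ex'; exists x.
    rewrite openE => z [iz /= e'z]; apply: filterI.
      exact: open_nbhs_nbhs.
    by apply: ei => //; exact: open_nbhs_nbhs.
  have oc := oI _ _ _ _ (cM _ Mc) (cM _ Mc').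
  have od := oI _ _ _ _ (cN _ Nd) (cN _ Nd').
  have oW : open ((lsubmx @^-1` (c @` (chart_dom c `&` chart_dom c'))) `&`
      (rsubmx @^-1` (d @` (chart_dom d `&` chart_dom d')))).
    apply: openI; apply: open_comp => // z _.
      exact: lsubmx_continuous.
    exact: rsubmx_continuous.
  case: (split_ordP j) => i ->.
    rewrite (_ : local_rep _ _ =
      (local_rep c (fun x => c' x ord0 i)) \o lsubmx); last first.
      by apply/funext => z; rewrite /local_rep /= row_mxEl.
    apply: (Ck_affine (l := lsubmx)) (cpM _ _ Mc Mc' i k) => //.
    + exact: lsubmx_continuous.
    + by move=> t v z; rewrite linearP.
    + exact: lsubmx_basis.
  rewrite (_ : local_rep _ _ =
    (local_rep d (fun y => d' y ord0 i)) \o rsubmx); last first.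
    by apply/funext => z; rewrite /local_rep /= row_mxEr.
  apply: (Ck_affine (l := rsubmx)) (cpN _ _ Nd Nd' i k) => //.
  + exact: rsubmx_continuous.
  + by move=> t v z; rewrite linearP.
  + exact: rsubmx_basis.
Qed.

Canonical prod_manifold (M N : manifold R) : manifold R :=
  Manifold (prod_is_manifold M N).

End Product.

Section FunctionSpaces.
Variable R : realType.
Notation C := R[i].

Lemma manifold_open_img (M : manifold R) c :
  @atlas R M c -> open (chart_img c).
Proof. by move=> /(manifold_charts (manifoldP M))/chart_img_open. Qed.

Section Real.
Variable X : manifold R.
Implicit Types f g : X -> R.

Lemma smooth_real_cst (a : R) : smooth_real (fun _ : X => a).
Proof. by move=> c _ k; exact: Ck_cst. Qed.

Lemma smooth_realD f g :
  smooth_real f -> smooth_real g -> smooth_real (fun x => f x + g x).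
Proof.
by move=> sf sg c Xc k; apply: CkD; [exact: manifold_open_img|exact: sf|exact: sg].
Qed.

Lemma smooth_realM f g :
  smooth_real f -> smooth_real g -> smooth_real (fun x => f x * g x).
Proof.
by move=> sf sg c Xc k; apply: CkM; [exact: manifold_open_img|exact: sf|exact: sg].
Qed.

Lemma smooth_realN f : smooth_real f -> smooth_real (fun x => - f x).
Proof.
move=> sf; rewrite (_ : (fun x => _) = fun x => -1 * f x).
  by apply: smooth_realM => //; exact: smooth_real_cst.
by apply/funext => x; rewrite mulN1r.
Qed.

Implicit Types F G : X -> C.

Lemma smooth_complex_cst (a : C) : smooth_complex (fun _ : X => a).
Proof. by split; exact: smooth_real_cst. Qed.

Lemma smooth_complexD F G :
  smooth_complex F -> smooth_complex G -> smooth_complex (F + G).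
Proof.
move=> [F1 F2] [G1 G2]; split.
  rewrite (_ : (fun x => _) = fun x => complex.Re (F x) + complex.Re (G x)).
    exact: smooth_realD.
  by apply/funext => x; rewrite fctE; case: (F x) (G x) => ? ? [].
rewrite (_ : (fun x => _) = fun x => complex.Im (F x) + complex.Im (G x)).
  exact: smooth_realD.
by apply/funext => x; rewrite fctE; case: (F x) (G x) => ? ? [].
Qed.

Lemma smooth_complexM F G :
  smooth_complex F -> smooth_complex G -> smooth_complex (F * G).
Proof.
move=> [F1 F2] [G1 G2]; split.
  rewrite (_ : (fun x => _) = fun x =>
    complex.Re (F x) * complex.Re (G x) - complex.Im (F x) * complex.Im (G x)).
    apply: smooth_realD; first exact: smooth_realM.
    by apply: smooth_realN; exact: smooth_realM.
  by apply/funext => x; rewrite fctE; case: (F x) (G x) => ? ? [].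
rewrite (_ : (fun x => _) = fun x =>
  complex.Re (F x) * complex.Im (G x) + complex.Im (F x) * complex.Re (G x)).
  by apply: smooth_realD; exact: smooth_realM.
by apply/funext => x; rewrite fctE; case: (F x) (G x) => ? ? [].
Qed.

Lemma smooth_complex_conj F :
  smooth_complex F -> smooth_complex (fun x => (F x)^*).
Proof.
move=> [F1 F2]; split.
  rewrite (_ : (fun x => _) = fun x => complex.Re (F x)) //.
  by apply/funext => x; case: (F x).
rewrite (_ : (fun x => _) = fun x => - complex.Im (F x)).
  exact: smooth_realN.
by apply/funext => x; case: (F x).
Qed.

End Real.

Lemma smooth_complex_fst (M N : manifold R) (f : M -> C) :
  smooth_complex f -> smooth_complex (fun p : prod_manifold M N => f p.1).
Proof.
have H (g : M -> R) : smooth_real g ->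
    smooth_real (fun p : prod_manifold M N => g p.1).
  move=> sg _ [c [d [Mc Nd ->]]] k.
  apply: (Ck_affine (h := lsubmx) (l := lsubmx)) (sg _ Mc k) => //.
  - by apply: (@manifold_open_img (prod_manifold M N)); exists c, d.
  - exact: lsubmx_continuous.
  - by rewrite prod_chart_img => z [].
  - by move=> t v z; rewrite linearP.
  - exact: lsubmx_basis.
by move=> [f1 f2]; split; [exact: H f1|exact: H f2].
Qed.

Lemma smooth_complex_slice (M N : manifold R) (y : N)
    (F : prod_manifold M N -> C) :
  smooth_complex F -> smooth_complex (fun x : M => F (x, y)).
Proof.
have H (g : prod_manifold M N -> R) : smooth_real g ->
    smooth_real (fun x : M => g (x, y)).
  move=> sg c Mc k.
  have [d Nd dy] := manifold_cover (manifoldP N) y.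
  have dK := chartK (manifold_charts (manifoldP N) Nd) dy.
  have cd : @atlas R (prod_manifold M N) (prod_chart c d) by exists c, d.
  rewrite (_ : local_rep c _ =
    local_rep (prod_chart c d) g \o (fun z => row_mx z (d y))); last first.
    by apply/funext => z; rewrite /local_rep /= row_mxKl row_mxKr dK.
  apply: (Ck_affine (l := fun v => row_mx v 0)) (sg _ cd k) => //.
  - exact: manifold_open_img.
  - exact: row_mx_continuous.
  - move=> z cz; rewrite /= prod_chart_img /= row_mxKl row_mxKr; split=> //.
    by exists y.
  - by move=> t v z; rewrite scale_row_mx add_row_mx scaler0 add0r.
  - by move=> i; left; exists (lshift _ i); exact: row_mx_basis.
by move=> [f1 f2]; split; [exact: H f1|exact: H f2].
Qed.

Definition csupport (X : topologicalType) (f : X -> C) : set X :=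
  closure [set x | f x != 0].

Lemma sub_csupport (X : topologicalType) (f g : X -> C) :
  (forall x, g x = 0 -> f x = 0) -> compact (csupport g) ->
  compact (csupport f).
Proof.
move=> fg cg; apply: subclosed_compact cg _; first exact: closed_closure.
by apply: closure_subset => x /=; apply: contra_neq; exact: fg.
Qed.

Lemma csupportD (X : topologicalType) (f g : X -> C) :
  compact (csupport f) -> compact (csupport g) -> compact (csupport (f + g)).
Proof.
move=> cf cg; apply: (@subclosed_compact _ _ (csupport f `|` csupport g)).
- exact: closed_closure.
- exact: compactU.
- rewrite -closureU; apply: closure_subset => x /= fg0.
  have [f0|] := eqVneq (f x) 0; last by left.
  by right; apply: contra_neq fg0 => g0; rewrite fctE f0 g0 addr0.
Qed.

Section Spaces.
Variable X : manifold R.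

Definition smooth_pred : {pred (X -> C)} := fun F => `[< smooth_complex F >].

Definition smooth_compact_pred : {pred (X -> C)} :=
  fun f => `[< smooth_complex f /\ compact (csupport f) >].

Lemma smooth_pred_submod : submod_closed smooth_pred.
Proof.
split=> [|a F G]; first by apply/asboolP; exact: smooth_complex_cst.
move=> /asboolP sF /asboolP sG; apply/asboolP.
apply: smooth_complexD => //; rewrite (_ : a *: F = (fun=> a) * F) //.
by apply: smooth_complexM => //; exact: smooth_complex_cst.
Qed.

HB.instance Definition _ :=
  GRing.isSubmodClosed.Build C (X -> C) smooth_pred smooth_pred_submod.

Lemma smooth_compact_pred_submod : submod_closed smooth_compact_pred.
Proof.
split=> [|a f g].
  apply/asboolP; split; first exact: smooth_complex_cst.
  rewrite /csupport (_ : [set x | _] = set0) ?closure0; first exact: compact0.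
  by apply/seteqP; split=> // x /=; rewrite eqxx.
move=> /asboolP[sf cf] /asboolP[sg cg]; apply/asboolP; split.
  apply: smooth_complexD => //; rewrite (_ : a *: f = (fun=> a) * f) //.
  by apply: smooth_complexM => //; exact: smooth_complex_cst.
apply: csupportD => //; apply: sub_csupport cf => x f0.
by rewrite fctE f0 scaler0.
Qed.

HB.instance Definition _ := GRing.isSubmodClosed.Build C (X -> C)
  smooth_compact_pred smooth_compact_pred_submod.

Record Cinf := MkCinf { Cinf_fun :> X -> C; _ : Cinf_fun \in smooth_pred }.
HB.instance Definition _ := [isSub for Cinf_fun].
HB.instance Definition _ := [Choice of Cinf by <:].
HB.instance Definition _ := [SubChoice_isSubLmodule of Cinf by <:].

Record Ccinf :=
  MkCcinf { Ccinf_fun :> X -> C; _ : Ccinf_fun \in smooth_compact_pred }.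
HB.instance Definition _ := [isSub for Ccinf_fun].
HB.instance Definition _ := [Choice of Ccinf by <:].
HB.instance Definition _ := [SubChoice_isSubLmodule of Ccinf by <:].

Lemma CinfP (F : Cinf) : smooth_complex F.
Proof. by case: F => F /= /asboolP. Qed.

Lemma CcinfP (f : Ccinf) : smooth_complex f /\ compact (csupport f).
Proof. by case: f => f /= /asboolP. Qed.

Lemma cmul_subproof (f g : Ccinf) :
  (fun x => f x * g x) \in smooth_compact_pred.
Proof.
have [[sf cf] [sg _]] := (CcinfP f, CcinfP g).
apply/asboolP; split; first exact: smooth_complexM.
by apply: sub_csupport cf => x ->; rewrite mul0r.
Qed.
Definition cmul (f g : Ccinf) : Ccinf := MkCcinf (cmul_subproof f g).

Lemma cconj_subproof (f : Ccinf) : (fun x => (f x)^*) \in smooth_compact_pred.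
Proof.
have [sf cf] := CcinfP f.
apply/asboolP; split; first exact: smooth_complex_conj.
by apply: sub_csupport cf => x ->; rewrite conjc0.
Qed.
Definition cconj (f : Ccinf) : Ccinf := MkCcinf (cconj_subproof f).

End Spaces.
End FunctionSpaces.

Section Topologies.
Variable R : realType.
Notation C := R[i].

(* The translation-invariant topology generated by a family of seminorms. *)
Definition lc_nbhs (V : zmodType) (P : set (V -> R)) (v : V) : set_system V :=
  [set U | exists (A : set (V -> R)) (e : R),
    [/\ finite_set A, A `<=` P, 0 < e &
        forall w, (forall p, A p -> p (w - v) < e) -> U w]].

Definition lc_bounded (V : zmodType) (P : set (V -> R)) : set (set V) :=
  [set B | forall p, P p -> exists r, forall v, B v -> p v <= r].

(* Uniform convergence on the sets of a family, for maps into a topological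
   abelian group with neighbourhoods of zero [nbhs0]. *)
Definition unif_nbhs (E : Type) (F : zmodType) (bnd : set (set E))
    (nbhs0 : set_system F) (T : E -> F) : set_system (E -> F) :=
  [set W | exists (B : set E) (U : set F),
    [/\ bnd B, nbhs0 U & forall S, (forall v, B v -> U (S v - T v)) -> W S]].

Definition is_seminorm (V : lmodType C) (q : V -> R) :=
  (forall u v, q (u + v) <= q u + q v) /\
  (forall (a : C) u, q (a *: u) = Normc.normc a * q u).

Definition cpartials n (s : seq 'I_n) (F : 'rV[R]_n -> C) (z : 'rV[R]_n) : C :=
  partials s (fun w => complex.Re (F w)) z +i*
  partials s (fun w => complex.Im (F w)) z.

Section FunctionTopologies.
Variable X : manifold R.

Definition sup_deriv (c : chart R X (dim X)) (K : set 'rV[R]_(dim X))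
    (s : seq 'I_(dim X)) (F : X -> C) : R :=
  sup [set Normc.normc (cpartials s (local_rep c F) z) | z in K].

Definition smooth_seminorms : set ((X -> C) -> R) :=
  [set p | exists c K s, [/\ atlas c, compact K, K `<=` chart_img c &
                             p = sup_deriv c K s]].

Definition Cinf_seminorms : set (Cinf X -> R) :=
  [set p | exists2 q, smooth_seminorms q & p = fun F : Cinf X => q F].

(* The inductive limit topology is the finest locally convex one for which the
   inclusions of the spaces of functions supported in a compact set are
   continuous, hence the one generated by all seminorms whose restrictions to
   these spaces are continuous. *)
Definition LF_seminorms : set (Ccinf X -> R) :=
  [set q | is_seminorm q /\
    forall L : set X, compact L -> forall e, 0 < e ->
    exists (A : set ((X -> C) -> R)) (d : R),
    [/\ finite_set A, A `<=` smooth_seminorms, 0 < d &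
        forall f : Ccinf X, csupport f `<=` L ->
          (forall p, A p -> p f < d) -> q f < e]].

End FunctionTopologies.
End Topologies.

Section Tensor.
Variables (A : Type) (E F : zmodType).
Variables (actE : A -> E -> E) (actF : A -> F -> F).

(* A formal sum of elementary tensors is a sequence of pairs; there is no need
   for formal opposites, since [(- e) (x) f] is the opposite of [e (x) f]. *)
Inductive tensor_eq : seq (E * F) -> seq (E * F) -> Prop :=
| tensor_refl s : tensor_eq s s
| tensor_sym s t : tensor_eq s t -> tensor_eq t s
| tensor_trans s t u : tensor_eq s t -> tensor_eq t u -> tensor_eq s u
| tensor_cat s s' t t' :
    tensor_eq s s' -> tensor_eq t t' -> tensor_eq (s ++ t) (s' ++ t')
| tensor_catC s t : tensor_eq (s ++ t) (t ++ s)
| tensor_Dl e e' f : tensor_eq [:: (e + e', f)] [:: (e, f); (e', f)]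
| tensor_Dr e f f' : tensor_eq [:: (e, f + f')] [:: (e, f); (e, f')]
| tensor_0l f : tensor_eq [:: (0, f)] [::]
| tensor_0r e : tensor_eq [:: (e, 0)] [::]
| tensor_act a e f : tensor_eq [:: (actE a e, f)] [:: (e, actF a f)].

Definition tensor_eqb : rel (seq (E * F)) := fun s t => `[< tensor_eq s t >].

Lemma tensor_eqb_equiv : equiv_class_of tensor_eqb.
Proof.
split=> [s|s t|t s u].
- exact/asboolP/tensor_refl.
- by apply/asboolP/asboolP => /tensor_sym.
- by move=> /asboolP st /asboolP tu; apply/asboolP; exact: tensor_trans st tu.
Qed.
Canonical tensor_equiv := EquivRelPack tensor_eqb_equiv.

Definition tensor := {eq_quot tensor_eqb}.
HB.instance Definition _ := Choice.on tensor.
HB.instance Definition _ : EqQuotient _ tensor_eqb tensor :=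
  EqQuotient.on tensor.

Definition tensor_sum (s : seq (E * F)) : tensor := \pi_tensor s.
Definition tens (e : E) (f : F) : tensor := tensor_sum [:: (e, f)].

End Tensor.

Section Dirac.
Variables (R : realType) (M N : manifold R).
Notation C := R[i].
Notation MN := (prod_manifold M N).

Lemma Cinf_act_subproof (f : Ccinf M) (F : Cinf MN) :
  (fun p : MN => f p.1 * F p) \in @smooth_pred R MN.
Proof.
apply/asboolP; apply: (@smooth_complexM _ MN); last exact: CinfP.
exact: (@smooth_complex_fst _ M N) (CcinfP f).1.
Qed.
Definition Cinf_act (f : Ccinf M) (F : Cinf MN) : Cinf MN :=
  MkCinf (Cinf_act_subproof f F).

Lemma bracket_subproof (y : N) (f : Ccinf M) (F : Cinf MN) :
  (fun x : M => f x * F (x, y)) \in @smooth_compact_pred R M.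
Proof.
have [sf cf] := CcinfP f; apply/asboolP; split; last first.
  by apply: sub_csupport cf => x ->; rewrite mul0r.
apply: smooth_complexM => //.
exact: (@smooth_complex_slice _ M N y) (CinfP F).
Qed.
Definition bracket (y : N) (f : Ccinf M) (F : Cinf MN) : Ccinf M :=
  MkCcinf (bracket_subproof y f F).

(* The linear span is taken in the space of all maps; it lies in the space of
   continuous module homomorphisms, whose topology is that of uniform
   convergence on bounded sets. *)
Definition Dirac_pred : {pred (Cinf MN -> Ccinf M)} := fun T =>
  `[< exists s : seq (C * (N * Ccinf M)),
        T = \sum_(p <- s) p.1 *: bracket p.2.1 p.2.2 >].

Lemma Dirac_pred_submod : submod_closed Dirac_pred.
Proof.
split=> [|a T S]; first by apply/asboolP; exists [::]; rewrite big_nil.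
move=> /asboolP[s ->] /asboolP[t ->]; apply/asboolP.
exists ([seq (a * p.1, p.2) | p <- s] ++ t).
rewrite big_cat big_map scaler_sumr; congr (_ + _).
by apply: eq_bigr => p _; rewrite scalerA.
Qed.

HB.instance Definition _ := GRing.isSubmodClosed.Build C (Cinf MN -> Ccinf M)
  Dirac_pred Dirac_pred_submod.

Record Dirac := MkDirac {
  Dirac_fun :> Cinf MN -> Ccinf M; _ : Dirac_fun \in Dirac_pred }.
HB.instance Definition _ := [isSub for Dirac_fun].
HB.instance Definition _ := [Choice of Dirac by <:].
HB.instance Definition _ := [SubChoice_isSubLmodule of Dirac by <:].

Lemma dirac_subproof y f : bracket y f \in Dirac_pred.
Proof.
by apply/asboolP; exists [:: (1, (y, f))]; rewrite big_seq1 scale1r.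
Qed.
Definition dirac (y : N) (f : Ccinf M) : Dirac := MkDirac (dirac_subproof y f).

Lemma Dirac_act_subproof (f : Ccinf M) (u : Dirac) :
  (fun F => u (Cinf_act f F)) \in Dirac_pred.
Proof.
case: u => T /= /asboolP[s ->]; apply/asboolP.
exists [seq (p.1, (p.2.1, cmul p.2.2 f)) | p <- s].
apply/funext => F; rewrite big_map !fct_sumE; apply: eq_bigr => p _.
by apply: val_inj; apply/funext => x; rewrite !fctE /= !fctE /= !mulrA.
Qed.
Definition Dirac_act (f : Ccinf M) (u : Dirac) : Dirac :=
  MkDirac (Dirac_act_subproof f u).

Definition Dirac_nbhs (u : Dirac) : set_system Dirac :=
  [set W | exists2 V : set (Cinf MN -> Ccinf M),
     unif_nbhs (lc_bounded (@Cinf_seminorms R MN))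
               (lc_nbhs (@LF_seminorms R M) 0) u V &
     forall v : Dirac, V v -> W v].

(* [xget] selects an element of a nonempty set; the representation with
   distinct points is unique up to zero terms and order, and the tensor below
   does not depend on the chosen local units. *)
Definition Dirac_repr (u : Dirac) : seq (N * Ccinf M) :=
  xget [::] [set s | uniq [seq p.1 | p <- s] /\
                     u = \sum_(p <- s) dirac p.1 p.2].

Definition local_unit (f : Ccinf M) : Ccinf M :=
  xget 0 [set g | cmul g f = f].

Definition Dirac_tensor := tensor Dirac_act Dirac_act.

Definition comult (u : Dirac) : Dirac_tensor :=
  tensor_sum Dirac_act Dirac_act
    [seq (dirac p.1 p.2, dirac p.1 (local_unit p.2)) | p <- Dirac_repr u].

Definition counit (u : Dirac) : Ccinf M := \sum_(p <- Dirac_repr u) p.2.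

Definition Dirac_conj (u : Dirac) : Dirac :=
  \sum_(p <- Dirac_repr u) dirac p.1 (cconj p.2).

Section Localization.
Variable x : M.

Definition germ0_pred : {pred (Ccinf M)} :=
  fun f => `[< \forall z \near x, f z = 0 >].

Lemma germ0_zmod : zmod_closed germ0_pred.
Proof.
split=> [|f g /asboolP f0 /asboolP g0]; apply/asboolP; first exact: nearW.
by apply: filterS2 f0 g0 => z fz gz; rewrite /= !fctE fz gz subr0.
Qed.
HB.instance Definition _ :=
  GRing.isZmodClosed.Build (Ccinf M) germ0_pred germ0_zmod.

Definition germs := Quotient.quot germ0_pred.

Definition germ_is_one (f : Ccinf M) := \forall z \near x, f z = 1.

Definition germ0_Dirac_pred : {pred Dirac} := fun u =>
  `[< exists2 s : seq (Ccinf M * Dirac), all (fun p => p.1 \in germ0_pred) s &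
        u = \sum_(p <- s) Dirac_act p.1 p.2 >].

Lemma germ0_Dirac_zmod : zmod_closed germ0_Dirac_pred.
Proof.
split=> [|u v /asboolP[s sI ->] /asboolP[t tI ->]]; apply/asboolP.
  by exists [::]; rewrite ?big_nil.
exists (s ++ [seq (p.1, - p.2) | p <- t]).
  by rewrite all_cat sI all_map.
rewrite big_cat big_map -sumrN; congr (_ + _); apply: eq_bigr => p _.
exact: val_inj.
Qed.
HB.instance Definition _ :=
  GRing.isZmodClosed.Build Dirac germ0_Dirac_pred germ0_Dirac_zmod.

Definition fiber := Quotient.quot germ0_Dirac_pred.

Definition fiber_class (u : Dirac) : fiber := \pi_fiber u.

Definition fiber_act (a : germs) (xi : fiber) : fiber :=
  fiber_class (Dirac_act (repr a) (repr xi)).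

Definition fiber_comult (xi : fiber) : tensor fiber_act fiber_act :=
  tensor_sum fiber_act fiber_act
    [seq (fiber_class p.1, fiber_class p.2) | p <- repr (comult (repr xi))].

Definition fiber_counit (xi : fiber) : germs := \pi_germs (counit (repr xi)).

Definition grouplike : set fiber := [set xi |
  fiber_comult xi = tens fiber_act fiber_act xi xi /\
  exists2 f, germ_is_one f & fiber_counit xi = \pi_germs f].

End Localization.

Definition Esp := {x : M & set_type (@grouplike x)}.

Definition pi_sp (e : Esp) : M := projT1 e.

Definition Esp_val (e : Esp) : {x : M & fiber x} :=
  existT fiber (projT1 e) (set_val (projT2 e)).

Definition Phi_spec (Phi : MN -> Esp) := forall x : M,
  (exists f, germ_is_one x f) /\
  forall y f, germ_is_one x f ->
    Esp_val (Phi (x, y)) = existT fiber x (fiber_class x (dirac y f)).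

Definition is_dual (phi : Dirac -> Ccinf M) :=
  [/\ forall (a : C) u v, phi (a *: u + v) = a *: phi u + phi v,
      forall f u, phi (Dirac_act f u) = cmul f (phi u) &
      forall u U, lc_nbhs (@LF_seminorms R M) (phi u) U ->
                  Dirac_nbhs u (phi @^-1` U)].

Definition dual_real : set (Dirac -> Ccinf M) :=
  [set phi | is_dual phi /\ forall u, cconj (phi (Dirac_conj u)) = phi u].

Notation DR := (set_type dual_real).

Definition convolution (phi psi : Dirac -> Ccinf M) (u : Dirac) : Ccinf M :=
  \sum_(p <- repr (comult u)) cmul (phi p.1) (psi p.2).

(* The real dual is closed under sums, real multiples and convolution, so the
   conditions below say that [chi] is a nonzero homomorphism of real
   algebras. *)
Definition is_character (chi : DR -> R) :=
  [/\ forall phi psi theta : DR,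
        (forall u, set_val theta u = set_val phi u + set_val psi u) ->
        chi theta = chi phi + chi psi,
      forall (r : R) (phi theta : DR),
        (forall u, set_val theta u = r%:C *: set_val phi u) ->
        chi theta = r * chi phi,
      forall phi psi theta : DR,
        set_val theta = convolution (set_val phi) (set_val psi) ->
        chi theta = chi phi * chi psi &
      exists phi, chi phi != 0].

Definition characters : set (DR -> R) := is_character.

Definition spec_eval (chi : set_type characters) : {ptws DR -> R} :=
  set_val chi.

Definition spec : topologicalType := initial_topology spec_eval.

(* An atlas on the spectrum defining its natural smooth structure. *)
Definition natural_atlas n (S : set (chart R spec n)) :=
  is_manifold (ChartedSpace S) /\
  forall h : spec -> R, @smooth_real R (ChartedSpace S) h <->
    exists phi : DR, forall chi, h chi = spec_eval chi phi.

Definition Theta_spec (Theta : Esp -> spec) :=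
  forall (e : Esp) (y : N) (f : Ccinf M), germ_is_one (pi_sp e) f ->
    Esp_val e = existT fiber (pi_sp e) (fiber_class (pi_sp e) (dirac y f)) ->
    forall phi : DR,
      (spec_eval (Theta e) phi)%:C = set_val phi (dirac y f) (pi_sp e).

(* The transport of the topology and of the smooth structure of the spectrum
   along the bijection [Theta]. *)
Definition spectral_bundle (Theta : Esp -> spec) n (S : set (chart R spec n))
  : charted_space R :=
  @ChartedSpace R (initial_topology Theta) n
    [set c : chart R (initial_topology Theta) n | exists2 d, S d &
       [/\ chart_dom c = Theta @^-1` chart_dom d,
           chart_map c = chart_map d \o Theta &
           Theta \o chart_inv c = chart_inv d]].

End Dirac.

(* Main.v *)
Require Import Defs.
From HB Require Import structures.
From mathcomp Require Import all_boot all_order all_algebra ring_quotient.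
From mathcomp Require Import all_classical all_reals all_analysis.
From mathcomp.real_closed Require Import complex.
From mathcomp Require Import ring lra.

(** The composite of [Phi] with [Theta] sends a point [p] of the product to the
    evaluation at [p] on the real dual (lemma [Theta_Phi]). The theorem follows
    once the real dual is known to be the algebra of smooth real functions on
    the product, and its characters to be the evaluations.

    The fibres. Points of [N] are separated by smooth functions, so each
    coefficient of an element of the span of the [dirac y f] is its value at a
    suitable test function ([select_coefficient]); therefore the class in the
    fibre at [x] is given by the germs at [x] of the values ([fiber_classP]).
    The comultiplication is dual to the product of test functions. Hence a
    group-like class is multiplicative, its coefficients have idempotent germs,
    and it is the class of a single [dirac y f] with [f] of germ one
    ([grouplike_dirac], [dirac_grouplike]). Thus [Phi] is onto the total space.

    The dual. An element [phi] of the dual is evaluation at a function on the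
    product, its [symbol]. The main difficulty is to see that the symbol is
    smooth in both variables together, given only that [phi] is continuous for
    uniform convergence on bounded sets. In charts, continuity says that a
    finite combination of values [h w] of the symbol, or of one of its
    derivatives in the first variable, is bounded in terms of the same
    combinations of the values [g w] for [g] in a family that is bounded with all derivatives
    ([dual_slice_dominated]). For such a dominated [h], the difference quotients
    satisfy the Cauchy estimates of the family, so [h] is differentiable
    ([dominated_quotient]), and its derivatives are dominated by the derivatives
    of the family ([dominated_derive]). Derivatives in the two variables
    commute, and joint smoothness follows by induction ([tame_smooth]).

    The spectrum. A character of the smooth functions is an evaluation, by the
    classical argument with an exhaustion function
    ([character_is_evaluation]). Bump functions show that the weak topology is
    the topology of the product, so the atlas of the product is transported to
    a natural atlas of the spectrum ([natural_atlas_exists]). Finally, in any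
    natural atlas the smooth functions are those of the dual, and a map is
    smooth as soon as it pulls smooth functions back to smooth functions
    ([smooth_map_pullback]); so [point], and with it [Phi], is a
    diffeomorphism. *)

Set Implicit Arguments.
Unset Strict Implicit.
Unset Printing Implicit Defensive.

Import Order.TTheory GRing.Theory Num.Theory.
Import numFieldNormedType.Exports.

Local Open Scope classical_set_scope.
Local Open Scope ring_scope.
Local Open Scope complex_scope.
Local Open Scope quotient_scope.

(** * Calculus on open sets of coordinate spaces *)
Section Calculus.
Variable R : realType.

(** A directional derivative is the derivative of a function of one variable,
    so that the mean value theorem applies along segments. *)
Lemma is_derive_line (V : normedModType R) (f : V -> R) (v z : V) (t a : R) :
  is_derive (t *: v + z) v f a <-> is_derive t 1 (fun s => f (s *: v + z)) a.
Proof.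
have E : (fun h : R => h^-1 *: ((f \o shift (t *: v + z)) (h *: v)
             - f (t *: v + z))) =
  (fun h : R => h^-1 *: (((fun s => f (s *: v + z)) \o shift t) (h *: 1)
             - f (t *: v + z))).
  apply/funext => h /=; congr (_ *: (f _ - _)).
  by rewrite scalerDl addrA [h *: 1]mulr1.
have D : derivable f (t *: v + z) v = derivable (fun s : R => f (s *: v + z)) t 1.
  by rewrite /derivable E.
have D' : 'D_v f (t *: v + z) = 'D_1 (fun s : R => f (s *: v + z)) t.
  by rewrite /derive E.
split=> -[d1 d2]; apply: DeriveDef.
- by rewrite -D.
- by rewrite -D'.
- by rewrite D.
- by rewrite D'.
Qed.

Lemma is_derive_comp1 (V : normedModType R) (f : R -> R) (g : V -> R) (v z : V) (a b : R) :
  is_derive (g z) 1 f a -> is_derive z v g b -> is_derive z v (f \o g) (a * b).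
Proof.
move=> df dg; have z0 : z = 0 *: v + z by rewrite scale0r add0r.
rewrite z0; apply: (is_derive_line (f \o g) v z 0 _).2.
apply: (@is_derive1_comp _ f (fun s => g (s *: v + z))); first by rewrite -z0.
by apply: (is_derive_line g v z 0 _).1; rewrite -z0.
Qed.

Lemma CkW n (U V : set 'rV[R]_n) k f : V `<=` U -> Ck U k f -> Ck V k f.
Proof.
move=> VU; elim: k f => [|k IH] f [cf df]; first by split=> // z /VU/cf.
split=> [z /VU/cf//|i].
by have [d1 d2] := df i; split=> [z /VU/d1//|]; exact: IH.
Qed.

Lemma Ck_local n (U : set 'rV[R]_n) k f :
  (forall z, U z -> exists V g, [/\ open V, V z, Ck V k g &
     forall w, V w -> f w = g w]) -> Ck U k f.
Proof.
move=> H; have {}H z : U z -> exists V, [/\ open V, V z & Ck V k f].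
  move=> /H[V [g [oV Vz kg fg]]]; exists V; split=> //.
  by apply: eq_Ck kg => // w /fg.
elim: k f H => [|k IH] f H.
  by split=> // z /H[V [oV Vz [cf _]]]; exact: cf.
split=> [z /H[V [oV Vz [cf _]]]|i]; first exact: cf.
split=> [z /H[V [oV Vz [_ df]]]|]; first exact: (df i).1.
by apply: IH => z /H[V [oV Vz [_ df]]]; exists V; split=> //; exact: (df i).2.
Qed.

Lemma CkN n (U : set 'rV[R]_n) k f : open U -> Ck U k f -> Ck U k (fun z => - f z).
Proof.
move=> oU kf; apply: (eq_Ck (f := cst (-1) * f)) => //.
  by move=> z _; rewrite !fctE /= mulN1r.
by apply: CkM => //; exact: Ck_cst.
Qed.

Lemma Ck_sum n (U : set 'rV[R]_n) k (I : Type) (s : seq I) f : open U ->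
  (forall i, Ck U k (f i)) -> Ck U k (fun z => \sum_(i <- s) f i z).
Proof.
move=> oU kf; elim: s => [|i s IH].
  by apply: eq_Ck (Ck_cst U k 0) => // z _; rewrite big_nil.
by apply: eq_Ck (CkD oU (kf i) IH) => // z _; rewrite big_cons.
Qed.

Lemma CkV n (U : set 'rV[R]_n) k f : open U -> (forall z, U z -> f z != 0) ->
  Ck U k f -> Ck U k (fun z => (f z)^-1).
Proof.
move=> oU f0; elim: k => [|k IH] kf.
  split=> // z Uz; apply: continuousV; [exact: f0|exact: kf.1].
have kf' := CkS kf; have kv := IH kf'; case: kf => cf df.
split=> [z Uz|i]; first by apply: continuousV; [exact: f0|exact: cf].
have [d1 d2] := df i; split=> [z Uz|].
  by apply: derivableV; [exact: f0|exact: d1].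
apply: (eq_Ck (f := (fun z => - ((f z)^-1 * (f z)^-1)) * (fun z => 'D_(basis_vec R i) f z))) => //.
  by move=> z Uz; rewrite deriveV ?f0//; [rewrite /= fctE expr2 invfM|exact: d1].
by apply: CkM => //; apply: CkN => //; exact: CkM.
Qed.

Definition smooth1 (f : R -> R) := forall k t, derivable (derive1n k f) t 1.

Lemma smooth1D f : smooth1 f -> smooth1 (derive1 f).
Proof. by move=> sf k t; rewrite -derive1Sn; exact: sf. Qed.

Lemma Ck_comp1 n (U : set 'rV[R]_n) k f g : open U ->
  smooth1 f -> Ck U k g -> Ck U k (f \o g).
Proof.
move=> oU; elim: k f => [|k IH] f sf kg.
all: have cfg z : U z -> {for z, continuous (f \o g)}.
1,3: move=> Uz; apply: continuous_comp; first exact: kg.1.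
1,2: by apply/differentiable_continuous/derivable1_diffP; exact: (sf 0).
  by [].
have kg' := CkS kg.
split=> // i; have [d1 d2] := kg.2 i.
have D z : U z -> is_derive z (basis_vec R i) (f \o g) ((derive1 f) (g z) * 'D_(basis_vec R i) g z).
  move=> Uz; apply: is_derive_comp1; last by apply: DeriveDef => //; exact: d1.
  by apply: DeriveDef; [exact: (sf 0)|rewrite derive1E].
split=> [z /D[]//|].
apply: (eq_Ck (f := ((derive1 f) \o g) * (fun z => 'D_(basis_vec R i) g z))) => //.
  by move=> z /D[_ ->].
by apply: CkM => //; apply: IH => //; exact: smooth1D.
Qed.

End Calculus.

(** * Flat functions and smooth steps *)
Section Flat.
Variable R : realType.

(** The powers of [t] make the linear combinations of these functions a class
    that is stable under differentiation. *)
Definition flat (k : nat) (t : R) : R :=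
  if 0 < t then t ^- k * expR (- t^-1) else 0.

Lemma flat_ge0 k t : 0 <= flat k t.
Proof.
rewrite /flat; case: ifPn => // t0.
by rewrite mulr_ge0 ?expR_ge0// invr_ge0 exprn_ge0// ltW.
Qed.

Lemma flat_gt0 k t : 0 < t -> 0 < flat k t.
Proof. by move=> t0; rewrite /flat t0 mulr_gt0 ?expR_gt0// invr_gt0 exprn_gt0. Qed.

Lemma flat_eq0 k t : t <= 0 -> flat k t = 0.
Proof. by rewrite leNgt /flat => /negbTE ->. Qed.

(** The exponential of [t^-1] is at least the term of order [k + 2] of its
    series. A quadratic bound is what a zero derivative at [0] requires. *)
Lemma flat_le k t : flat k t <= k.+2`!%:R * t ^+ 2.
Proof.
have [t0|t0] := ltP 0 t; last by rewrite flat_eq0// mulr_ge0 ?sqr_ge0.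
rewrite /flat t0 expRN ler_pdivrMr ?expR_gt0//.
have tV : 0 <= t^-1 by rewrite invr_ge0 ltW.
apply: le_trans (_ : k.+2`!%:R * t ^+ 2 * (1 + t^-1 ^+ k.+2 / k.+2`!%:R) <= _); last first.
  by rewrite ler_wpM2l ?expR_ge1Dxn// mulr_ge0 ?sqr_ge0.
rewrite mulrDr mulr1.
have -> : k.+2`!%:R * t ^+ 2 * (t^-1 ^+ k.+2 / k.+2`!%:R) = t ^- k.
  have tn0 : t != 0 by rewrite gt_eqF.
  have Fn0 : k.+2`!%:R != 0 :> R by rewrite pnatr_eq0 -lt0n fact_gt0.
  rewrite exprVn !exprS; field.
  by rewrite tn0 Fn0 expf_neq0.
by rewrite lerDr mulr_ge0 ?sqr_ge0.
Qed.

Lemma is_derive_sqr_bound (f : R -> R) C : f 0 = 0 ->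
  (forall h, `|f h| <= C * h ^+ 2) -> is_derive (0 : R) 1 f 0.
Proof.
move=> f0 fC.
have L : h^-1 *: ((f \o shift 0) (h *: 1) - f 0) @[h --> 0^'] --> (0 : R).
  apply/cvgrPdist_lt => e e0; near=> h.
  rewrite sub0r normrN f0 subr0 /= addr0 [h *: 1]mulr1 normrM normfV.
  rewrite ltr_pdivrMl ?normr_gt0; last by near: h; exact: nbhs_dnbhs_neq.
  apply: le_lt_trans (fC h) _; rewrite -real_normK ?num_real// expr2 mulrA mulrC.
  rewrite ltr_pM2l ?normr_gt0; last by near: h; exact: nbhs_dnbhs_neq.
  have C1 : 0 < `|C| + 1 by rewrite ltr_wpDl.
  have : `|h| < e / (`|C| + 1).
    near: h; apply: dnbhs0_lt; exact: divr_gt0.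
  rewrite ltr_pdivlMr//; apply: le_lt_trans.
  by rewrite mulrC ler_wpM2l// (le_trans (ler_norm _))// lerDl.
by apply: DeriveDef; [apply/cvg_ex; exists 0|apply/cvg_lim].
Unshelve. all: by end_near. Qed.

Lemma is_derive_flat k (t : R) :
  is_derive t 1 (flat k) (- k%:R * flat k.+1 t + flat k.+2 t).
Proof.
have [t0|t0|->] := ltgtP t 0; last first.
- rewrite !flat_eq0// mulr0 addr0.
  apply: (@is_derive_sqr_bound _ k.+2`!%:R); first exact: flat_eq0.
  by move=> h; rewrite ger0_norm ?flat_ge0 ?flat_le.
- have D : is_derive t 1 (fun t : R => (t ^+ k)^-1 * expR (- t^-1))
      (- k%:R * flat k.+1 t + flat k.+2 t).
    have tn0 : t != 0 by rewrite gt_eqF.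
    have tk0 : t ^+ k != 0 by rewrite expf_neq0.
    have dV : is_derive t 1 (fun t : R => t^-1) (- t ^- 2 *: 1).
      by apply: is_deriveV.
    have dE : is_derive t 1 (fun t : R => expR (- t^-1)) (expR (- t^-1) * - (- t ^- 2 *: 1)).
      by apply: (@is_derive1_comp R expR (fun t : R => - t^-1)).
    have dk : is_derive t 1 (fun t : R => (t ^+ k)^-1) (- (t ^+ k) ^- 2 *: (k%:R * t ^+ k.-1 *: 1)).
      apply: (@is_deriveV R (fun t : R => t ^+ k)) => //.
      by apply: DeriveDef; [exact: exprn_derivable|rewrite exp_derive /GRing.scale /= !mulr1].
    apply: is_derive_eq.
    rewrite /flat t0 /GRing.scale /=.
    case: k {dk} tk0 => [|k] tk0; first by rewrite !expr0 !(mul0r,mulr0,oppr0,invr1,addr0,add0r,mul1r,mulr1) opprK mulrC.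
    rewrite !exprS /=; field.
    by rewrite tn0 expf_neq0.
  split.
    apply: near_eq_derivable (@ex_derive _ _ _ _ _ _ _ D).
    by near=> s; rewrite /flat ifT//; near: s; exact: lt_nbhsr.
  rewrite -(@derive_val _ _ _ _ _ _ _ D); apply: near_eq_derive.
  by near=> s; rewrite /flat ifT//; near: s; exact: lt_nbhsr.
- rewrite (flat_eq0 k.+1) ?(flat_eq0 k.+2) ?ltW// mulr0 addr0.
  have D : is_derive t 1 (fun=> 0 : R) (0 : R) by exact: is_derive_cst.
  split.
    apply: near_eq_derivable (@ex_derive _ _ _ _ _ _ _ D).
    by near=> s; rewrite flat_eq0// ltW//; near: s; exact: lt_nbhsl.
  rewrite -(@derive_val _ _ _ _ _ _ _ D); apply: near_eq_derive.
  by near=> s; rewrite flat_eq0// ltW//; near: s; exact: lt_nbhsl.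
Unshelve. all: by end_near. Qed.

(** The induction on the order of differentiation is over all linear
    combinations of the functions [flat k], since the derivative of one of them
    involves two others. *)
Lemma smooth1_flat k : smooth1 (flat k).
Proof.
pose L (s : seq (R * nat)) : R -> R := \sum_(p <- s) p.1 *: flat p.2.
have dL s (t : R) : is_derive t 1 (L s)
    (L (flatten [seq [:: (- p.1 * p.2%:R, p.2.+1); (p.1, p.2.+2)] | p <- s]) t).
  rewrite /L; elim: s => [|[a i] s IH] /=.
    by rewrite !big_nil; exact: is_derive_cst.
  rewrite !big_cons /=.
  have := is_deriveD (is_deriveZ a (is_derive_flat i t)) IH.
  move=> H; apply: (is_derive_eq H).
  by rewrite !fctE /GRing.scale /=; ring.
have DL s : derive1 (L s) = L (flatten [seq [:: (- p.1 * p.2%:R, p.2.+1); (p.1, p.2.+2)] | p <- s]).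
  by apply/funext => t; rewrite derive1E derive_val.
have -> : flat k = L [:: (1, k)] by rewrite /L big_seq1 scale1r.
move=> n; elim: n ([:: (1, k)]) => [|n IH] s t.
  by have [] := dL s t.
by rewrite derive1Sn DL; exact: IH.
Qed.

(** The denominator does not vanish, because [t] and [1 - t] are not both
    nonpositive. *)
Definition step (t : R) : R := flat 0 t / (flat 0 t + flat 0 (1 - t)).

Lemma step_den_gt0 t : 0 < flat 0 t + flat 0 (1 - t).
Proof.
have [t0|t0] := ltP 0 t; first by rewrite ltr_pwDl ?flat_gt0 ?flat_ge0.
by rewrite ltr_wpDl ?flat_ge0 ?flat_gt0// subr_gt0 (le_lt_trans t0).
Qed.

Lemma step_eq0 t : t <= 0 -> step t = 0.
Proof. by move=> t0; rewrite /step flat_eq0// mul0r. Qed.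

Lemma step_eq1 t : 1 <= t -> step t = 1.
Proof.
move=> t1; have := step_den_gt0 t.
rewrite /step (flat_eq0 _ (_ : 1 - t <= 0)) ?subr_le0// addr0 => t0.
by rewrite divff// gt_eqF.
Qed.

Lemma step_ge0 t : 0 <= step t.
Proof. by rewrite /step mulr_ge0 ?flat_ge0// invr_ge0 ltW// step_den_gt0. Qed.

Lemma step_le1 t : step t <= 1.
Proof. by rewrite /step ler_pdivrMr ?step_den_gt0// mul1r lerDl flat_ge0. Qed.

Lemma Ck_step n (U : set 'rV[R]_n) k g : open U ->
  Ck U k g -> Ck U k (step \o g).
Proof.
move=> oU kg.
have kg1 : Ck U k (fun z => 1 - g z).
  by apply: (eq_Ck (f := cst 1 + (fun z => - g z))) => //; apply: CkD => //;
    [exact: Ck_cst|exact: CkN].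
have kf : Ck U k (flat 0 \o g) by apply: Ck_comp1 => //; exact: smooth1_flat.
have kf1 : Ck U k (flat 0 \o (fun z => 1 - g z)).
  by apply: Ck_comp1 => //; exact: smooth1_flat.
apply: (eq_Ck (f := (flat 0 \o g) * (fun z => (((flat 0 \o g) + (flat 0 \o (fun z => 1 - g z))) z)^-1))) => //.
apply: CkM => //; apply: CkV => //; last exact: CkD.
by move=> z _; rewrite gt_eqF// step_den_gt0.
Qed.

End Flat.

(** * Bump functions, exhaustion and characters on a manifold *)
Section Bumps.
Variable R : realType.

Lemma chart_image_preimage T n (c : chart R T n) A : is_chart c ->
  c @` (chart_dom c `&` A) = chart_img c `&` chart_inv c @^-1` A.
Proof.
move=> Hc; apply/seteqP; split=> [_ [x [cx Ax] <-]|_ [[x cx <-]]] /=.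
  by split; [exists x|rewrite /= (chartK Hc)].
by rewrite /= (chartK Hc)// => Ax; exists x.
Qed.

Lemma chart_image_open T n (c : chart R T n) A : is_chart c -> open A ->
  open (c @` (chart_dom c `&` A)).
Proof.
move=> Hc oA; rewrite chart_image_preimage// openE => z [iz /= Az].
apply: filterI; first by apply: open_nbhs_nbhs; split=> //; exact: chart_img_open Hc.
by apply: (chart_inv_continuous Hc iz); exact: open_nbhs_nbhs.
Qed.

Variable X : manifold R.
Implicit Types f g : X -> R.

Lemma manifold_is_chart (c : chart R X (Defs.dim X)) : atlas c -> is_chart c.
Proof. exact: (manifold_charts (manifoldP X)). Qed.

Lemma smooth_real_local f :
  (forall x, exists A g, [/\ open A, A x, smooth_real g &
     forall y, A y -> f y = g y]) -> smooth_real f.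
Proof.
move=> H c Xc k; apply: Ck_local => _ [x cx <-].
have [A [g [oA Ax sg fg]]] := H x.
exists (c @` (chart_dom c `&` A)), (local_rep c g); split.
- exact: chart_image_open (manifold_is_chart Xc) oA.
- by exists x.
- by apply: CkW (sg _ Xc k) => _ [y [cy _] <-]; exists y.
- by rewrite (chart_image_preimage _ (manifold_is_chart Xc)) => z [_ /= Az]; exact: fg.
Qed.

Lemma smooth_real_continuous f : smooth_real f -> continuous f.
Proof.
move=> sf x; have [c Xc cx] := manifold_cover (manifoldP X) x.
have icx : chart_img c (c x) by exists x.
have /(_ _ icx) cf := Ck_continuous (sf _ Xc 0).
apply: (near_eq_continuous (f := local_rep c f \o c)).
  have : nbhs x (chart_dom c).
    by apply: open_nbhs_nbhs; split=> //; exact: chart_dom_open (manifold_is_chart Xc).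
  by apply: filterS => y cy; rewrite /local_rep /= (chartK (manifold_is_chart Xc)).
by apply: continuous_comp cf; exact: (chart_continuous (manifold_is_chart Xc)).
Qed.

Lemma smooth_real_gt0_near f x : smooth_real f -> 0 < f x ->
  nbhs x [set y | 0 < f y].
Proof.
by move=> sf f0; have H := smooth_real_continuous sf (x := x); exact: (H _ (lt_nbhsr f0)).
Qed.

(** Extension by zero: the domain of [d] and the complement of [K] form an open
    cover. *)
Lemma smooth_ext0 d (K : set X) f : atlas d -> closed K -> K `<=` chart_dom d ->
  (forall x, ~ K x -> f x = 0) ->
  (forall c, atlas c ->
     smooth_on (c @` (chart_dom c `&` chart_dom d)) (local_rep c f)) ->
  smooth_real f.
Proof.
move=> Xd cK Kd f0 sf c Xc k; apply: Ck_local => _ [x cx <-].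
have [dx|dx] := pselect (chart_dom d x).
  exists (c @` (chart_dom c `&` chart_dom d)), (local_rep c f); split=> //.
  - exact: chart_image_open (manifold_is_chart Xc) (chart_dom_open (manifold_is_chart Xd)).
  - by exists x.
  - exact: sf.
exists (c @` (chart_dom c `&` ~` K)), (cst 0); split.
- by apply: chart_image_open (manifold_is_chart Xc) _; exact: closed_openC.
- by exists x => //; split=> // /Kd.
- exact: Ck_cst.
- by rewrite (chart_image_preimage _ (manifold_is_chart Xc)) => z [_ /= Az]; exact: f0.
Qed.

Lemma ler_sqr_norm (a b : R) : 0 <= b -> (a ^+ 2 <= b ^+ 2) = (`|a| <= b).
Proof. by move=> b0; rewrite -[a ^+ 2]real_normK ?num_real// ler_sqr ?nnegrE. Qed.

Lemma closed_box_compact n (p : 'rV[R]_n) (r : R) :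
  compact [set w : 'rV[R]_n | forall j, `|w ord0 j - p ord0 j| <= r].
Proof.
pose A (j : 'I_n) := `[p ord0 j - r, p ord0 j + r]%classic.
rewrite (_ : [set _ | _] = [set v : 'rV[R]_n | forall j, A j (v ord0 j)]).
  by apply: rV_compact => j; exact: segment_compact.
by apply/seteqP; split=> w H j; have := H j; rewrite /A /= in_itv /= ler_distl.
Qed.

(** In a chart, [2 - |w - p|^2 / r^2] is at least one near [p] and negative
    outside a compact box; [step] turns it into a plateau. *)
Lemma exists_bump_in d (x0 : X) (V : set X) :
  atlas d -> chart_dom d x0 -> nbhs x0 V ->
  exists (b : X -> R) (K : set X), [/\ smooth_real b,
    forall x, 0 <= b x <= 1, \forall x \near x0, b x = 1,
    compact K /\ K `<=` V `&` chart_dom d & forall x, ~ K x -> b x = 0].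
Proof.
move=> Xd dx0 Vx0; have Hd := manifold_is_chart Xd; set p := d x0.
have ip : chart_img d p by exists x0.
have : nbhs p (chart_img d `&` chart_inv d @^-1` V).
  apply: filterI; first by apply: open_nbhs_nbhs; split=> //; exact: chart_img_open Hd.
  by apply: (chart_inv_continuous Hd ip); rewrite (chartK Hd).
move=> /nbhs_ballP[e /= e0 eV].
pose r := e / 4; have r0 : 0 < r by rewrite divr_gt0.
pose B := [set w : 'rV[R]_(Defs.dim X) | forall j, `|w ord0 j - p ord0 j| <= 2 * r].
have BV : B `<=` chart_img d `&` chart_inv d @^-1` V.
  move=> w Bw; apply: eV; split=> // i j; rewrite (ord1 i) /ball /= distrC.
  by apply: le_lt_trans (Bw j) _; rewrite /r; lra.
pose q (x : X) := 2 - \sum_j ((d x ord0 j - p ord0 j) / r) ^+ 2.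
pose b x := if `[< chart_dom d x >] then step (q x) else 0.
pose K := chart_inv d @` B.
have cptK : compact K.
  apply: continuous_compact; last exact: closed_box_compact.
  apply: continuous_in_subspaceT => w /set_mem /BV[iw _].
  exact: (chart_inv_continuous Hd).
have b0 x : ~ K x -> b x = 0.
  move=> Kx; rewrite /b; case: asboolP => // dx; apply: step_eq0.
  rewrite leNgt; apply/negP => qx; apply: Kx; exists (d x); last exact: (chartK Hd).
  move=> j; have : ((d x ord0 j - p ord0 j) / r) ^+ 2 <= 2 ^+ 2.
    apply: le_trans (_ : 2 <= _); last by rewrite expr2; lra.
    move: qx; rewrite /q subr_gt0 => /ltW; apply: le_trans.
    rewrite (bigD1 j) //= lerDl; apply: sumr_ge0 => i _; exact: sqr_ge0.
  by rewrite ler_sqr_norm// normrM normfV (gtr0_norm r0) ler_pdivrMr.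
exists b, K; split=> //.
- apply: (smooth_ext0 Xd (K := K)) => //.
  + by apply: compact_closed cptK; exact: manifold_hausdorff (manifoldP X).
  + by move=> _ [w /BV[[x dx <-] _] <-]; rewrite (chartK Hd).
  move=> c Xc k; have oW := chart_image_open (manifold_is_chart Xc) (chart_dom_open Hd).
  pose g z := local_rep c q z.
  apply: (eq_Ck (f := @step R \o g)) => //.
    move=> z; rewrite (chart_image_preimage _ (manifold_is_chart Xc)) => -[_ dz].
    by rewrite /local_rep /= /b; case: asboolP.
  apply: Ck_step => //.
  pose t j z := (local_rep c (fun x => d x ord0 j) z - p ord0 j) / r.
  apply: (eq_Ck (f := cst 2 + (fun z => - \sum_j (t j * t j) z))) => //.
  apply: CkD => //; first exact: Ck_cst.
  apply: CkN => //; apply: Ck_sum => // j.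
  have kt : Ck (c @` (chart_dom c `&` chart_dom d)) k (t j).
    apply: (eq_Ck (f := (local_rep c (fun x => d x ord0 j) + cst (- p ord0 j)) * cst r^-1)) => //.
    apply: CkM => //; last exact: Ck_cst.
    apply: CkD => //; last exact: Ck_cst.
    exact: manifold_compatible (manifoldP X) _ _ Xc Xd j k.
  exact: CkM.
- by move=> x; rewrite /b; case: ifP; rewrite ?step_ge0 ?step_le1 ?lexx ?ler01.
- have : nbhs p [set w : 'rV[R]_(Defs.dim X) | forall j, `|w ord0 j - p ord0 j| <= r / (Defs.dim X).+1%:R].
    apply/nbhs_ballP; exists (r / (Defs.dim X).+1%:R) => /=; first by rewrite divr_gt0.
    by move=> w [_ pw] j; rewrite distrC ltW//; exact: pw.
  move=> /(chart_continuous Hd dx0) near_p.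
  have : nbhs x0 (chart_dom d).
    by apply: open_nbhs_nbhs; split=> //; exact: chart_dom_open Hd.
  apply: filterS2 (near_p : nbhs x0 (d @^-1` _)) => x /= px dx.
  rewrite /b; case: asboolP => // _; apply: step_eq1.
  rewrite /q lerBrDl -lerBrDr.
  have -> : 2 - 1 = 1 :> R by lra.
  apply: le_trans (_ : \sum_(j < Defs.dim X) (Defs.dim X).+1%:R^-1 <= _).
    apply: ler_sum => j _; apply: le_trans (_ : (Defs.dim X).+1%:R^-1 ^+ 2 <= _).
      rewrite ler_sqr_norm// normrM normfV (gtr0_norm r0) ler_pdivrMr//.
      by rewrite mulrC.
    by rewrite expr2 ler_piMr ?invr_ge0// invf_le1// ler1n.
  rewrite sumr_const card_ord -[_ *+ _]mulr_natr mulrC ler_pdivrMr// mul1r ler_nat.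
  by [].
- split=> // _ [w Bw <-]; have [[x dx <-] Vw] := BV _ Bw.
  by split=> //; rewrite (chartK Hd).
Qed.

Lemma exists_bump (x0 : X) (V : set X) : nbhs x0 V ->
  exists (b : X -> R) (K : set X), [/\ smooth_real b,
    forall x, 0 <= b x <= 1, \forall x \near x0, b x = 1,
    compact K /\ K `<=` V & forall x, ~ K x -> b x = 0].
Proof.
move=> Vx; have [d Xd dx] := manifold_cover (manifoldP X) x0.
have [b [K [? ? ? [cK KV] ?]]] := exists_bump_in Xd dx Vx.
by exists b, K; split=> //; split=> // x /KV[].
Qed.

(** Cutting off a coordinate of a chart makes it a smooth function on the whole
    manifold. *)
Lemma smooth_bump_coord d (K : set X) b j : atlas d -> compact K ->
  K `<=` chart_dom d -> (forall x, ~ K x -> b x = 0) -> smooth_real b ->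
  smooth_real (fun x => b x * d x ord0 j).
Proof.
move=> Xd cK Kd b0 sb; apply: (smooth_ext0 Xd (K := K)) => //.
- by apply: compact_closed cK; exact: manifold_hausdorff (manifoldP X).
- by move=> x /b0 ->; rewrite mul0r.
move=> c Xc k; have oW := chart_image_open (manifold_is_chart Xc) (chart_dom_open (manifold_is_chart Xd)).
apply: (@CkM _ _ _ k (local_rep c b)) => //; last first.
  exact: manifold_compatible (manifoldP X) _ _ Xc Xd j k.
by apply: CkW (sb _ Xc k) => _ [y [cy _] <-]; exists y.
Qed.

Lemma smooth_realV f : (forall x, f x != 0) -> smooth_real f ->
  smooth_real (fun x => (f x)^-1).
Proof.
move=> f0 sf c Xc k; apply: (@CkV _ _ _ k (local_rep c f)).
- exact: chart_img_open (manifold_is_chart Xc).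
- by move=> z _; exact: f0.
- exact: sf.
Qed.

Lemma smooth_real_sum (I : Type) (s : seq I) (F : I -> X -> R) :
  (forall i, smooth_real (F i)) -> smooth_real (fun x => \sum_(i <- s) F i x).
Proof.
move=> sF; elim: s => [|i s IH].
  rewrite (_ : (fun x => _) = fun=> 0); first exact: smooth_real_cst.
  by apply/funext => x; rewrite big_nil.
rewrite (_ : (fun x => _) = fun x => F i x + \sum_(j <- s) F j x).
  exact: smooth_realD.
by apply/funext => x; rewrite big_cons.
Qed.

Lemma smooth_realB f g : smooth_real f -> smooth_real g ->
  smooth_real (fun x => f x - g x).
Proof. by move=> sf sg; apply: smooth_realD => //; exact: smooth_realN. Qed.

(** This replaces the extraction of finite subcovers: what is obtained by
    combining finitely many local choices is proved for the union of two sets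
    at a time. *)
Lemma compact_ind (P : set X -> Prop) (K : set X) : compact K ->
  P set0 -> (forall A B, A `<=` B -> P B -> P A) ->
  (forall A B, P A -> P B -> P (A `|` B)) ->
  (forall x, K x -> exists2 A, nbhs x A & P A) -> P K.
Proof.
(* The collections that contain all subsets of some set with property [P] form
   a filter, to which the covering property of [K] applies. *)
move=> /compact_near_coveringP cK P0 PS PU Ploc.
pose F : set_system (set X) := [set S | exists2 B, P B & forall A, B `<=` A -> S A].
have FF : Filter F.
  split; first by exists set0.
  - move=> S T [A PA SA] [B PB TB]; exists (A `|` B); first exact: PU.
    by move=> C; rewrite subUset => -[? ?]; split; [exact: SA|exact: TB].
  - by move=> S T ST [B PB SB]; exists B => // A /SB/ST.
have [x Kx|B PB /(_ B)KB] := cK _ F (fun A x => A x) FF.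
  have [A nA PA] := Ploc x Kx; exists (A, [set B | A `<=` B]).
    by split=> //; exists A.
  by move=> [y B] [/= Ay]; apply.
by apply: PS PB; exact: KB.
Qed.

(** The value one is required near the points of [A], so that at these points
    the germ of [g] is one. For [A = set0] only smoothness, range and compact
    support are left. *)
Definition plateau (A : set X) (g : X -> R) (L : set X) :=
  [/\ smooth_real g, forall x, 0 <= g x <= 1, compact L,
      forall x, ~ L x -> g x = 0 & forall x, A x -> \forall y \near x, g y = 1].

(** Plateaux [g] and [h] over two sets are glued by [1 - (1 - g) * (1 - h)],
    which equals one wherever one of them does. *)
Lemma compact_plateau (K : set X) : compact K -> exists g L, plateau K g L.
Proof.
move=> cK; apply: (compact_ind (P := fun A => exists g L, plateau A g L)) cK _ _ _ _.
- exists (fun=> 0), set0; split=> //; first exact: smooth_real_cst.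
    by move=> x; rewrite lexx ler01.
  exact: compact0.
- by move=> A B AB [g [L [? ? ? ? gB]]]; exists g, L; split=> // x /AB/gB.
- move=> A B [g [L [sg g01 cL g0 g1]]] [h [L' [sh h01 cL' h0 h1]]].
  exists (fun x => 1 - (1 - g x) * (1 - h x)), (L `|` L'); split.
  + apply: smooth_realB; first exact: smooth_real_cst.
    by apply: smooth_realM; apply: smooth_realB => //; exact: smooth_real_cst.
  + move=> x; have /andP[g0x g1x] := g01 x; have /andP[h0x h1x] := h01 x.
    by apply/andP; split; nra.
  + exact: compactU.
  + move=> x /not_orP[Lx L'x]; rewrite g0// h0//; ring.
  + move=> x [/g1|/h1]; apply: filterS => y ->; ring.
- move=> x Kx; have [b [L [sb b01 b1 [cL _] b0]]] := exists_bump (@filterT _ (nbhs x) _).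
  exists [set y | b y = 1]°; first exact: nbhs_interior.
  by exists b, L; split=> // y; exact.
Qed.

(** Second countability allows choosing one bump function for each basic open
    set on which some bump function equals one, instead of one for each
    point. *)
Lemma countable_plateaux : exists (b : nat -> X -> R) (L : nat -> set X),
  (forall n, plateau set0 (b n) (L n)) /\
  forall x : X, exists n, \forall y \near x, b n y = 1.
Proof.
have [B cB [oB bB]] := manifold_second_countable (manifoldP X).
have /countable_injP[i inji] := cB.
pose e n := xget set0 [set U | B U /\ i U = n].
have eU U : B U -> e (i U) = U.
  move=> BU; apply: xget_unique; first by [].
  by move=> V [BV] /inji; apply; rewrite inE.
have : forall n, exists bL : (X -> R) * set X, plateau set0 bL.1 bL.2 /\
   ((exists g L, plateau set0 g L /\ forall x, e n x -> g x = 1) ->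
     forall x, e n x -> bL.1 x = 1).
  move=> n; have [[g [L [gL g1]]]|H] := pselect (exists g L, plateau set0 g L /\ forall x, e n x -> g x = 1).
    by exists (g, L).
  exists ((fun=> 0), set0); split=> //; split=> //; first exact: smooth_real_cst.
    by move=> x; rewrite lexx ler01.
  exact: compact0.
move=> /choice[bL bLP].
exists (fun n => (bL n).1), (fun n => (bL n).2); split=> [n|x]; first by have [] := bLP n.
have [b [L [sb b01 b1 [cL _] b0]]] := exists_bump (@filterT _ (nbhs x) _).
have [U [BU Ux] Ub] := bB x _ b1.
exists (i U); have [_ /(_ _)H] := bLP (i U).
have : nbhs x U by apply: open_nbhs_nbhs; split=> //; exact: oB.
apply: filterS => y Uy; apply: H; last by rewrite eU.
by exists b, L; split=> // z; rewrite eU// => /Ub.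
Qed.

(** The function is the sum over [n] of the products of the [1 - b i] for
    [i < n]. Near a point where [b k] equals one the products with [n > k]
    vanish, so the sum is locally finite. Outside the supports of the first [k]
    functions the first [k] products are equal to one, so the sum is at least
    [k] there. *)
Lemma exhaustion : exists rho : X -> R, smooth_real rho /\
  forall c, exists2 K, compact K & forall x, rho x <= c -> K x.
Proof.
have [b [L [bL b1]]] := countable_plateaux.
pose P n x := \prod_(i < n) (1 - b i x).
have P0 n x : 0 <= P n x.
  apply: prodr_ge0 => i _; rewrite subr_ge0; have [_ /(_ x)/andP[]] := bL i.
  by [].
have [m mP] := choice b1.
pose rho x := \sum_(n < (m x).+1) P n x.
have tail N k x : b k x = 1 -> (k <= N)%N ->
    \sum_(n < N.+1) P n x = \sum_(n < k.+1) P n x.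
  move=> bk; elim: N => [|N IH]; first by rewrite leqn0 => /eqP ->.
  rewrite leq_eqVlt => /predU1P[->//|]; rewrite ltnS => kN.
  rewrite big_ord_recr /= IH// [P N.+1 x](bigD1 (Ordinal (kN : (k < N.+1)%N)))//=.
  by rewrite bk subrr mul0r addr0.
have bm x : b (m x) x = 1 by exact: nbhs_singleton (mP x).
have rhoE k x : b k x = 1 -> rho x = \sum_(n < k.+1) P n x.
  move=> bk; rewrite /rho -(tail (maxn k (m x)) (m x)) ?leq_maxr//.
  by rewrite (tail _ k)// leq_maxl.
have sP n : smooth_real (P n).
  rewrite /P; elim: n => [|n IH].
    rewrite (_ : (fun x => _) = fun=> 1); first exact: smooth_real_cst.
    by apply/funext => x; rewrite big_ord0.
  rewrite (_ : (fun x => _) = fun x => P n x * (1 - b n x)).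
    apply: smooth_realM => //; apply: smooth_realB; first exact: smooth_real_cst.
    by have [] := bL n.
  by apply/funext => x; rewrite big_ord_recr.
exists rho; split.
  apply: smooth_real_local => x.
  exists [set y | b (m x) y = 1]°, (fun y => \sum_(n < (m x).+1) P n y); split.
  - exact: open_interior.
  - exact: mP.
  - by apply: smooth_real_sum => i; exact: sP.
  - by move=> y /interior_subset/rhoE.
move=> c; have [k ck] : exists k : nat, c < k%:R.
  by exists (Num.bound `|c|); exact: le_lt_trans (ler_norm c) (archi_boundP (normr_ge0 c)).
exists (\bigcup_(i in `I_k) L i).
  rewrite bigcup_mkord; apply: bigsetU_compact => i _.
  by have [] := bL i.
move=> x rc; apply: contrapT => Lx.
have bx i : (i < k)%N -> b i x = 0.
  by move=> ik; have [_ _ _ -> //] := bL i; move=> Lix; apply: Lx; exists i.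
have P1 n : (n <= k)%N -> P n x = 1.
  by move=> nk; apply: big1 => i _; rewrite bx ?subr0// (leq_trans (ltn_ord i)).
have km : (k <= m x)%N.
  by rewrite leqNgt; apply/negP => /bx; rewrite bm => /eqP; rewrite oner_eq0.
have : k%:R <= rho x.
  rewrite /rho -(big_mkord xpredT (fun n => P n x)) (big_cat_nat (n := k)) //=; last by rewrite ltnW.
  rewrite big_mkord (eq_bigr (fun=> 1)); last by move=> i _; rewrite P1// ltnW.
  by rewrite sumr_const card_ord lerDl sumr_ge0.
by move=> /le_trans/(_ rc); rewrite leNgt ck.
Qed.

(** If [chi] is no evaluation, then each point [q] has a function [f] with
    [f q != chi f], and the square of [f - chi f] is in the kernel of [chi] and
    positive near [q]. A finite sum of such squares is positive on the compact
    set where an exhaustion [rho] is at most [chi rho]; adding the square of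
    [rho - chi rho] gives a function that is positive everywhere, hence
    invertible, although [chi] kills it. *)
Lemma character_is_evaluation (chi : (X -> R) -> R) :
  (forall f g, smooth_real f -> smooth_real g ->
     chi (fun x => f x + g x) = chi f + chi g) ->
  (forall r f, smooth_real f -> chi (fun x => r * f x) = r * chi f) ->
  (forall f g, smooth_real f -> smooth_real g ->
     chi (fun x => f x * g x) = chi f * chi g) ->
  (exists2 f, smooth_real f & chi f != 0) ->
  exists q, forall f, smooth_real f -> chi f = f q.
Proof.
move=> chiD chiZ chiM [f0 sf0 chif0].
have s1 r : smooth_real (fun _ : X => r) by exact: smooth_real_cst.
have chi1 : chi (fun=> 1) = 1.
  apply: (mulfI chif0); rewrite mulr1 -chiM//; congr chi.
  by apply/funext => x; rewrite mulr1.
have chic r : chi (fun=> r) = r.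
  rewrite -[RHS]mulr1 -chi1 -chiZ//; congr chi.
  by apply/funext => x; rewrite mulr1.
apply: contrapT => noq.
have {}noq q : exists2 f, smooth_real f & chi f != f q.
  apply: contrapT => H; apply: noq; exists q => f sf; apply/eqP/negPn/negP => ne.
  by apply: H; exists f.
pose sq (f : X -> R) x := (f x - chi f) * (f x - chi f).
have s_sq f : smooth_real f -> smooth_real (sq f).
  by move=> sf; apply: smooth_realM; apply: smooth_realB.
have chi_sq f : smooth_real f -> chi (sq f) = 0.
  move=> sf; have sB : smooth_real (fun x => f x - chi f) by exact: smooth_realB.
  by rewrite /sq chiM// chiD// chic subrr mul0r.
have [rho [srho crho]] := exhaustion.
have [K cK Krho] := crho (chi rho).
have [h [sh chih h0 hK]] : exists h, [/\ smooth_real h, chi h = 0,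
    forall x, 0 <= h x & forall x, K x -> 0 < h x].
  apply: (compact_ind (P := fun A => exists h, [/\ smooth_real h, chi h = 0,
    forall x, 0 <= h x & forall x, A x -> 0 < h x])) cK _ _ _ _.
  - by exists (fun=> 0); split.
  - by move=> A B AB [h [? ? ? hB]]; exists h; split=> // x /AB/hB.
  - move=> A B [h [sh ch h0 hA]] [g [sg cg g0 gB]].
    exists (fun x => h x + g x); split.
    + exact: smooth_realD.
    + by rewrite chiD// ch cg addr0.
    + by move=> x; rewrite addr_ge0.
    + by move=> x [/hA|/gB] ?; [rewrite ltr_pwDl|rewrite ltr_wpDl].
  - move=> q Kq; have [f sf fq] := noq q.
    have sqf_ge0 x : 0 <= sq f x by rewrite /sq -expr2 sqr_ge0.
    exists [set x | 0 < sq f x].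
      apply: smooth_real_gt0_near; first exact: s_sq.
      by rewrite lt_neqAle sqf_ge0 eq_sym /sq mulf_eq0 orbb subr_eq0 eq_sym fq.
    by exists (sq f); split=> //; [exact: s_sq|exact: chi_sq].
pose g x := sq rho x + h x.
have sg : smooth_real g by apply: smooth_realD => //; exact: s_sq.
have g0 x : g x != 0.
  rewrite gt_eqF// /g; have [Kx|Kx] := pselect (K x).
    by rewrite ltr_wpDl ?hK// /sq -expr2 sqr_ge0.
  have rx : chi rho < rho x by rewrite ltNge; apply/negP => /Krho.
  by rewrite ltr_pwDl// /sq mulr_gt0// subr_gt0.
have : chi (fun x => g x * (g x)^-1) = 0.
  by rewrite chiM//; [rewrite chiD// ?chi_sq// ?chih ?addr0 ?mul0r//; exact: s_sq|exact: smooth_realV].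
rewrite (_ : (fun x => _) = fun=> 1) ?chi1; last by apply/funext => x; rewrite divff.
by move=> /eqP; rewrite oner_eq0.
Qed.

End Bumps.

(** Both continuity and the coordinates of a map are tested by functions
    defined on all of [Y]: bump functions and cut-off coordinates. *)
Lemma smooth_map_pullback (R : realType) (X Y : manifold R) (f : X -> Y) :
  (forall g : Y -> R, smooth_real g -> smooth_real (g \o f)) -> smooth_map f.
Proof.
move=> sf.
have cf : continuous f.
  move=> x V /exists_bump[b [K [sb _ b1 [_ KV] b0]]].
  have b1x : b (f x) = 1 by exact: nbhs_singleton b1.
  have : nbhs x [set y | 0 < (b \o f) y].
    by apply: smooth_real_gt0_near; [exact: sf|rewrite /= b1x].
  apply: filterS => y /= by0; apply: KV; apply: contrapT => /b0 by_0.
  by move: by0; rewrite by_0 ltxx.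
split=> // c d Xc Yd j k; apply: Ck_local => _ [x [cx /= dfx] <-].
have [b [K [sb _ b1 [cK KV] b0]]] := exists_bump_in Yd dfx (@filterT _ (nbhs (f x)) _).
have Kd : K `<=` chart_dom d by move=> y /KV[].
have Hc := manifold_is_chart Xc.
exists (c @` (chart_dom c `&` f @^-1` [set y | b y = 1]°)).
exists (local_rep c (fun x => b (f x) * d (f x) ord0 j)); split.
- apply: chart_image_open Hc _; apply: open_comp; last exact: open_interior.
  by move=> z _; exact: cf.
- by exists x.
- apply: CkW (sf _ (smooth_bump_coord j Yd cK Kd b0 sb) _ Xc k).
  by move=> _ [y [cy _] <-]; exists y.
- rewrite (chart_image_preimage _ Hc) => z [_ /= /interior_subset /= bz].
  by rewrite /local_rep /= bz mul1r.
Qed.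

(** * Smoothness from domination by a bounded family *)
Section Domination.
Variable R : realType.

Lemma continuous_dist_leP (T : topologicalType) (f : T -> R) x :
  {for x, continuous f} <->
  forall e : R, 0 < e -> \forall y \near x, `|f x - f y| <= e.
Proof. by split=> [/cvgrPdist_le//|H]; apply/cvgrPdist_le. Qed.

Lemma nbhsI (T : topologicalType) (x : T) (A B : set T) :
  nbhs x A -> nbhs x B -> nbhs x (A `&` B).
Proof. by move=> nA nB; exact: filterI. Qed.

Lemma mvt0 (f df : R -> R) (t : R) :
  (forall s, `|s| <= `|t| -> is_derive s (1 : R) f (df s)) ->
  exists2 s, `|s| <= `|t| & f t - f 0 = t * df s.
Proof.
move=> Hd; have cf s : `|s| <= `|t| -> {for s, continuous f}.
  by move=> /Hd[ds _]; exact/differentiable_continuous/derivable1_diffP.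
have [t0|t0] := leP 0 t.
  have H s : s \in `[0, t] -> `|s| <= `|t|.
    by rewrite in_itv /= => /andP[s0 st]; rewrite !ger0_norm.
  have [||s st ->] := @MVT_segment R f df 0 t t0.
  - by move=> s st; apply/Hd/H; exact: subset_itv_oo_cc.
  - by apply: continuous_in_subspaceT => s /set_mem/H; exact: cf.
  - by exists s; [exact: H|rewrite subr0 mulrC].
have H s : s \in `[t, 0] -> `|s| <= `|t|.
  by rewrite in_itv /= => /andP[st s0]; rewrite (ler0_norm s0) (ltr0_norm t0) lerN2.
have [||s st E] := @MVT_segment R f df t 0 (ltW t0).
- by move=> s st; apply/Hd/H; exact: subset_itv_oo_cc.
- by apply: continuous_in_subspaceT => s /set_mem/H; exact: cf.
- by exists s; [exact: H|rewrite -opprB E sub0r mulrN opprK mulrC].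
Qed.

Lemma taylor1 (f f1 f2 : R -> R) (t r : R) :
  (forall s, `|s| <= `|t| -> [/\ is_derive s (1 : R) f (f1 s),
     is_derive s (1 : R) f1 (f2 s) & `|f2 s| <= r]) ->
  `|f t - f 0 - t * f1 0| <= r * `|t| ^+ 2.
Proof.
move=> H.
have [s st ->] : exists2 s, `|s| <= `|t| & f t - f 0 = t * f1 s.
  by apply: mvt0 => s /H[].
have [u us E] : exists2 u, `|u| <= `|s| & f1 s - f1 0 = s * f2 u.
  by apply: mvt0 => u us; have [] := H u (le_trans us st).
rewrite -mulrBr E !normrM mulrA mulrC ler_pM// ?mulr_ge0//.
  by have [] := H u (le_trans us st).
by rewrite expr2 ler_pM.
Qed.

Lemma is_derive_eps (V : normedModType R) (f : V -> R) (z v : V) (a : R) :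
  (forall e : R, 0 < e -> exists2 d : R, 0 < d & forall t : R, `|t| < d ->
     `|f (t *: v + z) - f z - t * a| <= e * `|t|) ->
  is_derive z v f a.
Proof.
move=> H.
have L : h^-1 *: ((f \o shift z) (h *: v) - f z) @[h --> 0^'] --> a.
  apply/cvgrPdist_le => e e0; have [d d0 Hd] := H e e0.
  near=> t.
  have t0 : t != 0 by near: t; exact: nbhs_dnbhs_neq.
  have td : `|t| < d by near: t; exact: dnbhs0_lt.
  rewrite distrC /= [_ *: _]mulrC.
  have -> : (f (t *: v + z) - f z) / t - a = (f (t *: v + z) - f z - t * a) / t.
    by rewrite [RHS]mulrBl (mulrAC t a t^-1) divff// mul1r.
  by rewrite normrM normfV ler_pdivrMr ?normr_gt0// Hd.
by apply: DeriveDef; [apply/cvg_ex; exists a|apply/cvg_lim].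
Unshelve. all: by end_near. Qed.

Lemma lt_div_half (B e x : R) : 0 < B -> x < e / B / 2 -> B * x < e / 2.
Proof. by move=> B0; rewrite mulrAC ltr_pdivlMr// mulrC. Qed.

(** The arithmetic of the exchange of limits in [tame_swap]. There [Q1] and
    [Q0] are difference quotients at the ends of a segment of length [s], close
    to the derivatives [X] and [Y], and [Qu] is a difference quotient close to
    the mixed derivative [A] at the mean value point; [A0] is the mixed
    derivative at the base point. *)
Lemma quotient_estimate (X Y A A0 Q1 Q0 Qu K K' t s e eta : R) :
  Q1 - Q0 = s * Qu -> `|Q1 - X| <= K * t -> `|Q0 - Y| <= K * t ->
  `|Qu - A| <= K' * t -> `|A0 - A| <= e / 2 -> 0 <= t ->
  (2 * K + K' * `|s| + 1) * t <= eta -> 0 <= e ->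
  `|X - Y - s * A0| <= e * `|s| + eta.
Proof.
move=> E q1 q0 qu a0 t0 tB e0.
have -> : X - Y - s * A0 = (Q0 - Y) - (Q1 - X) + s * (Qu - A) - s * (A0 - A).
  by rewrite !mulrBr -E; ring.
apply: le_trans (ler_normB _ _) _.
apply: le_trans (lerD (ler_normD _ _) (lexx _)) _.
apply: le_trans (lerD (lerD (ler_normB _ _) (lexx _)) (lexx _)) _.
rewrite !normrM.
have s1 : `|s| * `|Qu - A| <= `|s| * (K' * t) by exact: ler_wpM2l.
have s2 : `|s| * `|A0 - A| <= `|s| * (e / 2) by exact: ler_wpM2l.
have s3 : 0 <= `|s| * e by rewrite mulr_ge0.
lra.
Qed.

Section Families.
Variables (n : nat) (W : set 'rV[R]_n).
Hypothesis oW : open W.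
Implicit Types (G : set ('rV[R]_n -> R)) (h g : 'rV[R]_n -> R).
Implicit Types (l : seq (R * 'rV[R]_n)).

(** The integral of [h] for the measure with finite support [l]. *)
Definition comb l h := \sum_(p <- l) p.1 * h p.2.

(** For [C >= 0] the bipolar theorem would turn this into: on [W], the function
    [h] is [C] times a pointwise limit of absolutely convex combinations of
    members of [G]. Stated with measures, the condition can be applied directly
    to difference quotients. *)
Definition dominated (C : R) G h := forall l, (forall p, p \in l -> W p.2) ->
  forall M, 0 < M -> (forall g, G g -> `|comb l g| <= M) -> `|comb l h| <= C * M.

Definition bounded_family G := (forall g, G g -> smooth_on W g) /\
  forall s w0, W w0 -> exists r : R, \forall w \near w0,
    forall g, G g -> `|partials s g w| <= r.

Definition derived_family (i : 'I_n) G : set ('rV[R]_n -> R) :=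
  [set 'D_(basis_vec R i) g | g in G].

Lemma partials_rcons s i h :
  partials (rcons s i) h = partials s ('D_(basis_vec R i) h).
Proof. by rewrite /partials foldr_rcons. Qed.

Lemma smooth_on_derive (U : set 'rV[R]_n) i h : smooth_on U h ->
  smooth_on U ('D_(basis_vec R i) h).
Proof. by move=> sh k; have [_ /(_ i)[]] := sh k.+1. Qed.

Lemma bounded_family_derive i G : bounded_family G ->
  bounded_family (derived_family i G).
Proof.
move=> [sG bG]; split=> [_ [g Gg <-]|s w0 Ww0]; first exact/smooth_on_derive/sG.
have [r Hr] := bG (rcons s i) w0 Ww0; exists r; apply: filterS Hr => w Hw _ [g Gg <-].
by rewrite -partials_rcons; exact: Hw.
Qed.

Lemma dominated_mem G g : G g -> dominated 1 G g.
Proof. by move=> Gg l Wl M M0 H; rewrite mul1r; exact: H. Qed.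

Lemma dominated_eq C G h h' : (forall w, W w -> h w = h' w) ->
  dominated C G h -> dominated C G h'.
Proof.
move=> hh' dh l Wl M M0 H.
rewrite (_ : comb l h' = comb l h); first exact: dh.
by apply: eq_big_seq => p /Wl Wp; rewrite hh'.
Qed.

Lemma ball_line (w0 w : 'rV[R]_n) (d t : R) i : ball w0 d w -> `|t| < d ->
  ball w0 (d + d) (t *: basis_vec R i + w).
Proof.
move=> w0w td; apply: ball_triangle w0w _.
split; first exact: le_lt_trans td.
move=> a j; rewrite /ball /= !mxE opprD addrCA subrr addr0 normrN normrM.
by apply: le_lt_trans td; rewrite ler_piMr// ger0_norm ?ler0n// lern1 leq_b1.
Qed.

(** The second derivatives bound the error of the expansion of order one, hence
    uniformly in the family. *)
Lemma family_taylor G i w0 : bounded_family G -> W w0 ->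
  exists r d : R, [/\ 0 < r, 0 < d & forall w : 'rV[R]_n, ball w0 d w -> W w /\
    forall t : R, `|t| < d -> W (t *: basis_vec R i + w) /\ forall g, G g ->
      `|g (t *: basis_vec R i + w) - g w - t * 'D_(basis_vec R i) g w| <= r * `|t| ^+ 2].
Proof.
move=> [sG bG] Ww0; have [r Hr] := bG [:: i; i] w0 Ww0.
have : nbhs w0 W by exact: open_nbhs_nbhs.
move=> /(filterI Hr)/nbhs_ballP[e /= e0 eW].
exists (`|r| + 1), (e / 2); split; [by rewrite ltr_wpDl|by rewrite divr_gt0|].
have e2 : e / 2 + e / 2 = e by rewrite -splitr.
move=> w ww; split.
  apply: (eW _ _).2; apply: le_ball ww; lra.
move=> t te; split.
  by apply: (eW _ _).2; rewrite -e2; exact: ball_line.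
move=> g Gg.
pose f s := g (s *: basis_vec R i + w).
have -> : g w = f 0 by rewrite /f scale0r add0r.
pose f1 s := 'D_(basis_vec R i) g (s *: basis_vec R i + w).
have -> : 'D_(basis_vec R i) g w = f1 0 by rewrite /f1 scale0r add0r.
pose f2 s := 'D_(basis_vec R i) ('D_(basis_vec R i) g) (s *: basis_vec R i + w).
apply: (@taylor1 f f1 f2) => s st.
have [/(_ g Gg) gr Ww] : ((fun w => forall g, G g -> `|partials [:: i; i] g w| <= r) `&` W) (s *: basis_vec R i + w).
  by apply: eW; rewrite -e2; apply: ball_line => //; exact: le_lt_trans te.
have [_ /(_ i)[d1 d2]] := sG g Gg 2%N.
have [_ /(_ i)[d3 _]] := d2.
split.
- by apply: (is_derive_line g _ _ s _).1; apply: DeriveDef; [exact: d1|].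
- by apply: (is_derive_line ('D_(basis_vec R i) g) _ _ s _).1; apply: DeriveDef; [exact: d3|].
- by apply: le_trans gr _; rewrite (le_trans (ler_norm _))// lerDl.
Qed.

(** The difference of two difference quotients of [h] at [w] is the integral of
    [h] for a measure with four atoms. For the members of [G] this integral is
    small by Taylor's formula, and domination carries the estimate over to [h]:
    its quotients form a Cauchy family. *)
Lemma dominated_quotient G i w0 : bounded_family G -> W w0 ->
  exists r d : R, [/\ 0 < r, 0 < d & forall w : 'rV[R]_n, ball w0 d w -> W w /\
    ((forall t : R, `|t| < d -> W (t *: basis_vec R i + w)) /\
     forall (C : R) h, 0 <= C -> dominated C G h ->
      derivable h w (basis_vec R i) /\ forall t : R, t != 0 -> `|t| < d ->
      `|(h (t *: basis_vec R i + w) - h w) / t - 'D_(basis_vec R i) h w|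
         <= C * r * `|t|)].
Proof.
move=> bG Ww0; have [r [d [r0 d0 H]]] := family_taylor i bG Ww0.
exists r, d; split=> // w /H[Ww Hw]; split=> //; split.
  by move=> t /Hw[].
move=> C h C0 dh.
pose Q (h : 'rV[R]_n -> R) t := (h (t *: basis_vec R i + w) - h w) / t.
have QQ (t s : R) : t != 0 -> s != 0 -> `|t| < d -> `|s| < d ->
    `|Q h t - Q h s| <= C * r * (`|t| + `|s|).
  move=> t0 s0 td sd; have [Wt gt] := Hw t td; have [Ws gs] := Hw s sd.
  pose l := [:: (t^-1, t *: basis_vec R i + w); (- t^-1, w);
                (- s^-1, s *: basis_vec R i + w); (s^-1, w)].
  have lE f : comb l f = Q f t - Q f s.
    by rewrite /comb /l !big_cons big_nil /Q /=; ring.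
  rewrite -lE -mulrA; apply: dh.
  - by move=> p; rewrite !inE => /or4P[] /eqP ->.
  - by rewrite mulr_gt0// addr_gt0// normr_gt0.
  - move=> g Gg; rewrite lE.
    have qb (u : R) : u != 0 -> `|u| < d -> `|Q g u - 'D_(basis_vec R i) g w| <= r * `|u|.
      move=> u0 /Hw[_ /(_ g Gg)]; rewrite /Q.
      have -> : (g (u *: basis_vec R i + w) - g w) / u - 'D_(basis_vec R i) g w =
        (g (u *: basis_vec R i + w) - g w - u * 'D_(basis_vec R i) g w) / u.
        by rewrite [in RHS]mulrBl [u * _ / u]mulrAC divff// mul1r.
      by rewrite normrM normfV ler_pdivrMr ?normr_gt0// -mulrA -expr2.
    rewrite mulrDr -(subrKA ('D_(basis_vec R i) g w)).
    apply: le_trans (ler_normD _ _) _.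
    by rewrite lerD ?qb// distrC qb.
have EQ : (fun t => t^-1 *: ((h \o shift w) (t *: basis_vec R i) - h w)) = Q h.
  by apply/funext => t; rewrite /Q /= mulrC.
have cv : cvg (Q h t @[t --> 0^']).
  apply: cauchy_cvg; apply/cauchy_exP => e e0.
  have e1 : 0 < e / (C * r + 1) / 2.
    by rewrite !divr_gt0// ltr_wpDl// mulr_ge0// ltW.
  have small : \forall t \near (0 : R)^', [/\ t != 0, `|t| < d & `|t| < e / (C * r + 1) / 2].
    by near=> t; split; near: t; [exact: nbhs_dnbhs_neq|exact: dnbhs0_lt|exact: dnbhs0_lt].
  have [s [s0 sd se]] := filter_ex small.
  exists (Q h s); apply: filterS small => t [t0 td te]; rewrite /ball /=.
  apply: le_lt_trans (QQ s t s0 t0 sd td) _.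
  apply: le_lt_trans (_ : (C * r + 1) * (`|s| + `|t|) < _).
    by rewrite ler_wpM2r ?addr_ge0// lerDl.
  by rewrite mulrDr [X in _ < X]splitr ltrD// lt_div_half// ltr_wpDl// mulr_ge0// ltW.
have Lim : Q h t @[t --> 0^'] --> 'D_(basis_vec R i) h w by rewrite /derive EQ.
split; first by rewrite /derivable EQ.
move=> t t0 td; apply/ler_addgt0Pr => e e0.
have e1 : 0 < e / (C * r + 1) / 2.
  by rewrite !divr_gt0// ltr_wpDl// mulr_ge0// ltW.
have e2 : 0 < e / 2 by rewrite divr_gt0.
have /cvgrPdist_lt/(_ _ e2) Lim2 := Lim.
have : \forall s \near (0 : R)^', [/\ s != 0, `|s| < d, `|s| < e / (C * r + 1) / 2 &
    `|'D_(basis_vec R i) h w - Q h s| < e / 2].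
  near=> s; split; near: s; [exact: nbhs_dnbhs_neq|exact: dnbhs0_lt|exact: dnbhs0_lt|exact: Lim2].
move=> /filter_ex[s [s0 sd se sl]].
rewrite -/(Q h t) -(subrKA (Q h s)).
apply: le_trans (ler_normD _ _) _.
apply: le_trans (lerD (QQ t s t0 s0 td sd) _) _; first by rewrite distrC; exact: ltW sl.
rewrite mulrDr -addrA lerD2l [X in _ <= X]splitr lerD2r.
apply: le_trans (_ : (C * r + 1) * `|s| <= _).
  by rewrite ler_wpM2r// lerDl.
by rewrite ltW// lt_div_half// ltr_wpDl// mulr_ge0// ltW.
Unshelve. all: by end_near. Qed.

(** The measure [lt] replaces the derivative at each atom of [l] by a
    difference quotient of step [t]; the rate of convergence is common to all
    dominated functions. *)
Lemma comb_quotient G i l : bounded_family G -> (forall p, p \in l -> W p.2) ->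
  exists K d : R, [/\ 0 < K, 0 < d & forall t : R, t != 0 -> `|t| < d ->
    exists lt : seq (R * 'rV[R]_n), (forall p, p \in lt -> W p.2) /\
    forall (C : R) h, 0 <= C -> dominated C G h ->
      `|comb lt h - comb l ('D_(basis_vec R i) h)| <= C * K * `|t|].
Proof.
move=> bG; elim: l => [|[a w] l IH] Wl.
  exists 1, 1; split=> // t t0 t1; exists [::]; split=> // C h C0 _.
  by rewrite /comb !big_nil subrr normr0 !mulr_ge0.
have [|K [d [K0 d0 Kd]]] := IH; first by move=> p lp; apply: Wl; rewrite in_cons lp orbT.
have Ww : W w by apply: (Wl (a, w)); rewrite mem_head.
have [r [d' [r0 d'0 rd]]] := dominated_quotient i bG Ww.
have [_ [Wt rw]] := rd w (ballxx _ d'0).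
exists (`|a| * r + K), (Num.min d d'); split; first by rewrite ltr_wpDl// mulr_ge0// ltW.
  by rewrite lt_min d0.
move=> t t0; rewrite lt_min => /andP[td td'].
have [lt [Wlt Hlt]] := Kd t t0 td.
exists [:: (a / t, t *: basis_vec R i + w), (- (a / t), w) & lt]; split.
  by move=> p; rewrite !inE => /or3P[/eqP->|/eqP->|/Wlt//] //=; exact: Wt.
move=> C h C0 dh; have [_ /(_ t t0 td') Hw] := rw C h C0 dh.
rewrite /comb !big_cons /= -/(comb _ _) -/(comb _ _).
set hq := (X in `|X / t - _|) in Hw.
have -> : a / t * h (t *: basis_vec R i + w) + (- (a / t) * h w + comb lt h) -
    (a * 'D_(basis_vec R i) h w + comb l ('D_(basis_vec R i) h)) =
  a * (hq / t - 'D_(basis_vec R i) h w) + (comb lt h - comb l ('D_(basis_vec R i) h)).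
  by rewrite /hq; ring.
apply: le_trans (ler_normD _ _) _; rewrite normrM mulrDr mulrDl lerD ?Hlt//.
rewrite mulrCA -!mulrA; apply: ler_wpM2l => //.
by rewrite mulrA.
Qed.

(** An integral of derivatives is a limit of integrals of the functions
    themselves, for the same measures [lt] and with the same error for [h] and
    for the family. *)
Lemma dominated_derive C G i h : 0 <= C -> bounded_family G -> dominated C G h ->
  dominated C (derived_family i G) ('D_(basis_vec R i) h).
Proof.
move=> C0 bG dh l Wl M M0 H.
have [K [d [K0 d0 Kd]]] := comb_quotient i bG Wl.
apply/ler_addgt0Pr => e e0.
pose B := 2 * (C * K) + 1.
have B0 : 0 < B by rewrite ltr_wpDl// !mulr_ge0// ltW.
pose t := Num.min (d / 2) (e / B).
have t0 : 0 < t by rewrite lt_min !divr_gt0.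
have td : `|t| < d by rewrite gtr0_norm// gt_min; apply/orP; left; lra.
have tB : B * t <= e by rewrite mulrC -ler_pdivlMr// ge_min lexx orbT.
have [lt [Wlt Hlt]] := Kd t (lt0r_neq0 t0) td.
have lth := Hlt C h C0 dh; rewrite (gtr0_norm t0) in lth.
have lthM : `|comb lt h| <= C * (M + K * t).
  apply: dh => //; first by rewrite addr_gt0// mulr_gt0.
  move=> g Gg; have := Hlt 1 g ler01 (dominated_mem Gg).
  rewrite mul1r (gtr0_norm t0) => gt.
  rewrite -[comb lt g](subrK (comb l ('D_(basis_vec R i) g))) addrC.
  by apply: le_trans (ler_normD _ _) _; rewrite lerD//; apply: H; exists g.
rewrite -[comb l _](subrK (comb lt h)); apply: le_trans (ler_normD _ _) _.
rewrite distrC; apply: le_trans (lerD lth lthM) _.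
have : 0 <= C * K by rewrite mulr_ge0// ltW.
by rewrite /B in tB; nra.
Qed.

(** The points [w0] and [w] are joined by moving one coordinate at a time, so
    that only partial derivatives enter. *)
Lemma lipschitz_coord g w0 w (d : R) (r : 'I_n -> R) : ball w0 d w ->
  (forall v i, ball w0 d v -> derivable g v (basis_vec R i) /\
     `|'D_(basis_vec R i) g v| <= r i) ->
  `|g w - g w0| <= \sum_i r i * `|w ord0 i - w0 ord0 i|.
Proof.
move=> w0w H.
pose v (k : nat) : 'rV[R]_n := \row_(j < n) if (j < k)%N then w ord0 j else w0 ord0 j.
have v0 : v 0 = w0 by apply/rowP => j; rewrite mxE.
have vn : v n = w by apply/rowP => j; rewrite mxE ltn_ord.
have -> : g w - g w0 = \sum_(k < n) (g (v k.+1) - g (v k)).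
  by rewrite -(big_mkord xpredT (fun k => g (v k.+1) - g (v k))) telescope_sumr// v0 vn.
apply: le_trans (ler_norm_sum _ _ _) _; apply: ler_sum => k _.
pose t := w ord0 k - w0 ord0 k.
have vs (s : R) : s *: basis_vec R k + v k = \row_j (if j == k then s + w0 ord0 j else v k ord0 j).
  apply/rowP => j; rewrite !mxE eqxx /=; case: (eqVneq j k) => [->|jk].
    by rewrite mulr1 ltnn.
  by rewrite mulr0 add0r.
have vS : v k.+1 = t *: basis_vec R k + v k.
  rewrite vs; apply/rowP => j; rewrite !mxE ltnS leq_eqVlt.
  rewrite -[(j == k :> nat)]/(j == k); case: (eqVneq j k) => [->|//].
  by rewrite /= /t subrK.
have vk : v k = 0 *: basis_vec R k + v k by rewrite scale0r add0r.
have bs (s : R) : `|s| <= `|t| -> ball w0 d (s *: basis_vec R k + v k).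
  move=> st; rewrite vs; case: w0w => d0 w0w; split=> // a j; rewrite (_ : a = ord0) ?mxE; last exact: ord1.
  have wj := w0w ord0 j; rewrite /ball /= in wj *.
  case: (eqVneq j k) wj => [->|jk] wj; first by rewrite opprD addrCA subrr addr0 normrN (le_lt_trans st)// /t distrC.
  by case: ifP => // _; rewrite subrr normr0.
have [s st E] : exists2 s, `|s| <= `|t| & g (t *: basis_vec R k + v k) - g (0 *: basis_vec R k + v k) =
    t * 'D_(basis_vec R k) g (s *: basis_vec R k + v k).
  apply: (@mvt0 (fun s => g (s *: basis_vec R k + v k)) (fun s => 'D_(basis_vec R k) g (s *: basis_vec R k + v k))).
  move=> s st; apply: (is_derive_line g _ _ s _).1.
  by have [ds _] := H _ k (bs s st); apply: DeriveDef.
rewrite vS {2}vk E normrM mulrC ler_wpM2r//.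
by have [] := H _ k (bs s st).
Qed.

Lemma bounded_family_equicontinuous G w0 (e : R) : bounded_family G -> W w0 ->
  0 < e -> \forall w \near w0, W w /\ forall g, G g -> `|g w - g w0| <= e.
Proof.
move=> [sG bG] Ww0 e0.
have [r Hr] := choice (fun i => bG [:: i] w0 Ww0).
have : nbhs w0 (W `&` [set w | forall i g, G g -> `|partials [:: i] g w| <= r i]).
  apply: filterI; first exact: open_nbhs_nbhs.
  exact: (@filter_forall _ _ (fun i => [set w | forall g, G g -> `|partials [:: i] g w| <= r i]) (nbhs w0) _ Hr).
move=> /nbhs_ballP[d /= d0 dW].
pose B := \sum_i `|r i| + 1.
have B0 : 0 < B by rewrite ltr_wpDl// sumr_ge0.
have : nbhs w0 (ball w0 (Num.min d (e / B))).
  by apply: nbhsx_ballx; rewrite lt_min d0 divr_gt0.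
apply: filterS => w ww.
have wd : ball w0 d w by apply: le_ball ww; rewrite ge_min lexx.
split; first by have [] := dW _ wd.
move=> g Gg; apply: le_trans (lipschitz_coord (r := fun i => `|r i|) wd _) _.
  move=> v i /dW[Wv rv]; split; first by have [_ /(_ i)[d1 _]] := sG g Gg 1%N; exact: d1.
  by apply: le_trans (rv i g Gg) _; exact: ler_norm.
apply: le_trans (_ : \sum_i `|r i| * (e / B) <= _).
  apply: ler_sum => i _; apply: ler_wpM2l => //.
  case: ww => _ /(_ ord0 i); rewrite /ball /= lt_min distrC => /andP[_ /ltW].
  by [].
rewrite -mulr_suml mulrCA ger_pMr// ler_pdivrMr// mul1r lerDl.
by [].
Qed.

Lemma dominated_diff C G h (M : R) w w' : 0 < M -> W w -> W w' -> dominated C G h ->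
  (forall g, G g -> `|g w - g w'| <= M) -> `|h w - h w'| <= C * M.
Proof.
move=> M0 Ww Ww' dh H.
have lE f : comb [:: (1, w); (-1, w')] f = f w - f w'.
  by rewrite /comb !big_cons big_nil /=; ring.
rewrite -lE; apply: dh => //.
- by move=> p; rewrite !inE => /orP[] /eqP ->.
- by move=> g Gg; rewrite lE; exact: H.
Qed.

End Families.

Section Joint.
Variables (m n : nat) (U : set 'rV[R]_m) (W : set 'rV[R]_n).
Hypotheses (oU : open U) (oW : open W).
Implicit Types H : 'rV[R]_m -> 'rV[R]_n -> R.

(** Smoothness in [z] alone, together with a domination in [w] of all
    derivatives in [z], locally uniform in [z]. It is stable under derivatives
    in both variables, and it is what the continuity of a functional
    provides. *)
Definition tame H := (forall w, W w -> smooth_on U (H^~ w)) /\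
  forall s z0, U z0 -> exists (C : R) (G : set ('rV[R]_n -> R)),
    [/\ 0 <= C, bounded_family W G &
        \forall z \near z0, dominated W C G (fun w => partials s (H^~ w) z)].

Definition dfst j H : 'rV[R]_m -> 'rV[R]_n -> R :=
  fun z w => 'D_(basis_vec R j) (H^~ w) z.
Definition dsnd i H : 'rV[R]_m -> 'rV[R]_n -> R :=
  fun z w => 'D_(basis_vec R i) (H z) w.

Lemma tame_dfst j H : tame H -> tame (dfst j H).
Proof.
move=> [sH dH]; split=> [w Ww|s z0 Uz0]; first exact: smooth_on_derive (sH w Ww).
have [C [G [C0 bG Hd]]] := dH (rcons s j) z0 Uz0; exists C, G; split=> //.
apply: filterS Hd => z; apply: dominated_eq => w Ww.
by rewrite partials_rcons.
Qed.

(** The constants depend only on the dominating family, which is common to all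
    points near [z0]. *)
Lemma tame_quotient H i z0 w : tame H -> U z0 -> W w ->
  exists K d : R, [/\ 0 <= K, 0 < d, forall t : R, `|t| < d -> W (t *: basis_vec R i + w) &
    \forall z \near z0,
    derivable (H z) w (basis_vec R i) /\ forall t : R, t != 0 -> `|t| < d ->
    `|(H z (t *: basis_vec R i + w) - H z w) / t - dsnd i H z w| <= K * `|t|].
Proof.
move=> [sH dH] Uz0 Ww; have [C [G [C0 bG Hd]]] := dH [::] z0 Uz0.
have [r [d [r0 d0 rd]]] := dominated_quotient oW i bG Ww.
have [_ [Wt Hw]] := rd w (ballxx _ d0).
exists (C * r), d; split=> //; first by rewrite mulr_ge0// ltW.
by apply: filterS Hd => z dz; apply: Hw.
Qed.

Lemma tame_derivable H i z w : tame H -> U z -> W w ->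
  derivable (H z) w (basis_vec R i).
Proof.
by move=> tH Uz Ww; have [K [d [_ _ _ /nbhs_singleton[]]]] := tame_quotient i tH Uz Ww.
Qed.

(** The derivative is a locally uniform limit of difference quotients, which
    are continuous in the first variable. *)
Lemma tame_dsnd_continuous H i z0 w : tame H -> U z0 -> W w ->
  {for z0, continuous (fun z => dsnd i H z w)}.
Proof.
move=> tH Uz0 Ww; have [K [d [K0 d0 Wt Hd]]] := tame_quotient i tH Uz0 Ww.
apply/continuous_dist_leP => e e0.
have K1 : 0 < K + 1 by rewrite ltr_wpDl.
pose t := Num.min (d / 2) (e / (3 * (K + 1))).
have t0 : 0 < t by rewrite lt_min !divr_gt0// mulr_gt0.
have td : `|t| < d by rewrite gtr0_norm// gt_min; apply/orP; left; lra.
have tK : 3 * ((K + 1) * t) <= e.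
  by rewrite mulrA mulrC -ler_pdivlMr ?mulr_gt0// ge_min lexx orbT.
have cH w' : W w' -> \forall z \near z0, `|H z0 w' - H z w'| <= e * t / 6.
  move=> Ww'; have := Ck_continuous (tH.1 w' Ww' 0) Uz0.
  by move=> /continuous_dist_leP; apply; rewrite !divr_gt0// mulr_gt0.
have [_ Hz0] := nbhs_singleton Hd.
apply: filterS3 Hd (cH w Ww) (cH _ (Wt t td)) => z [_ Hz] H1 H2.
have {}Hz := Hz t (lt0r_neq0 t0) td; have {}Hz0 := Hz0 t (lt0r_neq0 t0) td.
rewrite (gtr0_norm t0) in Hz Hz0.
set wt := t *: _ + w in Hz Hz0 H2.
have Q : `|(H z0 wt - H z0 w) / t - (H z wt - H z w) / t| <= e / 3.
  have -> : (H z0 wt - H z0 w) / t - (H z wt - H z w) / t =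
     ((H z0 wt - H z wt) - (H z0 w - H z w)) / t by ring.
  rewrite normrM normfV (gtr0_norm t0) ler_pdivrMr//.
  by apply: le_trans (ler_normB _ _) _; lra.
move: Hz Hz0 Q; rewrite !ler_norml => /andP[a1 a2] /andP[b1 b2] /andP[c1 c2].
by apply/andP; split; nra.
Qed.

(** The derivative in [z] of a difference quotient in [w] is the difference
    quotient of the derivative. As the step tends to zero both converge locally
    uniformly in [z], so the limits are again related by differentiation. *)
Lemma tame_swap H i j z0 w : tame H -> U z0 -> W w ->
  is_derive z0 (basis_vec R j) (fun z => dsnd i H z w) (dsnd i (dfst j H) z0 w).
Proof.
move=> tH Uz0 Ww; have tH1 := tame_dfst j tH.
have [K [d [K0 d0 Wt Hd]]] := tame_quotient i tH Uz0 Ww.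
have [K' [d' [K'0 d'0 _ Hd']]] := tame_quotient i tH1 Uz0 Ww.
apply: is_derive_eps => e e0.
have e2 : 0 < e / 2 by rewrite divr_gt0.
have /continuous_dist_leP/(_ _ e2) cA := @tame_dsnd_continuous _ i _ _ tH1 Uz0 Ww.
have nU : nbhs z0 U by exact: open_nbhs_nbhs.
have /nbhs_ballP[r /= r0 rP] := nbhsI (nbhsI Hd Hd') (nbhsI cA nU).
exists (r / 2); first by rewrite divr_gt0.
move=> s sr.
have bz (u : R) : `|u| <= `|s| -> ball z0 r (u *: basis_vec R j + z0).
  move=> us; rewrite [r]splitr; apply: ball_line; last exact: le_lt_trans sr.
  by apply: ballxx; rewrite divr_gt0.
apply/ler_addgt0Pr => eta eta0.
have D0 : 0 < 2 * K + K' * `|s| + 1.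
  by rewrite ltr_wpDl// addr_ge0// mulr_ge0.
pose t := Num.min (Num.min (d / 2) (d' / 2)) (eta / (2 * K + K' * `|s| + 1)).
have t0 : 0 < t by rewrite !lt_min !divr_gt0.
have td : `|t| < d by rewrite gtr0_norm// !gt_min; apply/orP; left; apply/orP; left; lra.
have td' : `|t| < d' by rewrite gtr0_norm// !gt_min; apply/orP; left; apply/orP; right; lra.
have tB : (2 * K + K' * `|s| + 1) * t <= eta.
  by rewrite mulrC -ler_pdivlMr// ge_min lexx orbT.
have tn0 := lt0r_neq0 t0.
have Wwt := Wt t td; set wt := t *: _ + w in Wwt.
pose q z := (H z wt - H z w) / t.
have [u us E] : exists2 u, `|u| <= `|s| & q (s *: basis_vec R j + z0) - q (0 *: basis_vec R j + z0) =
    s * ((dfst j H (u *: basis_vec R j + z0) wt - dfst j H (u *: basis_vec R j + z0) w) / t).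
  apply: (@mvt0 (fun u => q (u *: basis_vec R j + z0))
     (fun u => (dfst j H (u *: basis_vec R j + z0) wt - dfst j H (u *: basis_vec R j + z0) w) / t)).
  move=> u /bz/rP[_ [_ Uu]].
  have dH w' : W w' -> is_derive u (1 : R) (fun u => H (u *: basis_vec R j + z0) w') (dfst j H (u *: basis_vec R j + z0) w').
    move=> Ww'; apply: (is_derive_line (H^~ w') _ _ u _).1.
    by have [_ /(_ j)[dj _]] := tH.1 w' Ww' 1%N; apply: DeriveDef => //; exact: dj.
  have := is_deriveZ t^-1 (is_deriveB (dH wt Wwt) (dH w Ww)).
  rewrite /GRing.scale /= mulrC.
  by congr (is_derive _ _ _ _); apply/funext => v; rewrite /q mulrC.
have [[[_ /(_ t tn0 td) q1] _] _] := rP _ (bz s (lexx _)).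
have [[[_ /(_ t tn0 td) q0] _] _] := rP _ (ballxx _ r0).
have [[_ [_ /(_ t tn0 td') qu]] [Au _]] := rP _ (bz u us).
rewrite scale0r add0r in E; rewrite -/wt -/(q _) in q1 q0 qu.
rewrite (gtr0_norm t0) in q1 q0 qu.
exact: (quotient_estimate E q1 q0 qu Au (ltW t0) tB (ltW e0)).
Qed.

Lemma tame_dsnd_Ck H i w k : tame H -> W w -> Ck U k (fun z => dsnd i H z w).
Proof.
elim: k H => [|k IH] H tH Ww.
  by split=> // z Uz; exact: tame_dsnd_continuous.
split=> [z Uz|j]; first exact: tame_dsnd_continuous.
split=> [z Uz|]; first by have [] := tame_swap i j tH Uz Ww.
refine (eq_Ck oU _ (IH _ (tame_dfst j tH) Ww)) => z Uz.
by have [_ ->] := tame_swap i j tH Uz Ww.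
Qed.

Lemma tame_partials s H : tame H -> tame (fun z w => partials s (H^~ w) z).
Proof.
move=> tH; elim: s => [//|j s IH].
exact: (tame_dfst j IH).
Qed.

Lemma partials_dsnd s H i z w : tame H -> U z -> W w ->
  partials s (fun z => dsnd i H z w) z =
  dsnd i (fun z w => partials s (H^~ w) z) z w.
Proof.
move=> tH Uz Ww; elim: s z Uz => [//|j s IH] z Uz /=.
have [_ <-] := tame_swap i j (tame_partials s tH) Uz Ww.
apply: near_eq_derive.
by apply: filterS (open_nbhs_nbhs (conj oU Uz)) => z' Uz'; exact: IH.
Qed.

(** Since the derivatives commute, a derivative in [z] of [dsnd i H] is the
    derivative in [w] of a dominated function, and it is dominated by the
    derivatives of the family. *)
Lemma tame_dsnd i H : tame H -> tame (dsnd i H).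
Proof.
move=> tH; split=> [w Ww k|s z0 Uz0]; first exact: tame_dsnd_Ck.
have [C [G [C0 bG Hd]]] := tH.2 s z0 Uz0.
exists C, (derived_family i G); split=> //; first exact: bounded_family_derive.
apply: filterS2 Hd (open_nbhs_nbhs (conj oU Uz0)) => z dz Uz.
apply: (dominated_eq (h := dsnd i (fun z w => partials s (H^~ w) z) z)); last first.
  exact: (dominated_derive oW C0 bG dz).
move=> w Ww; by rewrite partials_dsnd.
Qed.

Definition joint H (p : 'rV[R]_(m + n)) := H (lsubmx p) (rsubmx p).
Definition joint_dom : set 'rV[R]_(m + n) := lsubmx @^-1` U `&` rsubmx @^-1` W.

Lemma joint_dom_open : open joint_dom.
Proof.
by apply: openI; apply: open_comp => // z _; [exact: lsubmx_continuous|exact: rsubmx_continuous].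
Qed.

(** Domination makes the functions [H z], for [z] near a point, as
    equicontinuous as the family. *)
Lemma tame_joint_continuous H p : tame H -> joint_dom p ->
  {for p, continuous (joint H)}.
Proof.
move=> tH [/= Up Wp]; apply/continuous_dist_leP => e e0.
have [C [G [C0 bG Hd]]] := tH.2 [::] _ Up.
have C1 : 0 < C + 1 by rewrite ltr_wpDl.
have e1 : 0 < e / (C + 1) / 2 by rewrite !divr_gt0.
have e2 : 0 < e / 2 by rewrite divr_gt0.
have eqc := bounded_family_equicontinuous oW bG Wp e1.
have /continuous_dist_leP/(_ _ e2) cz := Ck_continuous (tH.1 _ Wp 0) Up.
have nl := lsubmx_continuous (nbhsI Hd cz).
have nr := rsubmx_continuous eqc.
have nlr := @nbhsI _ p (lsubmx @^-1` _) (rsubmx @^-1` _) nl nr.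
apply: filterS nlr => q [/= [dq cq] [Wq eq]].
rewrite /joint -(subrKA (H (lsubmx q) (rsubmx p))).
apply: le_trans (ler_normD _ _) _; rewrite [e]splitr lerD//.
rewrite distrC; apply: le_trans (dominated_diff e1 Wq Wp dq eq) _.
apply: le_trans (_ : (C + 1) * (e / (C + 1) / 2) <= _).
  by rewrite ler_wpM2r ?lerDl// ltW.
by rewrite mulrCA mulrA divfK// lt0r_neq0.
Qed.

Lemma joint_derive_lshift H j p :
  (derivable (joint H) p (basis_vec R (lshift n j)) <->
   derivable (H^~ (rsubmx p)) (lsubmx p) (basis_vec R j)) /\
  'D_(basis_vec R (lshift n j)) (joint H) p = dfst j H (lsubmx p) (rsubmx p).
Proof.
have E : (fun t : R => t^-1 *: ((joint H \o shift p) (t *: basis_vec R (lshift n j)) - joint H p)) =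
  (fun t : R => t^-1 *: (((H^~ (rsubmx p)) \o shift (lsubmx p)) (t *: basis_vec R j) - H (lsubmx p) (rsubmx p))).
  apply/funext => t /=; rewrite /joint -row_mx_basis !linearD !linearZ /=.
  by rewrite row_mxKl row_mxKr scaler0 add0r.
by rewrite /derivable /dfst /derive E.
Qed.

Lemma joint_derive_rshift H i p :
  (derivable (joint H) p (basis_vec R (rshift m i)) <->
   derivable (H (lsubmx p)) (rsubmx p) (basis_vec R i)) /\
  'D_(basis_vec R (rshift m i)) (joint H) p = dsnd i H (lsubmx p) (rsubmx p).
Proof.
have bE : basis_vec R (rshift m i) = row_mx 0 (basis_vec R i).
  apply/rowP => j; rewrite !mxE; case: split_ordP => k ->.
    by rewrite !mxE eq_lrshift andbF.
  by rewrite !mxE eq_rshift.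
have E : (fun t : R => t^-1 *: ((joint H \o shift p) (t *: basis_vec R (rshift m i)) - joint H p)) =
  (fun t : R => t^-1 *: (((H (lsubmx p)) \o shift (rsubmx p)) (t *: basis_vec R i) - H (lsubmx p) (rsubmx p))).
  apply/funext => t /=; rewrite /joint bE !linearD !linearZ /=.
  by rewrite row_mxKl row_mxKr scaler0 add0r.
by rewrite /derivable /dsnd /derive E.
Qed.

(** Tame functions are jointly continuous and have tame partial derivatives in
    all directions. *)
Lemma tame_smooth H : tame H -> smooth_on joint_dom (joint H).
Proof.
move=> tH k; elim: k H tH => [|k IH] H tH.
  by split=> // p; exact: tame_joint_continuous.
split=> [p|a]; first exact: tame_joint_continuous.
case: (split_ordP a) => b ->.
  have D p := joint_derive_lshift H b p; split=> [p [Up Wp]|].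
    apply/(D p).1; have [_ /(_ b)[d1 _]] := tH.1 _ Wp 1%N; exact: d1.
  rewrite (_ : (fun p => _) = joint (dfst b H)); first exact/IH/tame_dfst.
  by apply/funext => p; exact: (D p).2.
have D p := joint_derive_rshift H b p; split=> [p [Up Wp]|].
  by apply/(D p).1; exact: tame_derivable.
rewrite (_ : (fun p => _) = joint (dsnd b H)); first exact/IH/tame_dsnd.
by apply/funext => p; exact: (D p).2.
Qed.

End Joint.

End Domination.

(** * Iterated partial derivatives *)
Section Partials.
Variables (R : realType) (n : nat) (A : set 'rV[R]_n).
Hypothesis oA : open A.
Implicit Types (f g : 'rV[R]_n -> R) (s : seq 'I_n).

Lemma partials_eq s f g : (forall z, A z -> f z = g z) ->
  forall z, A z -> partials s f z = partials s g z.
Proof.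
move=> fg; elim: s => [//|i s IH] z Az /=; apply: near_eq_derive.
by apply: filterS (open_nbhs_nbhs (conj oA Az)) => w /IH.
Qed.

Lemma smooth_on_partials s f : smooth_on A f -> smooth_on A (partials s f).
Proof. by move=> sf; elim: s => [//|i s IH]; exact: smooth_on_derive IH. Qed.

Lemma smooth_on_derivable f z i : smooth_on A f -> A z ->
  derivable f z (basis_vec R i).
Proof. by move=> sf Az; have [_ /(_ i)[d1 _]] := sf 1%N; exact: d1. Qed.

Lemma smooth_onD f g : smooth_on A f -> smooth_on A g ->
  smooth_on A (fun z => f z + g z).
Proof. by move=> sf sg k; exact: CkD. Qed.

Lemma smooth_onM f g : smooth_on A f -> smooth_on A g ->
  smooth_on A (fun z => f z * g z).
Proof. by move=> sf sg k; exact: CkM. Qed.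

Lemma smooth_onZ a f : smooth_on A f -> smooth_on A (fun z => a * f z).
Proof. by move=> sf k; apply: (@CkM _ _ _ k (cst a)) => //; exact: Ck_cst. Qed.

Lemma partialsD s f g : smooth_on A f -> smooth_on A g ->
  forall z, A z -> partials s (fun z => f z + g z) z = partials s f z + partials s g z.
Proof.
move=> sf sg; elim: s => [//|i s IH] z Az /=.
have -> : 'D_(basis_vec R i) (partials s (fun z => f z + g z)) z =
    'D_(basis_vec R i) (partials s f + partials s g) z.
  apply: near_eq_derive.
  by apply: filterS (open_nbhs_nbhs (conj oA Az)) => w /IH.
by rewrite deriveD//; apply: smooth_on_derivable => //; exact: smooth_on_partials.
Qed.

Lemma partialsZ s a f : smooth_on A f ->
  forall z, A z -> partials s (fun z => a * f z) z = a * partials s f z.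
Proof.
move=> sf; elim: s => [//|i s IH] z Az /=.
have -> : 'D_(basis_vec R i) (partials s (fun z => a * f z)) z =
    'D_(basis_vec R i) (a *: partials s f) z.
  apply: near_eq_derive.
  by apply: filterS (open_nbhs_nbhs (conj oA Az)) => w /IH.
by rewrite deriveZ//; apply: smooth_on_derivable => //; exact: smooth_on_partials.
Qed.

Lemma partials_sum (I : Type) s (l : seq I) (a : I -> R) (F : I -> 'rV[R]_n -> R) :
  (forall p, smooth_on A (F p)) -> forall z, A z ->
  partials s (fun z => \sum_(p <- l) a p * F p z) z =
  \sum_(p <- l) a p * partials s (F p) z.
Proof.
move=> sF; elim: l => [|p l IH] z Az.
  rewrite big_nil; under [X in partials s X]eq_fun do rewrite big_nil.
  rewrite (@partials_eq s _ (fun z => 0 * cst 0 z))// => [|w _]; last by rewrite mul0r.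
  by rewrite partialsZ ?mul0r// => k; exact: Ck_cst.
have sS : smooth_on A (fun z => \sum_(p <- l) a p * F p z).
  by move=> k; apply: Ck_sum => // q; exact: smooth_onZ.
rewrite big_cons -IH// -partialsZ// -partialsD//; last exact: smooth_onZ.
by apply: partials_eq => // w _; rewrite big_cons.
Qed.

Lemma compact_bound f (K : set 'rV[R]_n) : smooth_on A f -> compact K -> K `<=` A ->
  exists r : R, forall z, K z -> `|f z| <= r.
Proof.
move=> sf cK KA.
have : compact (f @` K).
  apply: continuous_compact cK; apply: continuous_in_subspaceT => z /set_mem /KA.
  by move=> Az; exact: (Ck_continuous (sf 0%N) Az).
move=> /compact_bounded[r [_ /(_ (r + 1))]]; rewrite ltrDl ltr01 => /(_ isT) H.
by exists (r + 1) => z Kz; apply: H; exists z.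
Qed.

(** These are the bounded sets of the Frechet space of smooth functions on
    [A]. *)
Definition compactly_bounded (F : set ('rV[R]_n -> R)) :=
  (forall f, F f -> smooth_on A f) /\
  forall s K, compact K -> K `<=` A -> exists r : R, forall f z, F f -> K z ->
    `|partials s f z| <= r.

Lemma compactly_bounded1 f : smooth_on A f -> compactly_bounded [set f].
Proof.
move=> sf; split=> [_ ->//|s K cK KA].
have [r Hr] := compact_bound (smooth_on_partials s sf) cK KA.
by exists r => _ z -> /Hr.
Qed.

Lemma compactly_bounded_derive i F : compactly_bounded F ->
  compactly_bounded (derived_family i F).
Proof.
move=> [sF bF]; split=> [_ [f Ff <-]|s K cK KA]; first exact/smooth_on_derive/sF.
have [r Hr] := bF (rcons s i) K cK KA; exists r => _ z [f Ff <-] Kz.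
by rewrite -partials_rcons; exact: Hr.
Qed.

(** The Leibniz rule; both families vary in the induction because each
    derivative falls on one of the factors. *)
Lemma compactly_bounded_mul s F G K : compactly_bounded F -> compactly_bounded G ->
  compact K -> K `<=` A -> exists r : R, forall f g z, F f -> G g -> K z ->
    `|partials s (fun z => f z * g z) z| <= r.
Proof.
move=> bF bG cK KA; elim/last_ind: s F G bF bG => [|s i IH] F G bF bG.
  have [[_ /(_ [::] K cK KA)[r Hr]] [_ /(_ [::] K cK KA)[r' Hr']]] := (bF, bG).
  exists (r * r') => f g z Ff Gg Kz; rewrite normrM ler_pM//.
    exact: Hr.
  exact: Hr'.
have [r Hr] := IH _ _ bF (compactly_bounded_derive i bG).
have [r' Hr'] := IH _ _ (compactly_bounded_derive i bF) bG.
exists (r + r') => f g z Ff Gg Kz; rewrite partials_rcons.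
have sf := bF.1 f Ff; have sg := bG.1 g Gg.
have sf' := smooth_on_derive i sf; have sg' := smooth_on_derive i sg.
rewrite (@partials_eq s _ (fun z => f z * 'D_(basis_vec R i) g z + 'D_(basis_vec R i) f z * g z)); last 2 first.
- move=> w Aw; rewrite (_ : (fun z => f z * g z) = f * g)// deriveM.
  + by rewrite [X in _ + X]mulrC.
  + exact: smooth_on_derivable.
  + exact: smooth_on_derivable.
- exact: KA.
rewrite partialsD; last exact: KA.
- apply: le_trans (ler_normD _ _) _; rewrite lerD//.
  + by apply: Hr => //; exists g.
  + by apply: Hr' => //; exists f.
- exact: smooth_onM.
- exact: smooth_onM.
Qed.

End Partials.

Lemma partials_lshift (R : realType) m n (F : 'rV[R]_(m + n) -> R) s z w :
  partials s (fun z : 'rV[R]_m => F (row_mx z w)) z =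
  partials (map (lshift n) s) F (row_mx z w).
Proof.
elim: s z => [//|i s IH] z /=.
pose H (z : 'rV[R]_m) w := partials (map (lshift n) s) F (row_mx z w).
have -> : partials (map (lshift n) s) F = joint H.
  by apply/funext => p; rewrite /joint /H hsubmxK.
rewrite (joint_derive_lshift H i _).2 row_mxKl row_mxKr /dfst.
by congr ('D__ _ z); apply/funext => z'; exact: IH.
Qed.

Lemma partials_rshift (R : realType) m n (F : 'rV[R]_(m + n) -> R) s z w :
  partials s (fun w : 'rV[R]_n => F (row_mx z w)) w =
  partials (map (@rshift m n) s) F (row_mx z w).
Proof.
elim: s w => [//|i s IH] w /=.
pose H (z : 'rV[R]_m) w := partials (map (@rshift m n) s) F (row_mx z w).
have -> : partials (map (@rshift m n) s) F = joint H.
  by apply/funext => p; rewrite /joint /H hsubmxK.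
rewrite (joint_derive_rshift H i _).2 row_mxKl row_mxKr /dsnd.
by congr ('D__ _ w); apply/funext => w'; exact: IH.
Qed.

(** * Seminorms on spaces of smooth functions *)
Section Seminorms.
Variable R : realType.
Notation C := R[i].

Lemma normc_geRe (a : C) : `|complex.Re a| <= Normc.normc a.
Proof.
by case: a => x y /=; rewrite -sqrtr_sqr ler_sqrt ?addr_ge0 ?sqr_ge0// lerDl sqr_ge0.
Qed.

Lemma normc_geIm (a : C) : `|complex.Im a| <= Normc.normc a.
Proof.
by case: a => x y /=; rewrite -sqrtr_sqr ler_sqrt ?addr_ge0 ?sqr_ge0// lerDr sqr_ge0.
Qed.

Lemma normc_leReIm (a : C) :
  Normc.normc a <= `|complex.Re a| + `|complex.Im a|.
Proof.
case: a => x y /=.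
have s0 : 0 <= `|x| + `|y| by rewrite addr_ge0.
rewrite -[leRHS]ger0_norm// -sqrtr_sqr ler_sqrt ?sqr_ge0//.
rewrite sqrrD !real_normK ?num_real// addrAC lerDl mulrn_wge0//.
Qed.

Lemma normc_ge0 (a : C) : 0 <= Normc.normc a.
Proof. exact: le_trans (normc_geRe a). Qed.

Variable X : manifold R.
Implicit Types (F : X -> C) (c : chart R X (Defs.dim X)).

Let img_open c (Xc : atlas c) : open (chart_img c) := manifold_open_img Xc.

Lemma smooth_Re F c : smooth_complex F -> atlas c ->
  smooth_on (chart_img c) (fun z => complex.Re (local_rep c F z)).
Proof. by move=> [sF _] Xc; exact: sF. Qed.

Lemma smooth_Im F c : smooth_complex F -> atlas c ->
  smooth_on (chart_img c) (fun z => complex.Im (local_rep c F z)).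
Proof. by move=> [_ sF] Xc; exact: sF. Qed.

Lemma cpartials_lin c s (a : C) F G z : atlas c -> smooth_complex F ->
  smooth_complex G -> chart_img c z ->
  cpartials s (local_rep c (fun x => a * F x + G x)) z =
  a * cpartials s (local_rep c F) z + cpartials s (local_rep c G) z.
Proof.
move=> Xc sF sG cz; have oc := img_open Xc.
have [[sFr sFi] [sGr sGi]] := ((smooth_Re sF Xc, smooth_Im sF Xc), (smooth_Re sG Xc, smooth_Im sG Xc)).
rewrite /cpartials.
have L a1 a2 f g h : smooth_on (chart_img c) f -> smooth_on (chart_img c) g ->
    smooth_on (chart_img c) h ->
    partials s (fun w => a1 * f w + a2 * g w + h w) z =
    a1 * partials s f z + a2 * partials s g z + partials s h z.
  move=> sf sg sh; have := smooth_onZ oc; move=> sZ.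
  by rewrite !(partialsD oc) ?(partialsZ oc)//; [exact: sZ|exact: sZ|apply: smooth_onD => //; exact: sZ].
rewrite (_ : (fun w => complex.Re (local_rep c (fun x => a * F x + G x) w)) =
  (fun w => complex.Re a * complex.Re (local_rep c F w) + - complex.Im a * complex.Im (local_rep c F w) + complex.Re (local_rep c G w))); last first.
  by apply/funext => w; rewrite /local_rep /=; case: a (F _) (G _) => ? ? [? ?] [? ?] /=; rewrite mulNr.
rewrite (_ : (fun w => complex.Im (local_rep c (fun x => a * F x + G x) w)) =
  (fun w => complex.Re a * complex.Im (local_rep c F w) + complex.Im a * complex.Re (local_rep c F w) + complex.Im (local_rep c G w))); last first.
  by apply/funext => w; rewrite /local_rep /=; case: a (F _) (G _) => ? ? [? ?] [? ?] /=.
by rewrite !L//; case: a => a1 a2 /=; rewrite mulNr.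
Qed.

Lemma le_sup_deriv F c K s z : atlas c -> smooth_complex F -> compact K ->
  K `<=` chart_img c -> K z ->
  Normc.normc (cpartials s (local_rep c F) z) <= sup_deriv c K s F.
Proof.
move=> Xc sF cK Kc Kz; apply: ub_le_sup; last by exists z.
have [r Hr] := compact_bound (smooth_on_partials s (smooth_Re sF Xc)) cK Kc.
have [r' Hr'] := compact_bound (smooth_on_partials s (smooth_Im sF Xc)) cK Kc.
exists (r + r') => _ [w Kw <-]; apply: le_trans (normc_leReIm _) _.
by apply: lerD; [exact: Hr|exact: Hr'].
Qed.

Lemma sup_deriv_le F c (K : set 'rV[R]_(Defs.dim X)) s (r : R) : 0 <= r ->
  (forall z, K z -> Normc.normc (cpartials s (local_rep c F) z) <= r) ->
  sup_deriv c K s F <= r.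
Proof.
move=> r0 H; rewrite /sup_deriv; set E := (X in sup X).
have [->|/set0P E0] := eqVneq E set0; first by rewrite sup0.
by apply: ge_sup => // _ [z Kz <-]; exact: H.
Qed.

Lemma sup_deriv_ge0 F c (K : set 'rV[R]_(Defs.dim X)) s : atlas c ->
  smooth_complex F -> compact K -> K `<=` chart_img c -> 0 <= sup_deriv c K s F.
Proof.
move=> Xc sF cK Kc; have [->|/set0P[z Kz]] := eqVneq K set0.
  by rewrite /sup_deriv image_set0 sup0.
by apply: le_trans (le_sup_deriv s Xc sF cK Kc Kz); exact: normc_ge0.
Qed.

Lemma CcinfE (a : C) (u v : Ccinf X) x : (a *: u + v : Ccinf X) x = a * u x + v x.
Proof. by []. Qed.

Lemma sup_deriv_LF c K s : atlas c -> compact K -> K `<=` chart_img c ->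
  LF_seminorms (fun v : Ccinf X => sup_deriv c K s v).
Proof.
move=> Xc cK Kc; have sC (v : Ccinf X) := (CcinfP v).1.
have lin (a : C) (u v : Ccinf X) z : K z ->
    cpartials s (local_rep c (a *: u + v : Ccinf X)) z =
    a * cpartials s (local_rep c u) z + cpartials s (local_rep c v) z.
  by move=> /Kc cz; rewrite -(cpartials_lin s a Xc (sC u) (sC v) cz).
have le_sup (u : Ccinf X) z : K z -> Normc.normc (cpartials s (local_rep c u) z) <= sup_deriv c K s u.
  exact: le_sup_deriv.
have sup0 (u : Ccinf X) : 0 <= sup_deriv c K s u by exact: sup_deriv_ge0.
have leZ (a : C) (u : Ccinf X) : sup_deriv c K s (a *: u) <= Normc.normc a * sup_deriv c K s u.
  apply: sup_deriv_le => [|z Kz]; first by rewrite mulr_ge0// normc_ge0.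
  have c0 : cpartials s (local_rep c (0 : Ccinf X)) z = 0.
    have := lin 1 0 0 z Kz; rewrite scale1r addr0 mul1r => /eqP.
    by rewrite -subr_eq0 opprD addrA subrr sub0r oppr_eq0 => /eqP.
  rewrite -[a *: u]addr0 lin// c0 addr0 Normc.normcM.
  by rewrite ler_wpM2l ?normc_ge0// le_sup.
split; last first.
  move=> L cL e e0; exists [set sup_deriv c K s], e; split=> //.
    by move=> _ ->; exists c, K, s.
  by move=> f _; apply.
split=> [u v|a u].
  apply: sup_deriv_le => [|z Kz]; first by rewrite addr_ge0.
  have -> : u + v = 1 *: u + v by rewrite scale1r.
  rewrite lin// mul1r; apply: le_trans (le_normcD _ _) _.
  by rewrite lerD// le_sup.
(* The reverse inequality is [leZ] for the inverse scalar. *)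
apply/le_anti/andP; split; first exact: leZ.
have [->|a0] := eqVneq a 0; first by rewrite Normc.normc0 mul0r.
have na0 : 0 < Normc.normc a.
  by rewrite lt0r normc_ge0 andbT; apply: contra_neq a0 => /Normc.eq0_normc.
rewrite -ler_pdivlMl// -Normc.normcV -{1}[u]scale1r -(mulVf a0) -scalerA.
exact: leZ.
Qed.

End Seminorms.

(** * Joint smoothness of continuous functionals in charts *)
Section TameDual.
Variables (R : realType) (M N : manifold R).
Notation C := R[i].
Notation MN := (prod_manifold M N).
Implicit Types (u v : Dirac M N) (F G : Cinf MN).

Lemma DiracE (a : C) u v F x : (a *: u + v : Dirac M N) F x = a * u F x + v F x.
Proof. by []. Qed.

Variables (c : chart R M (Defs.dim M)) (d : chart R N (Defs.dim N)) (f : Ccinf M).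
Hypotheses (Mc : atlas c) (Nd : atlas d).
Let U := chart_img c.
Let W := chart_img d.

Let oU : open U := manifold_open_img Mc.
Let oW : open W := manifold_open_img Nd.

(** The measure [l], read in the chart [d], with the fixed coefficient [f]. *)
Definition dirac_comb (l : seq (R * 'rV[R]_(Defs.dim N))) : Dirac M N :=
  \sum_(p <- l) p.1%:C *: Defs.dirac (chart_inv d p.2) f.

Lemma dirac_combE l F x :
  dirac_comb l F x = \sum_(p <- l) p.1%:C * (f x * F (x, chart_inv d p.2)).
Proof.
elim: l => [|p l IH]; first by rewrite /dirac_comb !big_nil.
by rewrite /dirac_comb !big_cons DiracE -/(dirac_comb l) IH.
Qed.

Lemma Re_sum (l : seq (R * 'rV[R]_(Defs.dim N))) (g : R * 'rV[R]_(Defs.dim N) -> C) :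
  complex.Re (\sum_(p <- l) p.1%:C * g p) = \sum_(p <- l) p.1 * complex.Re (g p) /\
  complex.Im (\sum_(p <- l) p.1%:C * g p) = \sum_(p <- l) p.1 * complex.Im (g p).
Proof.
elim: l => [|p l [IH1 IH2]]; first by rewrite !big_nil.
rewrite !big_cons -IH1 -IH2; case: (g p) => a b; case: (\sum_(_ <- _) _) => a' b' /=.
by rewrite !mul0r subr0 addr0.
Qed.

Lemma row_mx_continuous_r m n (z : 'rV[R]_m) :
  continuous (fun w : 'rV[R]_n => row_mx z w).
Proof.
apply: mx_entries_continuous => j; case: (split_ordP j) => k ->.
  by right; exists (z ord0 k) => w; rewrite row_mxEl.
by left; exists k => w; rewrite row_mxEr.
Qed.

Lemma compact_row_mx m n (K : set 'rV[R]_m) (L : set 'rV[R]_n) :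
  compact K -> compact L ->
  compact [set row_mx p.1 p.2 | p in K `*` L].
Proof.
move=> cK cL; apply: continuous_compact; last exact: compact_setX.
apply: continuous_subspaceT => -[z w] A /nbhs_ballP[e e0 zA].
exists (ball z e, ball w e); first by split; exact: nbhsx_ballx.
move=> [z' w'] [/= [_ zz'] [_ ww']]; apply: zA; split=> // i j.
by case: (split_ordP j) => k ->; rewrite ?row_mxEl ?row_mxEr; [exact: zz'|exact: ww'].
Qed.

Lemma compact_nbhs n (z : 'rV[R]_n) (A : set 'rV[R]_n) : nbhs z A ->
  exists K, [/\ compact K, K `<=` A & nbhs z K].
Proof.
move=> /nbhs_ballP[e /= e0 eA].
exists [set w | forall j, `|w ord0 j - z ord0 j| <= e / 2]; split.
- exact: closed_box_compact.
- move=> w zw; apply: eA; split=> // i j; rewrite (_ : i = ord0); last exact: ord1.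
  by rewrite /ball /= distrC (le_lt_trans (zw j))//; lra.
- apply/nbhs_ballP; exists (e / 2) => /=; first by rewrite divr_gt0.
  by move=> w [_ zw] j; rewrite distrC ltW//; exact: zw.
Qed.

Section Seminorm.
Variables (B : set (Cinf MN)).
Hypothesis bB : lc_bounded (@Cinf_seminorms R MN) B.
Variables (c' : chart R M (Defs.dim M)) (K : set 'rV[R]_(Defs.dim M)).
Variable s : seq 'I_(Defs.dim M).
Hypotheses (Mc' : atlas c') (cK : compact K) (Kc' : K `<=` chart_img c').

Let O := chart_img (prod_chart c' d).
Let pc_atlas : @atlas R MN (prod_chart c' d). Proof. by exists c', d. Qed.
Let oO : open O := @manifold_open_img R MN _ pc_atlas.

Lemma bounded_parts (P : C -> R) : (P = @complex.Re R \/ P = @complex.Im R) ->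
  compactly_bounded O [set g | exists2 G, B G & g = fun z => P (local_rep (prod_chart c' d) G z)].
Proof.
move=> HP; have sP (G : Cinf MN) : smooth_on O (fun z => P (local_rep (prod_chart c' d) G z)).
  by case: HP => ->; [exact: (smooth_Re (CinfP G) pc_atlas)|exact: (smooth_Im (CinfP G) pc_atlas)].
split=> [_ [G _ ->]|t L cL LO]; first exact: sP.
have [|r Hr] := @bB (fun G : Cinf MN => @sup_deriv R MN (prod_chart c' d) L t G).
  by exists (@sup_deriv R MN (prod_chart c' d) L t) => //; exists (prod_chart c' d), L, t.
exists r => _ z [G BG ->] Lz; apply: le_trans (Hr G BG).
apply: le_trans _ (@le_sup_deriv R MN G (prod_chart c' d) L t z pc_atlas (CinfP G) cL LO Lz).
by case: HP => ->; [exact: (normc_geRe (cpartials t (local_rep (prod_chart c' d) G) z))|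
  exact: (normc_geIm (cpartials t (local_rep (prod_chart c' d) G) z))].
Qed.

Lemma bounded_product_parts (P : C -> R) : (P = @complex.Re R \/ P = @complex.Im R) ->
  compactly_bounded O [set g | exists2 G, B G &
     g = fun z => P (local_rep (prod_chart c' d) (Cinf_act f G) z)].
Proof.
move=> HP; split=> [_ [G _ ->]|t L cL LO].
  by case: HP => ->; [exact: (smooth_Re (CinfP (Cinf_act f G)) pc_atlas)|exact: (smooth_Im (CinfP (Cinf_act f G)) pc_atlas)].
have sf : @smooth_complex R MN (fun p => f p.1) := @smooth_complex_fst R M N _ (CcinfP f).1.
pose fr z := complex.Re (local_rep (prod_chart c' d) (fun p : MN => f p.1) z).
pose fi z := complex.Im (local_rep (prod_chart c' d) (fun p : MN => f p.1) z).
have sfr : smooth_on O fr by exact: (smooth_Re sf pc_atlas).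
have sfi : smooth_on O fi by exact: (smooth_Im sf pc_atlas).
have bR := bounded_parts (or_introl erefl).
have bI := bounded_parts (or_intror erefl).
have bfr := compactly_bounded1 sfr; have bfi := compactly_bounded1 sfi.
have [r1 H1] := compactly_bounded_mul oO t bfr bR cL LO.
have [r2 H2] := compactly_bounded_mul oO t bfi bI cL LO.
have [r3 H3] := compactly_bounded_mul oO t bfr bI cL LO.
have [r4 H4] := compactly_bounded_mul oO t bfi bR cL LO.
exists (r1 + r2 + (r3 + r4)) => _ z [G BG ->] Lz.
pose Gr z := complex.Re (local_rep (prod_chart c' d) G z).
pose Gi z := complex.Im (local_rep (prod_chart c' d) G z).
have BGr : [set g | exists2 G, B G & g = fun z => complex.Re (local_rep (prod_chart c' d) G z)] Gr by exists G.
have BGi : [set g | exists2 G, B G & g = fun z => complex.Im (local_rep (prod_chart c' d) G z)] Gi by exists G.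
have sGr : smooth_on O Gr by exact: bR.1.
have sGi : smooth_on O Gi by exact: bI.1.
have {}H1 := H1 _ _ z erefl BGr Lz; have {}H2 := H2 _ _ z erefl BGi Lz.
have {}H3 := H3 _ _ z erefl BGi Lz; have {}H4 := H4 _ _ z erefl BGr Lz.
have r0 (a b : R) : `|a| <= b -> 0 <= b by apply: le_trans.
have Oz := LO z Lz.
case: HP => ->.
  rewrite (_ : (fun z => _) = (fun z => fr z * Gr z + (-1) * (fi z * Gi z))); last first.
    apply/funext => w; rewrite /fr /Gr /fi /Gi /local_rep /=.
    by case: (f _) (G _) => ? ? [? ?] /=; rewrite mulN1r.
  rewrite (partialsD oO)//; [|exact: smooth_onM|by apply: smooth_onZ => //; exact: smooth_onM].
  rewrite (partialsZ oO)//; last exact: smooth_onM.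
  rewrite mulN1r; apply: le_trans (ler_normB _ _) _.
  by rewrite -[leLHS]addr0 lerD ?addr_ge0 ?(r0 _ _ H3) ?(r0 _ _ H4)// lerD.
rewrite (_ : (fun z => _) = (fun z => fr z * Gi z + fi z * Gr z)); last first.
  apply/funext => w; rewrite /fr /Gr /fi /Gi /local_rep /=.
  by case: (f _) (G _) => ? ? [? ?].
rewrite (partialsD oO)//; [|exact: smooth_onM|exact: smooth_onM].
apply: le_trans (ler_normD _ _) _.
by rewrite -[leLHS]add0r lerD ?addr_ge0 ?(r0 _ _ H1) ?(r0 _ _ H2)// lerD.
Qed.

(** The integrals of these functions for [l] are the real and imaginary parts
    of the derivatives of the functions [dirac_comb l G]. *)
Definition control_family : set ('rV[R]_(Defs.dim N) -> R) :=
  [set g | exists G z P, [/\ B G, K z, P = @complex.Re R \/ P = @complex.Im R &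
    g = fun w => partials s (fun z' => P (local_rep c' (bracket (chart_inv d w) f G) z')) z]].

Lemma control_familyE (G : Cinf MN) z (P : C -> R) :
  (fun w => partials s (fun z' => P (local_rep c' (bracket (chart_inv d w) f G) z')) z) =
  (fun w => partials (map (lshift (Defs.dim N)) s)
     (fun p => P (local_rep (prod_chart c' d) (Cinf_act f G) p)) (row_mx z w)).
Proof.
apply/funext => w; rewrite -partials_lshift; congr (partials s _ z).
by apply/funext => z'; rewrite /local_rep /= row_mxKl row_mxKr.
Qed.

(** A derivative of a member is a mixed derivative of the product of [f] and
    [G], taken on the product of [K] with a compact neighbourhood, where it is
    bounded uniformly in [G]. *)
Lemma control_family_bounded : bounded_family W control_family.
Proof.
have rowO z w : K z -> W w -> O (row_mx z w).
  by move=> /Kc' cz Ww; rewrite /O prod_chart_img /= row_mxKl row_mxKr.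
split=> [_ [G [z [P [BG Kz HP ->]]]]|t w0 Ww0].
  rewrite control_familyE => k.
  have [sb _] := bounded_product_parts HP.
  have := smooth_on_partials (map (lshift (Defs.dim N)) s) (sb _ (ex_intro2 _ _ G BG erefl)).
  move=> /(_ k); apply: (Ck_affine (h := row_mx z) (l := row_mx 0)) => //.
  - exact: row_mx_continuous_r.
  - by move=> w Ww; exact: rowO.
  - by move=> a v w; rewrite scale_row_mx add_row_mx scaler0 add0r.
  - move=> i; left; exists (rshift _ i); apply/rowP => j; rewrite !mxE.
    case: split_ordP => k' ->; first by rewrite !mxE eq_lrshift andbF.
    by rewrite !mxE eq_rshift.
have [L [cL LW nL]] := compact_nbhs (open_nbhs_nbhs (conj oW Ww0)).
have cKL := compact_row_mx cK cL.
have KLO : [set row_mx p.1 p.2 | p in K `*` L] `<=` O.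
  by move=> _ [[z w] [/= Kz Lw] <-]; apply: rowO => //; exact: LW.
pose t' := map (@rshift (Defs.dim M) (Defs.dim N)) t ++ map (lshift (Defs.dim N)) s.
have [_ /(_ t' _ cKL KLO)[r Hr]] := bounded_product_parts (or_introl erefl).
have [_ /(_ t' _ cKL KLO)[r' Hr']] := bounded_product_parts (or_intror erefl).
exists (`|r| + `|r'|); apply: filterS nL => w Lw _ [G [z [P [BG Kz HP ->]]]].
rewrite control_familyE partials_rshift.
rewrite (_ : partials _ (partials _ _) = partials t' (fun p => P (local_rep (prod_chart c' d) (Cinf_act f G) p))); last by rewrite /partials /t' foldr_cat.
have KLzw : [set row_mx p.1 p.2 | p in K `*` L] (row_mx z w) by exists (z, w).
case: HP => ->.
  apply: le_trans (_ : `|r| <= _); last by rewrite lerDl.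
  by apply: le_trans (ler_norm r); apply: Hr => //; exists G.
apply: le_trans (_ : `|r'| <= _); last by rewrite lerDr.
by apply: le_trans (ler_norm r'); apply: Hr' => //; exists G.
Qed.

Lemma control_family_sup l (r : R) : 0 <= r ->
  (forall g, control_family g -> `|comb l g| <= r) ->
  forall G, B G -> sup_deriv c' K s (dirac_comb l G) <= 2 * r.
Proof.
move=> r0 H G BG; apply: sup_deriv_le => [|z Kz]; first by rewrite mulr_ge0.
apply: le_trans (normc_leReIm _) _; rewrite mulr_natl mulr2n /=.
have oc' := manifold_open_img Mc'.
have sb y := (CcinfP (bracket y f G)).1.
apply: lerD.
  have := H _ (ex_intro _ G (ex_intro _ z (ex_intro _ _ (And4 BG Kz (or_introl erefl) erefl)))).
  rewrite /comb -(@partials_sum R _ (chart_img c') oc' _ s l (fun p => p.1)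
    (fun p z' => complex.Re (local_rep c' (bracket (chart_inv d p.2) f G) z'))
    (fun p => smooth_Re (sb _) Mc') z (Kc' Kz)).
  congr (`|partials s _ z| <= r); apply/funext => z'.
  by rewrite -(Re_sum _ _).1 /local_rep /= dirac_combE.
have := H _ (ex_intro _ G (ex_intro _ z (ex_intro _ _ (And4 BG Kz (or_intror erefl) erefl)))).
rewrite /comb -(@partials_sum R _ (chart_img c') oc' _ s l (fun p => p.1)
    (fun p z' => complex.Im (local_rep c' (bracket (chart_inv d p.2) f G) z'))
    (fun p => smooth_Im (sb _) Mc') z (Kc' Kz)).
congr (`|partials s _ z| <= r); apply/funext => z'.
by rewrite -(Re_sum _ _).2 /local_rep /= dirac_combE.
Qed.

End Seminorm.

Lemma bounded_familyU (G1 G2 : set ('rV[R]_(Defs.dim N) -> R)) : bounded_family W G1 -> bounded_family W G2 ->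
  bounded_family W (G1 `|` G2).
Proof.
move=> [s1 b1] [s2 b2]; split=> [g [/s1|/s2]//|s w Ww].
have [r1 H1] := b1 s w Ww; have [r2 H2] := b2 s w Ww.
exists (`|r1| + `|r2|); apply: filterS2 H1 H2 => w' H1 H2 g [/H1|/H2] H.
  by apply: le_trans H _; rewrite (le_trans (ler_norm _))// lerDl.
by apply: le_trans H _; rewrite (le_trans (ler_norm _))// lerDr.
Qed.

Lemma control_finite B (A : set ((M -> C) -> R)) :
  lc_bounded (@Cinf_seminorms R MN) B -> finite_set A -> A `<=` @smooth_seminorms R M ->
  exists2 G, bounded_family W G & forall l (r : R), 0 <= r ->
    (forall g, G g -> `|comb l g| <= r) ->
    forall F, B F -> forall p, A p -> p (dirac_comb l F) <= 2 * r.
Proof.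
move=> bB /finite_seqP[t ->]; elim: t => [|p t IH] tP.
  by exists set0 => //; split=> [//|s w _]; exists 0; apply: (@filterS _ _ _ setT) => [w' _ g []|]; exact: filterT.
have [|G bG HG] := IH; first by move=> q tq; apply: tP; rewrite /= in_cons tq orbT.
have [|c' [K [s [Mc' cK Kc' ->]]]] := tP p; first by rewrite /= mem_head.
exists (control_family B c' K s `|` G).
  by apply: bounded_familyU => //; exact: control_family_bounded.
move=> l r r0 H F BF q /=; rewrite in_cons => /predU1P[->|tq].
  by apply: control_family_sup BF => // g Gg; apply: H; left.
by apply: HG BF _ tq => // g Gg; apply: H; right.
Qed.

(** On functions supported in [L] the inductive limit topology is that of
    uniform convergence of derivatives. *)
Lemma LF_finite (A : set (Ccinf M -> R)) (L : set M) (e : R) : compact L -> 0 < e ->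
  finite_set A -> A `<=` @LF_seminorms R M ->
  exists (A' : set ((M -> C) -> R)) (e' : R),
    [/\ finite_set A', A' `<=` @smooth_seminorms R M, 0 < e' &
      forall v : Ccinf M, csupport v `<=` L -> (forall p, A' p -> p v < e') ->
        forall p, A p -> p v < e].
Proof.
move=> cL e0 /finite_seqP[t ->]; elim: t => [|p t IH] tP.
  by exists set0, 1; split.
have [|A1 [e1 [fA1 sA1 e10 H1]]] := IH; first by move=> q tq; apply: tP; rewrite /= in_cons tq orbT.
have [|_ /(_ L cL e e0)[A2 [e2 [fA2 sA2 e20 H2]]]] := tP p; first by rewrite /= mem_head.
exists (A1 `|` A2), (Num.min e1 e2); split.
- by rewrite finite_setU.
- by move=> q [/sA1|/sA2].
- by rewrite lt_min e10.
move=> v vL Hv q /=; rewrite in_cons => /predU1P[->|].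
  by apply: H2 => // q' A2q; have := Hv q' (or_intror A2q); rewrite lt_min => /andP[].
by apply: H1 => // q' A1q; have := Hv q' (or_introl A1q); rewrite lt_min => /andP[].
Qed.

Variable phi : Dirac M N -> Ccinf M.
Hypothesis dphi : is_dual phi.

Lemma dual0 : phi 0 = 0.
Proof.
have [lin _ _] := dphi; have := lin 1 0 0; rewrite !scale1r addr0 => /eqP.
by rewrite -subr_eq0 opprD addrA subrr sub0r oppr_eq0 => /eqP.
Qed.

Lemma dual_comb l x : phi (dirac_comb l) x =
  \sum_(p <- l) p.1%:C * phi (Defs.dirac (chart_inv d p.2) f) x.
Proof.
have [lin _ _] := dphi; elim: l => [|p l IH].
  by rewrite /dirac_comb !big_nil dual0.
by rewrite /dirac_comb !big_cons lin CcinfE -/(dirac_comb l) IH.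
Qed.

Definition dual_slice (z : 'rV[R]_(Defs.dim M)) (w : 'rV[R]_(Defs.dim N)) : R :=
  complex.Re (local_rep c (phi (Defs.dirac (chart_inv d w) f)) z).

(** Continuity of [phi] at zero bounds a derivative of [phi u] on [K] by
    finitely many seminorms of the functions [u F] with [F] in a bounded set.
    For [u = dirac_comb l] these are supported in the support of [f] and
    bounded by integrals for [l] of the members of a bounded family. Rescaling
    [l] turns the implication between neighbourhoods into an inequality. *)
Lemma dual_slice_dominated s (K : set 'rV[R]_(Defs.dim M)) : compact K -> K `<=` U ->
  exists (k : R) (G : set ('rV[R]_(Defs.dim N) -> R)), [/\ 0 <= k, bounded_family W G &
    forall z, K z -> dominated W k G (fun w => partials s (dual_slice^~ w) z)].
Proof.
move=> cK KU; have [lin _ cphi] := dphi.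
pose q (v : Ccinf M) := sup_deriv c K s v.
have : Dirac_nbhs 0 (phi @^-1` [set v | q v < 1]).
  apply: cphi; exists [set q], 1; split=> //; first by move=> _ ->; exact: sup_deriv_LF.
  by move=> v; rewrite dual0 subr0; apply.
move=> [V [B [U1 [bB [A1 [e1 [fA1 sA1 e10 HU1]]] HV]]] HVq].
have cont u : (forall F, B F -> forall p, A1 p -> p (u F) < e1) -> q (phi u) < 1.
  move=> H; apply: HVq; apply: HV => F BF; apply: HU1 => p A1p.
  by rewrite !subr0; exact: H.
have [A2 [e2 [fA2 sA2 e20 H2]]] := LF_finite (CcinfP f).2 e10 fA1 sA1.
have [G bG HG] := control_finite bB fA2 sA2.
(* The constant [3] exceeds the factor [2] of [control_finite], which makes the
   inequality below strict. *)
exists (3 / e2), G; split=> //; first by rewrite divr_ge0// ltW.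
move=> z Kz l Wl r r0 Hr.
pose a := e2 / (3 * r); have a0 : 0 < a by rewrite divr_gt0// mulr_gt0.
pose al := [seq (a * p.1, p.2) | p <- l].
have alE g : comb al g = a * comb l g.
  rewrite /comb /al big_map mulr_sumr; apply: eq_bigr => p _.
  by rewrite mulrA.
have supp F : csupport (dirac_comb al F) `<=` csupport f.
  apply: closure_subset => x /=; apply: contra_neq => fx.
  by rewrite dirac_combE big1// => p _; rewrite fx mul0r mulr0.
have : q (phi (dirac_comb al)) < 1.
  apply: cont => F BF; apply: H2; first exact: supp.
  move=> p A2p; apply: le_lt_trans (HG al (a * r) _ _ F BF p A2p) _.
  - by rewrite mulr_ge0// ltW.
  - by move=> g Gg; rewrite alE normrM gtr0_norm// ler_pM2l//; exact: Hr.
  - have -> : a * r = e2 / 3 by rewrite /a; field; exact: lt0r_neq0.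
    lra.
have alh : comb al (fun w => partials s (dual_slice^~ w) z) =
    partials s (fun z' => complex.Re (local_rep c (phi (dirac_comb al)) z')) z.
  rewrite /comb -(@partials_sum R _ U oU _ s al (fun p => p.1)
    (fun p z' => dual_slice z' p.2)
    (fun p => smooth_Re (CcinfP (phi (Defs.dirac (chart_inv d p.2) f))).1 Mc) z (KU z Kz)).
  congr (partials s _ z); apply/funext => z'.
  by rewrite -(Re_sum _ _).1 /local_rep /= dual_comb.
move=> /ltW; apply: contraTT; rewrite -!ltNge => lth.
have : 1 < `|comb al (fun w => partials s (dual_slice^~ w) z)|.
  rewrite alE normrM gtr0_norm// mulrC -ltr_pdivrMr//.
  by apply: le_lt_trans lth; rewrite /a invf_div mul1r mulrAC.
move=> /lt_le_trans; apply; rewrite alh.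
apply: le_trans (le_sup_deriv s Mc (CcinfP (phi (dirac_comb al))).1 cK KU Kz).
exact: (normc_geRe (cpartials s (local_rep c (phi (dirac_comb al))) z)).
Qed.

Lemma dual_slice_tame : tame U W dual_slice.
Proof.
split=> [w Ww|s z0 Uz0].
  by apply: smooth_Re => //; exact: (CcinfP _).1.
have [K [cK KU nK]] := compact_nbhs (open_nbhs_nbhs (conj oU Uz0)).
have [k [G [k0 bG H]]] := dual_slice_dominated s cK KU.
by exists k, G; split=> //; apply: filterS nK => z /H.
Qed.

End TameDual.

(** * Compactly supported functions and their germs *)
Section CompactlySupported.
Variables (R : realType) (X : manifold R).
Notation C := R[i].
Implicit Types (f g : Ccinf X) (x : X).

Lemma smooth_complex_of_real (g : X -> R) : smooth_real g ->
  smooth_complex (fun x => (g x)%:C).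
Proof. by move=> sg; split=> //; exact: smooth_real_cst. Qed.

Lemma Ccinf_ext f g : (forall x, f x = g x) -> f = g.
Proof. by move=> fg; apply: val_inj; apply/funext => x; exact: fg. Qed.

Lemma Cinf_ext (F G : Cinf X) : (forall x, F x = G x) -> F = G.
Proof. by move=> FG; apply: val_inj; apply/funext => x; exact: FG. Qed.

Lemma plateau_Ccinf A (g : X -> R) L : plateau A g L ->
  exists f, forall x, f x = (g x)%:C.
Proof.
move=> [sg _ cL g0 _].
suff H : (fun x => (g x)%:C) \in @smooth_compact_pred R X by exists (MkCcinf H).
apply/asboolP; split; first exact: smooth_complex_of_real.
apply: (subclosed_compact _ cL); first exact: closed_closure.
have /closure_id {1}-> : closed L.
  by apply: compact_closed cL; exact: manifold_hausdorff (manifoldP X).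
apply: closure_subset => x /=; apply: contra_neqP => Lx.
by rewrite g0.
Qed.

Lemma Ccinf_bump x (V : set X) : nbhs x V ->
  exists f, germ_is_one x f /\ forall z, ~ V z -> f z = 0.
Proof.
move=> /exists_bump[b [K [sb b01 b1 [cK KV] b0]]].
have [f fE] : exists f, forall x, f x = (b x)%:C.
  by apply: (@plateau_Ccinf set0 b K); split.
exists f; split=> [|z Vz]; last by rewrite fE b0// => /KV.
by apply: filterS b1 => z bz; rewrite fE bz.
Qed.

Lemma exists_germ_one x : exists f, germ_is_one x f.
Proof. by have [f []] := Ccinf_bump (@filterT _ (nbhs x) _); exists f. Qed.

(** A plateau over the compact support of [f] is a local unit. *)
Lemma local_unitP f : cmul (local_unit f) f = f.
Proof.
suff [g gf] : exists g, cmul g f = f by apply: (@xgetPex _ 0 [set g | cmul g f = f]); exists g.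
have [g0 [L HL]] := compact_plateau (CcinfP f).2; have [g gE] := plateau_Ccinf HL.
exists g; apply: val_inj; apply/funext => x /=; rewrite gE.
have [->|fx] := eqVneq (f x) 0; first by rewrite mulr0.
have [_ _ _ _ /(_ x)H] := HL.
rewrite (nbhs_singleton (H _)) ?mul1r//.
exact: subset_closure.
Qed.

Lemma germ0P x f : reflect (\forall z \near x, f z = 0) (f \in germ0_pred x).
Proof. exact: asboolP. Qed.

Lemma CcinfBE f g x : (f - g) x = f x - g x.
Proof. by []. Qed.

(** Subtract from a local unit of [f] its product with a bump function
    supported in the zeros of [f]. *)
Lemma germ0_absorb x f : f \in germ0_pred x ->
  exists2 a, a \in germ0_pred x & cmul a f = f.
Proof.
move=> /germ0P f0.
have [b [b1 b0]] := Ccinf_bump f0.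
exists (local_unit f - cmul (local_unit f) b).
  apply/germ0P; apply: filterS b1 => z bz.
  rewrite -scaleN1r addrC CcinfE /= bz mulr1 mulN1r addNr.
  by [].
apply: Ccinf_ext => z.
have lu : local_unit f z * f z = f z.
  exact: (congr1 (fun g : Ccinf X => g z) (local_unitP f)).
change ((local_unit f - cmul (local_unit f) b) z * f z = f z).
rewrite CcinfBE /=.
have [->|fz] := eqVneq (f z) 0; first by rewrite mulr0.
rewrite b0 ?mulr0 ?subr0//.
by move=> /= fz0; rewrite fz0 eqxx in fz.
Qed.

Lemma germs_eq x f g : \pi_(germs x) f = \pi_(germs x) g <->
  \forall z \near x, f z = g z.
Proof.
rewrite (rwP eqP) -Quotient.idealrBE -(rwP (germ0P _ _)); split; apply: filterS => z.
  by rewrite -scaleN1r addrC CcinfE mulN1r => /eqP; rewrite addrC subr_eq0 => /eqP.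
by move=> fg; rewrite -scaleN1r addrC CcinfE mulN1r fg addNr.
Qed.

End CompactlySupported.

(** * Dirac elements, fibres and group-like classes *)
Section Diracs.
Variables (R : realType) (M N : manifold R).
Notation C := R[i].
Notation MN := (prod_manifold M N).
Implicit Types (u v : Dirac M N) (F G : Cinf MN) (f g : Ccinf M) (y : N).
Implicit Types (s : seq (N * Ccinf M)).

Lemma Dirac_ext u v : (forall F x, u F x = v F x) -> u = v.
Proof.
move=> uv; apply: val_inj; apply/funext => F; apply: val_inj; apply/funext => x.
exact: uv.
Qed.

Definition dirac_sum s : Dirac M N := \sum_(p <- s) Defs.dirac p.1 p.2.

Lemma dirac_sum_cons p s : dirac_sum (p :: s) = Defs.dirac p.1 p.2 + dirac_sum s.
Proof. by rewrite /dirac_sum big_cons. Qed.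

Lemma DiracDE u v F x : (u + v) F x = u F x + v F x.
Proof. by []. Qed.

Lemma dirac_sumE s F x : dirac_sum s F x = \sum_(p <- s) p.2 x * F (x, p.1).
Proof.
elim: s => [|p s IH]; first by rewrite /dirac_sum !big_nil.
by rewrite dirac_sum_cons DiracDE IH big_cons.
Qed.

(** Adding the coefficients of equal points keeps the points distinct. *)
Lemma dirac_sum_insert y f s : uniq [seq p.1 | p <- s] -> exists s',
  [/\ uniq [seq p.1 | p <- s'], {subset [seq p.1 | p <- s'] <= y :: [seq p.1 | p <- s]} &
      dirac_sum s' = Defs.dirac y f + dirac_sum s].
Proof.
elim: s => [|[y' f'] s IH] /=.
  by exists [:: (y, f)]; split=> //; rewrite dirac_sum_cons.
move=> /andP[y's us]; have [yy'|yy'] := eqVneq y y'.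
  exists ((y', f + f') :: s); split=> //=; first by rewrite y's.
    by move=> z zs; rewrite in_cons zs orbT.
  apply: Dirac_ext => F x; rewrite !dirac_sum_cons !DiracDE /= yy'.
  by rewrite /= mulrDl addrA.
have [s' [us' ss' E]] := IH us; exists ((y', f') :: s'); split=> /=.
- rewrite us' andbT; apply: contra y's => /ss'; rewrite in_cons => /predU1P[y'y|//].
  by rewrite y'y eqxx in yy'.
- move=> z; rewrite !in_cons => /predU1P[->|/ss']; first by rewrite eqxx orbT.
  by rewrite in_cons => /orP[->//|->]; rewrite !orbT.
- by rewrite !dirac_sum_cons E /= addrCA.
Qed.

Lemma Dirac_reprP u : uniq [seq p.1 | p <- Dirac_repr u] /\
  u = dirac_sum (Dirac_repr u).
Proof.
apply: (@xgetPex _ [::] [set s | uniq [seq p.1 | p <- s] /\ u = \sum_(p <- s) Defs.dirac p.1 p.2]).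
have /asboolP[t ut] : Dirac_fun u \in @Dirac_pred R M N by case: u.
have : exists s, uniq [seq p.1 | p <- s] /\
    dirac_sum s = \sum_(p <- t) Defs.dirac p.2.1 (p.1 *: p.2.2).
  elim: {ut} t => [|[a [y f]] t [s [us E]]].
    by exists [::]; rewrite /dirac_sum !big_nil.
  have [s' [us' _ E']] := dirac_sum_insert y (a *: f) us.
  by exists s'; split=> //; rewrite big_cons E' E.
move=> [s [us E]]; exists s; split=> //; rewrite -/(dirac_sum s) E.
apply: Dirac_ext => F x; rewrite ut fct_sumE.
elim: {ut E} t => [|[a [y f]] t IH]; first by rewrite !big_nil.
rewrite !big_cons DiracDE -IH /=.
by rewrite -mulrA.
Qed.

Lemma smooth_complex_snd (g : N -> C) : smooth_complex g ->
  @smooth_complex R MN (fun p => g p.2).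
Proof.
have H (h : N -> R) : smooth_real h -> @smooth_real R MN (fun p => h p.2).
  move=> sh _ [c [d [Mc Nd ->]]] k.
  apply: (Ck_affine (h := rsubmx) (l := rsubmx)) (sh _ Nd k) => //.
  - by apply: (@manifold_open_img R MN); exists c, d.
  - exact: rsubmx_continuous.
  - by rewrite prod_chart_img => z [].
  - by move=> t v z; rewrite linearP.
  - exact: rsubmx_basis.
by move=> [g1 g2]; split; [exact: H g1|exact: H g2].
Qed.

Lemma separate_point y (ys : seq N) : y \notin ys ->
  exists2 g : N -> R, smooth_real g & g y = 1 /\ forall y', y' \in ys -> g y' = 0.
Proof.
elim: ys => [|z ys IH].
  by exists (fun=> 1) => //; exact: smooth_real_cst.
rewrite in_cons negb_or => /andP[yz /IH[g sg [gy g0]]].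
have : nbhs y (~` [set z]).
  apply: open_nbhs_nbhs; split; last exact/eqP.
  apply: closed_openC; apply: accessible_closed_set1; apply: hausdorff_accessible.
  exact: manifold_hausdorff (manifoldP N).
move=> /exists_bump[b [K [sb _ /nbhs_singleton b1 [_ Kz] b0]]].
exists (fun w => b w * g w); first exact: smooth_realM.
rewrite b1 gy mulr1; split=> // y'; rewrite in_cons => /predU1P[->|/g0 ->].
  by rewrite b0 ?mul0r// => /Kz; apply.
by rewrite mulr0.
Qed.

(** The function depends on the second variable only, so it isolates a
    coefficient on all of [M] at once. *)
Lemma select_coefficient s p : uniq [seq q.1 | q <- s] -> p \in s ->
  exists F, (forall x, F (x, p.1) = 1) /\
    forall q, q \in s -> q != p -> forall x, F (x, q.1) = 0.
Proof.
move=> us ps; pose ys := [seq q.1 | q <- s & q.1 != p.1].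
have [|g sg [gp g0]] := @separate_point p.1 ys.
  by apply/mapP => -[q]; rewrite mem_filter => /andP[/eqP qp _] /esym.
have sG : (fun z : MN => (g z.2)%:C) \in @smooth_pred R MN.
  by apply/asboolP/(smooth_complex_snd (g := fun y => (g y)%:C))/smooth_complex_of_real.
exists (MkCinf sG); split=> [x|q qs qp x] /=; first by rewrite gp.
rewrite g0//; apply/mapP; exists q => //; rewrite mem_filter qs andbT.
apply: contra qp => /eqP q1p1; apply/eqP.
have : index q s = index p s.
  apply/eqP; rewrite -(nth_uniq p.1 _ _ us) ?size_map ?index_mem//.
  by rewrite !(nth_map p) ?index_mem// !nth_index// q1p1.
by move=> /(congr1 (nth p s)); rewrite !nth_index.
Qed.

Lemma sum_selected s p F x : uniq [seq q.1 | q <- s] -> p \in s ->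
  (forall x, F (x, p.1) = 1) -> (forall q, q \in s -> q != p -> forall x, F (x, q.1) = 0) ->
  forall h : N * Ccinf M -> C, \sum_(q <- s) h q * F (x, q.1) = h p.
Proof.
move=> us ps F1 F0 h; have us' := map_uniq us.
rewrite (bigD1_seq p)//= F1 mulr1 big_seq_cond big1 ?addr0// => q /andP[qs qp].
by rewrite F0// mulr0.
Qed.

Lemma Dirac_actE f u F x : Dirac_act f u F x = f x * u F x.
Proof.
have [_ ->] := Dirac_reprP u.
rewrite /Dirac_act /= !dirac_sumE mulr_sumr; apply: eq_bigr => p _ /=.
by rewrite mulrCA.
Qed.

Lemma dirac_sum_germ0 (x : M) s : (forall p, p \in s -> p.2 \in germ0_pred x) ->
  dirac_sum s \in @germ0_Dirac_pred R M N x.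
Proof.
elim: s => [|p s IH] Hs; first by rewrite /dirac_sum big_nil rpred0.
rewrite dirac_sum_cons rpredD//; last by apply: IH => q qs; apply: Hs; rewrite in_cons qs orbT.
have [|a a0 ap] := germ0_absorb (Hs p _); first by rewrite mem_head.
apply/asboolP; exists [:: (a, Defs.dirac p.1 p.2)]; first by rewrite /= a0.
rewrite big_seq1 /=; apply: Dirac_ext => F z; rewrite Dirac_actE /=.
by rewrite -{1}ap /= mulrA.
Qed.

(** The coefficients of [u] are among its values by [select_coefficient], and
    a coefficient with zero germ is the product of itself with a function of
    zero germ by [germ0_absorb]. *)
Lemma germ0_DiracP (x : M) u : u \in @germ0_Dirac_pred R M N x <->
  forall F, u F \in germ0_pred x.
Proof.
split=> [/asboolP[t t0 ->] F|H].
  elim: t t0 => [|p t IH] /=; first by rewrite big_nil => _; exact: rpred0.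
  move=> /andP[/germ0P p0 t0]; rewrite big_cons.
  have -> : (Dirac_act p.1 p.2 + \sum_(q <- t) Dirac_act q.1 q.2) F =
    Dirac_act p.1 p.2 F + (\sum_(q <- t) Dirac_act q.1 q.2 : Dirac M N) F by [].
  apply: rpredD; last exact: IH.
  by apply/germ0P; apply: filterS p0 => z pz; rewrite Dirac_actE pz mul0r.
have [us uE] := Dirac_reprP u; rewrite uE; apply: dirac_sum_germ0 => p ps.
have [F [F1 F0]] := select_coefficient us ps.
have /germ0P := H F; rewrite uE => uF; apply/germ0P; apply: filterS uF => z.
by rewrite dirac_sumE (sum_selected z us ps F1 F0).
Qed.

Lemma fiber_classP x u v : fiber_class x u = fiber_class x v <->
  forall F, \forall z \near x, u F z = v F z.
Proof.
rewrite /fiber_class (rwP eqP) -Quotient.idealrBE germ0_DiracP.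
have E F z : (u - v) F z = u F z - v F z.
  by rewrite -scaleN1r addrC DiracE mulN1r addrC.
split=> H F; have := H F; rewrite -(rwP (germ0P _ _)); apply: filterS => z.
  by rewrite E => /eqP; rewrite subr_eq0 => /eqP.
by rewrite E => ->; rewrite subrr.
Qed.

Lemma fiber_class_repr (x : M) (xi : @fiber R M N x) : fiber_class x (repr xi) = xi.
Proof. exact: reprK. Qed.

Lemma repr_fiber_class x u F : \forall z \near x, (repr (fiber_class x u)) F z = u F z.
Proof. by move: F; apply/fiber_classP; exact: fiber_class_repr. Qed.

Lemma repr_germ x f : \forall z \near x, (repr (\pi_(germs x) f)) z = f z.
Proof. by apply/germs_eq; exact: reprK. Qed.

Lemma Cinf_one_subproof : (fun=> 1) \in @smooth_pred R MN.
Proof. by apply/asboolP; exact: (@smooth_complex_cst R MN). Qed.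
Definition Cinf_one : Cinf MN := MkCinf Cinf_one_subproof.

Lemma Cinf_mul_subproof F G : (fun p => F p * G p) \in @smooth_pred R MN.
Proof. by apply/asboolP; apply: (@smooth_complexM R MN); exact: CinfP. Qed.
Definition Cinf_mul F G : Cinf MN := MkCinf (Cinf_mul_subproof F G).

Lemma Cinf_conj_subproof F : (fun p => (F p)^*) \in @smooth_pred R MN.
Proof. by apply/asboolP; apply: (@smooth_complex_conj R MN); exact: CinfP. Qed.
Definition Cinf_conj F : Cinf MN := MkCinf (Cinf_conj_subproof F).

Lemma CcinfDE f g x : (f + g) x = f x + g x. Proof. by []. Qed.

Lemma counitE u x : counit u x = u Cinf_one x.
Proof.
have [_ {2}->] := Dirac_reprP u; rewrite dirac_sumE /counit.
elim: (Dirac_repr u) => [|p s IH]; first by rewrite !big_nil.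
by rewrite !big_cons CcinfDE IH mulr1.
Qed.

Lemma Dirac_conjE u F x : Dirac_conj u F x = (u (Cinf_conj F) x)^*.
Proof.
have [_ {2}->] := Dirac_reprP u; rewrite dirac_sumE rmorph_sum /=.
rewrite /Dirac_conj; elim: (Dirac_repr u) => [|p s IH]; first by rewrite !big_nil.
by rewrite !big_cons DiracDE IH /= rmorphM /= conjcK.
Qed.

(** The bilinear form of a formal tensor on test functions. It is invariant
    under [tensor_eq], so that equalities in the tensor product become
    equalities of functions. *)
Definition pairing F G (t : seq (Dirac M N * Dirac M N)) : Ccinf M :=
  \sum_(p <- t) cmul (p.1 F) (p.2 G).

Lemma pairingE F G t x : pairing F G t x = \sum_(p <- t) p.1 F x * p.2 G x.
Proof.
rewrite /pairing; elim: t => [|p t IH]; first by rewrite !big_nil.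
by rewrite !big_cons CcinfDE IH.
Qed.

Definition comult_seq u : seq (Dirac M N * Dirac M N) :=
  [seq (Defs.dirac p.1 p.2, Defs.dirac p.1 (local_unit p.2)) | p <- Dirac_repr u].

(** The comultiplication is dual to the product of test functions, because a
    coefficient absorbs its local unit. *)
Lemma pairing_comult F G u : pairing F G (comult_seq u) = u (Cinf_mul F G).
Proof.
apply: Ccinf_ext => x; rewrite pairingE big_map.
have [_ {2}->] := Dirac_reprP u; rewrite dirac_sumE; apply: eq_bigr => p _ /=.
have /(congr1 (fun h : Ccinf M => h x)) /= {2}<- := local_unitP p.2.
by rewrite mulrACA [p.2 x * _]mulrC !mulrA.
Qed.

Lemma tensor_sumP (A : Type) (E E' : zmodType) (aE : A -> E -> E) (aE' : A -> E' -> E')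
    (s t : seq (E * E')) :
  tensor_sum aE aE' s = tensor_sum aE aE' t <-> tensor_eq aE aE' s t.
Proof.
rewrite /tensor_sum; split=> [/eqP|H].
  by rewrite eqmodE => /asboolP.
by apply/eqP; rewrite eqmodE; apply/asboolP.
Qed.

Lemma repr_comult u :
  tensor_eq (@Dirac_act R M N) (@Dirac_act R M N) (repr (comult u)) (comult_seq u).
Proof. by apply/tensor_sumP; rewrite /tensor_sum reprK. Qed.

Section Fiber.
Variable x : M.
Notation teq := (tensor_eq (@fiber_act R M N x) (@fiber_act R M N x)).

Lemma fiber_class_act f u :
  fiber_class x (Dirac_act f u) = fiber_act (\pi_(germs x) f) (fiber_class x u).
Proof.
apply/fiber_classP => F.
apply: filterS2 (repr_germ x f) (repr_fiber_class x u F) => z fz uz.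
by rewrite !Dirac_actE fz uz.
Qed.

Lemma fiber_classD u v : fiber_class x (u + v) = fiber_class x u + fiber_class x v.
Proof. by rewrite /fiber_class raddfD. Qed.

Lemma fiber_class0 : fiber_class x (0 : Dirac M N) = 0.
Proof. by rewrite /fiber_class raddf0. Qed.

Definition class_pair (p : Dirac M N * Dirac M N) :=
  (fiber_class x p.1, fiber_class x p.2).

Lemma tensor_eq_class (s t : seq (Dirac M N * Dirac M N)) : tensor_eq (@Dirac_act R M N) (@Dirac_act R M N) s t ->
  teq (map class_pair s) (map class_pair t).
Proof.
elim=> {s t}.
- by move=> s; exact: tensor_refl.
- by move=> s t _; exact: tensor_sym.
- by move=> s t r _ st _; exact: tensor_trans st.
- by move=> s s' t t' _ st _ st'; rewrite !map_cat; exact: tensor_cat.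
- by move=> s t; rewrite !map_cat; exact: tensor_catC.
- by move=> e e' f; rewrite /= /class_pair /= fiber_classD; exact: tensor_Dl.
- by move=> e f f'; rewrite /= /class_pair /= fiber_classD; exact: tensor_Dr.
- by move=> f; rewrite /= /class_pair /= fiber_class0; exact: tensor_0l.
- by move=> e; rewrite /= /class_pair /= fiber_class0; exact: tensor_0r.
- by move=> a e f; rewrite /= /class_pair /= !fiber_class_act; exact: tensor_act.
Qed.

Lemma fiber_comultE (xi : @fiber R M N x) : teq
  [seq (fiber_class x p.1, fiber_class x p.2) | p <- repr (comult (repr xi))]
  (map class_pair (comult_seq (repr xi))).
Proof. exact: (tensor_eq_class (repr_comult (repr xi))). Qed.

(** Representatives are chosen by [repr], so only the germ of this function at
    [x] is attached to the tensor. *)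
Definition fiber_pairing F G (t : seq (@fiber R M N x * @fiber R M N x)) : Ccinf M :=
  pairing F G [seq (repr p.1, repr p.2) | p <- t].

Lemma repr_fiberD (xi eta : @fiber R M N x) F :
  \forall z \near x, (repr (xi + eta)) F z = repr xi F z + repr eta F z.
Proof.
have H : fiber_class x (repr (xi + eta)) = fiber_class x (repr xi + repr eta).
  by rewrite fiber_classD !fiber_class_repr.
exact: (fiber_classP x _ _).1 H F.
Qed.

Lemma repr_fiber0 F : \forall z \near x, (repr (0 : @fiber R M N x)) F z = 0.
Proof.
have H : fiber_class x (repr (0 : @fiber R M N x)) = fiber_class x 0.
  by rewrite fiber_class0 fiber_class_repr.
exact: (fiber_classP x _ _).1 H F.
Qed.

Lemma repr_fiber_act a (xi : @fiber R M N x) F :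
  \forall z \near x, (repr (fiber_act a xi)) F z = repr a z * repr xi F z.
Proof.
apply: filterS (repr_fiber_class x (Dirac_act (repr a) (repr xi)) F) => z ->.
by rewrite Dirac_actE.
Qed.

Lemma fiber_pairing_eq F G (s t : seq (@fiber R M N x * @fiber R M N x)) : teq s t ->
  \forall z \near x, fiber_pairing F G s z = fiber_pairing F G t z.
Proof.
have E r z : fiber_pairing F G r z = \sum_(p <- r) repr p.1 F z * repr p.2 G z.
  by rewrite /fiber_pairing pairingE big_map.
elim=> {s t}.
- by move=> s; exact: nearW.
- by move=> s t _; apply: filterS => z ->.
- by move=> s t r _ H1 _ H2; apply: filterS2 H1 H2 => z -> ->.
- by move=> s s' t t' _ H1 _ H2; apply: filterS2 H1 H2 => z; rewrite !E !big_cat /= => -> ->.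
- by move=> s t; apply: nearW => z; rewrite !E !big_cat /= addrC.
- move=> e e' f; apply: filterS (repr_fiberD e e' F) => z.
  by rewrite !E big_seq1 big_cons big_seq1 /= => ->; rewrite mulrDl.
- move=> e f f'; apply: filterS (repr_fiberD f f' G) => z.
  by rewrite !E big_seq1 big_cons big_seq1 /= => ->; rewrite mulrDr.
- by move=> f; apply: filterS (repr_fiber0 F) => z; rewrite !E big_seq1 big_nil /= => ->; rewrite mul0r.
- by move=> e; apply: filterS (repr_fiber0 G) => z; rewrite !E big_seq1 big_nil /= => ->; rewrite mulr0.
- move=> a e f; apply: filterS2 (repr_fiber_act a e F) (repr_fiber_act a f G) => z.
  by rewrite !E !big_seq1 /= => -> ->; rewrite mulrAC mulrC mulrCA mulrA.
Qed.

Lemma grouplikeE (xi : @fiber R M N x) : grouplike xi <->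
  teq (map class_pair (comult_seq (repr xi))) [:: (xi, xi)] /\
  germ_is_one x (repr xi Cinf_one).
Proof.
rewrite /grouplike /=; split=> -[H1 H2]; split.
- apply: tensor_trans (tensor_sym (fiber_comultE xi)) _.
  exact: (tensor_sumP _ _ _ _).1 H1.
- have [f f1 /germs_eq H] := H2; apply: filterS2 f1 H => z f1z.
  by rewrite counitE f1z.
- by apply/tensor_sumP; exact: tensor_trans (fiber_comultE xi) H1.
- exists (repr xi Cinf_one) => //; apply/germs_eq; apply: nearW => z.
  exact: counitE.
Qed.

(** Evaluate on the functions that isolate a coefficient. *)
Lemma localized_coefficients s y : uniq [seq p.1 | p <- s] ->
  (forall F, \forall z \near x, dirac_sum s F z = F (z, y)) ->
  y \in [seq p.1 | p <- s] /\
  forall p, p \in s -> \forall z \near x, p.2 z = (p.1 == y)%:R.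
Proof.
move=> us uE.
have ys : y \in [seq p.1 | p <- s].
  apply/negPn/negP => ys.
  have [||F [F1 F0]] := @select_coefficient ((y, 0) :: s) (y, 0).
  - by rewrite /= ys.
  - exact: mem_head.
  have /nbhs_singleton := uE F; rewrite dirac_sumE F1 big_seq big1 => [/eqP|p ps].
    by rewrite eq_sym oner_eq0.
  rewrite F0 ?mulr0// ?in_cons ?ps ?orbT//.
  by apply: contraNneq ys => py; apply/mapP; exists p => //; rewrite py.
split=> // p ps; have [F [F1 F0]] := select_coefficient us ps.
apply: filterS (uE F) => z.
rewrite dirac_sumE (sum_selected z us ps F1 F0) => ->.
have [<-|py] := eqVneq p.1 y; first exact: F1.
move: ys => /mapP[q qs yq]; rewrite yq F0//.
by apply: contraNneq py => <-; rewrite yq.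
Qed.

(** The terms at points other than [y] have a zero factor in the fibre. In the
    term at [y] both factors are [xi], because a local unit of a function with
    germ one has germ one. The case without a term at [y] is there for the
    induction. *)
Lemma tensor_eq_localized s y (xi : @fiber R M N x) : uniq [seq p.1 | p <- s] ->
  (forall p, p \in s -> \forall z \near x, p.2 z = (p.1 == y)%:R) ->
  (forall f, germ_is_one x f -> fiber_class x (Defs.dirac y f) = xi) ->
  teq (map class_pair [seq (Defs.dirac p.1 p.2, Defs.dirac p.1 (local_unit p.2)) | p <- s])
      (if y \in [seq p.1 | p <- s] then [:: (xi, xi)] else [::]).
Proof.
move=> + + yxi; elim: s => [|p s IH] /=; first by move=> _ _; exact: tensor_refl.
move=> /andP[ps us] ps1.
have {}IH := IH us (fun q qs => ps1 q (mem_behead (s := p :: s) qs)).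
have p1 := ps1 p (mem_head _ _); rewrite in_cons.
set a := class_pair _; set l := map _ _ in IH *.
have [yp|yp] /= := eqVneq y p.1.
  rewrite yp (negbTE ps) in IH.
  have p_one : germ_is_one x p.2 by apply: filterS p1 => z ->; rewrite yp eqxx.
  have lu_one : germ_is_one x (local_unit p.2).
    apply: filterS p_one => z p2z.
    have /(congr1 (fun h : Ccinf M => h z)) /= := local_unitP p.2.
    by rewrite p2z mulr1.
  rewrite (_ : a = (xi, xi)); last by rewrite /a /class_pair /= -yp !yxi.
  by rewrite -cat1s -[X in teq _ X]cats0; apply: tensor_cat => //; exact: tensor_refl.
rewrite (_ : a = (0, fiber_class x (Defs.dirac p.1 (local_unit p.2)))).
  by rewrite -cat1s -[X in teq _ X]cat0s; apply: tensor_cat => //; exact: tensor_0l.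
rewrite /a /class_pair /= -fiber_class0; congr pair.
apply/fiber_classP => F; apply: filterS p1 => z /= ->.
by rewrite eq_sym (negbTE yp) mul0r.
Qed.

Lemma dirac_class_eq y f g : germ_is_one x f -> germ_is_one x g ->
  fiber_class x (Defs.dirac y f) = fiber_class x (Defs.dirac y g).
Proof.
by move=> f1 g1; apply/fiber_classP => F; apply: filterS2 f1 g1 => z /= -> ->.
Qed.

Lemma dirac_grouplike y f : germ_is_one x f ->
  grouplike (fiber_class x (Defs.dirac y f)).
Proof.
move=> f1; apply/grouplikeE; set xi := fiber_class _ _; set u := repr xi.
have uE F : \forall z \near x, u F z = F (z, y).
  by apply: filterS2 f1 (repr_fiber_class x (Defs.dirac y f) F) => z f1z ->; rewrite /= f1z mul1r.
split; last by apply: filterS (uE Cinf_one) => z ->.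
have [us uS] := Dirac_reprP u.
have [|ys coef] := localized_coefficients us (y := y).
  by move=> F; rewrite -uS.
have xiE g : germ_is_one x g -> fiber_class x (Defs.dirac y g) = xi.
  by move=> g1; exact: dirac_class_eq.
have := tensor_eq_localized us coef xiE.
by rewrite ys.
Qed.

Lemma dirac_class_inj y y' f f' : germ_is_one x f -> germ_is_one x f' ->
  fiber_class x (Defs.dirac y f) = fiber_class x (Defs.dirac y' f') -> y = y'.
Proof.
move=> f1 f'1 /fiber_classP E; apply/eqP/negPn/negP => yy'.
have [||F [F1 F0]] := @select_coefficient [:: (y, 0); (y', 0)] (y, 0).
- by rewrite /= inE yy'.
- exact: mem_head.
have /nbhs_singleton := E F; rewrite /= F1 (nbhs_singleton f1) (nbhs_singleton f'1).
rewrite (F0 (y', 0)) ?inE ?eqxx ?orbT//; last by rewrite xpair_eqE eqxx andbT eq_sym.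
by rewrite mulr0 mulr1 => /eqP; rewrite oner_eq0.
Qed.

Lemma repr_pairing F G (t : seq (Dirac M N * Dirac M N)) :
  \forall z \near x, fiber_pairing F G (map class_pair t) z = pairing F G t z.
Proof.
elim: t => [|p t IH].
  by apply: nearW => z; rewrite /fiber_pairing /pairing !big_nil.
apply: filterS3 IH (repr_fiber_class x p.1 F) (repr_fiber_class x p.2 G) => z.
rewrite /fiber_pairing !pairingE /= !big_cons /= => -> ->.
by move=> ->.
Qed.

Lemma grouplike_multiplicative (xi : @fiber R M N x) F G : grouplike xi ->
  \forall z \near x, repr xi (Cinf_mul F G) z = repr xi F z * repr xi G z.
Proof.
move=> /grouplikeE[/(fiber_pairing_eq F G) H _].
apply: filterS2 H (repr_pairing F G (comult_seq (repr xi))) => z.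
rewrite pairing_comult => + <- => ->.
by rewrite /fiber_pairing pairingE big_seq1.
Qed.

(** By the counit some coefficient [f], at a point [y], satisfies [f x != 0].
    If [F] isolates this coefficient, then [u F = f] and
    [u (G F) = f * G (_, y)]. As [u] is multiplicative near [x], the germ of
    [f] is idempotent, hence one, and then [u G = G (_, y)] near [x] for all
    [G]. *)
Lemma grouplike_dirac (xi : @fiber R M N x) : grouplike xi ->
  exists y f, germ_is_one x f /\ xi = fiber_class x (Defs.dirac y f).
Proof.
move=> gxi; have [_ one] := (grouplikeE xi).1 gxi.
set u := repr xi in one; have [us uS] := Dirac_reprP u; set s := Dirac_repr u in us uS.
have uM F G : \forall z \near x, u (Cinf_mul F G) z = u F z * u G z.
  exact: grouplike_multiplicative.
have [p ps px] : exists2 p, p \in s & p.2 x != 0.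
  apply: contrapT => H; have := nbhs_singleton one.
  rewrite uS dirac_sumE big_seq big1 => [/eqP|p ps]; first by rewrite eq_sym oner_eq0.
  apply/eqP/negPn/negP => px; apply: H; exists p => //.
  by apply: contra px => /eqP ->; rewrite mul0r.
have [F [F1 F0]] := select_coefficient us ps.
have uF z : u F z = p.2 z by rewrite uS dirac_sumE (sum_selected z us ps F1 F0).
have uGF G z : u (Cinf_mul G F) z = p.2 z * G (z, p.1).
  rewrite uS dirac_sumE /=.
  under eq_bigr do rewrite mulrA.
  exact: (sum_selected z us ps F1 F0 (fun q => q.2 z * G (z, q.1))).
have idem : \forall z \near x, p.2 z = p.2 z * p.2 z.
  by apply: filterS (uM F F) => z; rewrite uGF F1 mulr1 uF.
have p_one : germ_is_one x p.2.
  have p1x : p.2 x = 1.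
    apply: (mulfI px); rewrite mulr1; symmetry; exact: nbhs_singleton idem.
  have : nbhs x [set z | 0 < complex.Re (p.2 z)].
    by apply: smooth_real_gt0_near; [exact: (CcinfP p.2).1.1|rewrite p1x /= ltr01].
  apply: filterS2 idem => z idz /= p0; apply: (mulfI (x := p.2 z)); last by rewrite mulr1.
  by apply: contraTneq p0 => ->; rewrite ltxx.
exists p.1, p.2; split=> //; rewrite -[xi](fiber_class_repr (x := x)).
apply/fiber_classP => G; apply: filterS2 p_one (uM G F) => z p1z.
by rewrite uGF uF /= p1z !mul1r mulr1 => <-.
Qed.

End Fiber.

(** * The dual as an algebra of smooth functions *)
Section Dual.
Implicit Types phi psi : Dirac M N -> Ccinf M.

Lemma pairing_eq F G (s t : seq (Dirac M N * Dirac M N)) :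
  tensor_eq (@Dirac_act R M N) (@Dirac_act R M N) s t -> pairing F G s = pairing F G t.
Proof.
have cat r r' : pairing F G (r ++ r') = pairing F G r + pairing F G r'.
  by rewrite /pairing big_cat.
have one (e f : Dirac M N) : pairing F G [:: (e, f)] = cmul (e F) (f G).
  by rewrite /pairing big_seq1.
have two p q : pairing F G [:: p; q] = pairing F G [:: p] + pairing F G [:: q].
  by rewrite -cat.
elim=> {s t} //.
- by move=> s t r _ -> _ ->.
- by move=> s s' t t' _ H1 _ H2; rewrite !cat H1 H2.
- by move=> s t; rewrite !cat addrC.
- move=> e e' f; rewrite two !one; apply: Ccinf_ext => x.
  by change ((e F x + e' F x) * f G x = e F x * f G x + e' F x * f G x); exact: mulrDl.
- move=> e f f'; rewrite two !one; apply: Ccinf_ext => x.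
  by change (e F x * (f G x + f' G x) = e F x * f G x + e F x * f' G x); exact: mulrDr.
- move=> f; rewrite one /pairing big_nil; apply: Ccinf_ext => x.
  by change (0 * f G x = 0); exact: mul0r.
- move=> e; rewrite one /pairing big_nil; apply: Ccinf_ext => x.
  by change (e F x * 0 = 0); exact: mulr0.
- move=> a e f; rewrite !one; apply: Ccinf_ext => x.
  by rewrite /= !Dirac_actE mulrCA mulrA.
Qed.

Lemma pairing_repr_comult F G u : pairing F G (repr (comult u)) = u (Cinf_mul F G).
Proof. by rewrite (pairing_eq F G (repr_comult u)) pairing_comult. Qed.

Definition germ_one (x : M) : Ccinf M := projT1 (cid (exists_germ_one x)).

Lemma germ_oneP x : germ_is_one x (germ_one x).
Proof. exact: projT2 (cid (exists_germ_one x)). Qed.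

(** The function on the product that represents [phi]. The coefficient
    [germ_one] changes with the point, but by linearity over functions on [M]
    the value is independent of it. *)
Definition symbol phi (p : MN) : C := phi (Defs.dirac p.2 (germ_one p.1)) p.1.

(** For [e = germ_one x] the products of [e] with [dirac y f] and of [f] with
    [dirac y e] agree, and [phi] is linear over functions on [M]. *)
Lemma symbolE phi y f x : is_dual phi ->
  phi (Defs.dirac y f) x = f x * symbol phi (x, y).
Proof.
move=> [_ mphi _]; rewrite /symbol /=; set e := germ_one x.
have ex : e x = 1 by exact: nbhs_singleton (germ_oneP x).
have E : Dirac_act e (Defs.dirac y f) = Dirac_act f (Defs.dirac y e).
  by apply: Dirac_ext => F z; rewrite !Dirac_actE /= mulrCA.
have /(congr1 (fun h : Ccinf M => h x)) := mphi e (Defs.dirac y f).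
by rewrite E mphi /= ex mul1r.
Qed.

Lemma symbol_germ phi y f x : is_dual phi -> germ_is_one x f ->
  symbol phi (x, y) = phi (Defs.dirac y f) x.
Proof. by move=> dphi f1; rewrite symbolE// (nbhs_singleton f1) mul1r. Qed.

(** Near [x] the coefficient can be kept fixed, and the symbol becomes a slice
    as in [dual_slice_tame]. *)
Lemma smooth_symbol_Re phi : is_dual phi ->
  @smooth_real R MN (fun p => complex.Re (symbol phi p)).
Proof.
move=> dphi _ [c [d [Mc Nd ->]]] k; apply: Ck_local => _ [[x y] [/= cx dy] <-].
have Hc := manifold_is_chart Mc; have Hd := manifold_is_chart Nd.
set e := germ_one x; pose A := [set z | e z = 1]°.
pose V := joint_dom (c @` (chart_dom c `&` A)) (chart_img d).
exists V, (joint (dual_slice c d e phi)); split.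
- apply: joint_dom_open; last exact: chart_img_open Hd.
  by apply: chart_image_open => //; exact: open_interior.
- split; rewrite /= ?row_mxKl ?row_mxKr; last by exists y.
  by exists x => //; split=> //; exact: (germ_oneP x).
- apply: (@CkW _ _ (joint_dom (chart_img c) (chart_img d))); last first.
    exact: (tame_smooth (chart_img_open Hc) (chart_img_open Hd) (@dual_slice_tame R M N c d e Mc Nd phi dphi) k).
  by move=> z [/= [x' [cx' _] E] ?]; split=> //; exists x'.
- move=> z [/= [x' [cx' /interior_subset /= ex'] E] dz].
  rewrite /local_rep /joint /dual_slice /= /local_rep /= -E (chartK Hc)//.
  by rewrite [in RHS]symbolE// ex' mul1r.
Qed.

Lemma symbol_real phi p : dual_real phi -> complex.Im (symbol phi p) = 0.
Proof.
case: p => x y [dphi rphi]; set e := germ_one x.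
have ex : e x = 1 by exact: nbhs_singleton (germ_oneP x).
have E : Dirac_conj (Defs.dirac y e) = Defs.dirac y (cconj e).
  by apply: Dirac_ext => F z; rewrite Dirac_conjE /= rmorphM /= conjcK.
have /(congr1 (fun h : Ccinf M => h x)) := rphi (Defs.dirac y e).
rewrite E /= !symbolE//= ex conjc1 !mul1r.
by case: (symbol phi (x, y)) => a b /= [bb]; lra.
Qed.

Lemma dual_symbolE phi u x : is_dual phi ->
  forall F, (forall p, F p = symbol phi p) -> phi u x = u F x.
Proof.
move=> dphi F FE; have [_ ->] := Dirac_reprP u; rewrite dirac_sumE.
have [lin _ _] := dphi.
elim: (Dirac_repr u) => [|p s IH].
  by rewrite /dirac_sum !big_nil dual0.
rewrite dirac_sum_cons big_cons -[Defs.dirac _ _]scale1r lin CcinfE mul1r IH.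
by rewrite symbolE// FE.
Qed.

Variable h : MN -> R.
Hypothesis sh : smooth_real h.

Lemma Cinf_of_real_subproof : (fun p => (h p)%:C) \in @smooth_pred R MN.
Proof. by apply/asboolP; exact: (@smooth_complex_of_real R MN). Qed.
Definition Cinf_of_real : Cinf MN := MkCinf Cinf_of_real_subproof.

Definition hat (u : Dirac M N) : Ccinf M := u Cinf_of_real.

(** The continuity holds because a single function is a bounded set. *)
Lemma hat_dual : is_dual hat.
Proof.
split=> [//|f u|u U [A [e [fA AP e0 HU]]]].
  by apply: Ccinf_ext => x; rewrite /hat Dirac_actE.
exists [set S : Cinf MN -> Ccinf M | U (S Cinf_of_real)]; last by [].
exists [set Cinf_of_real], [set v | forall p, A p -> p v < e]; split.
- by move=> p _; exists (p Cinf_of_real) => _ ->.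
- by exists A, e; split=> // w Hw p Ap; rewrite -[w]subr0; exact: Hw.
- by move=> S HS; apply: HU => p Ap; exact: HS.
Qed.

Lemma hat_real : dual_real hat.
Proof.
split; first exact: hat_dual.
move=> u; apply: Ccinf_ext => x.
change ((Dirac_conj u Cinf_of_real x)^* = u Cinf_of_real x).
rewrite Dirac_conjE conjcK; congr (u _ x).
by apply: Cinf_ext => p; exact: conjc_real.
Qed.

Lemma symbol_hat p : symbol hat p = (h p)%:C.
Proof.
case: p => x y; rewrite /symbol /hat /= (nbhs_singleton (germ_oneP x)).
by rewrite mul1r.
Qed.

End Dual.
End Diracs.

(** * Transport of a manifold structure along a homeomorphism *)
Section Transport.
Variables (R : realType) (X : manifold R) (T : topologicalType).
Variables (f : X -> T) (g : T -> X).
Hypotheses (fK : cancel f g) (gK : cancel g f).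
Hypotheses (cf : continuous f) (cg : continuous g).

Definition transport_chart (c : chart R X (Defs.dim X)) : chart R T (Defs.dim X) :=
  Chart (g @^-1` chart_dom c) (c \o g) (f \o chart_inv c).

Definition transport_atlas : set (chart R T (Defs.dim X)) :=
  [set transport_chart c | c in @atlas R X].

Definition transport_space : charted_space R := ChartedSpace transport_atlas.

Lemma transport_img c : chart_img (transport_chart c) = chart_img c.
Proof.
apply/seteqP; split=> [_ [t /= ct <-]|_ [x cx <-]]; first by exists (g t).
by exists (f x); rewrite /= fK.
Qed.

Lemma transport_manifold : is_manifold transport_space.
Proof.
have [hX sX cX covX cpX] := manifoldP X.
split.
- move=> p q pq; rewrite -[p]gK -[q]gK; congr f; apply: hX => A B nA nB.
  have [t [At Bt]] := pq _ _ (cg nA) (cg nB).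
  by exists (g t).
- have [B cB [oB bB]] := sX.
  exists [set g @^-1` A | A in B].
    exact: sub_countable (card_image_le _ _) cB.
  split=> [_ [A BA <-]|t V nV].
    by apply: open_comp; [move=> ? _; exact: cg|exact: oB].
  have : nbhs (g t) (f @^-1` V) by apply: cf; rewrite gK.
  move=> /bB[A [BA At] AV]; exists (g @^-1` A); first by split=> //; exists A.
  by move=> t' /AV /=; rewrite gK.
- move=> _ [c Xc <-]; have Hc := cX c Xc; split; rewrite ?transport_img.
  + by apply: open_comp; [move=> ? _; exact: cg|exact: chart_dom_open Hc].
  + exact: chart_img_open Hc.
  + by move=> t /= ct; rewrite (chartK Hc)// gK.
  + move=> t /= ct; apply: continuous_comp; first exact: cg.
    exact: (chart_continuous Hc).
  + move=> z cz; apply: continuous_comp; last exact: cf.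
    exact: (chart_inv_continuous Hc).
- move=> t; have [c Xc ct] := covX (g t); exists (transport_chart c) => //.
  by exists c.
- move=> _ _ [c Xc <-] [d Xd <-] j k.
  rewrite (_ : transport_chart c @` _ = c @` (chart_dom c `&` chart_dom d)); last first.
    apply/seteqP; split=> [_ [t /= ct <-]|_ [x cx <-]]; first by exists (g t).
    by exists (f x); rewrite /= fK.
  rewrite (_ : local_rep _ _ = local_rep c (fun x => d x ord0 j)).
    exact: cpX.
  by apply/funext => z; rewrite /local_rep /= fK.
Qed.

Lemma transport_smooth (h : T -> R) :
  @smooth_real R transport_space h <-> @smooth_real R X (h \o f).
Proof.
split=> sh c; last first.
  by move=> [c' Xc' <-] k; rewrite transport_img; exact: sh.
by move=> Xc k; have := sh (transport_chart c) (ex_intro2 _ _ c Xc erefl) k; rewrite transport_img.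
Qed.

End Transport.

(** * The spectrum of the real dual and the spectral bundle *)
Section Spectrum.
Variables (R : realType) (M N : manifold R).
Notation C := R[i].
Notation MN := (prod_manifold M N).
Notation DR := (set_type (@dual_real R M N)).

Lemma dual_real_is_dual (phi : DR) : is_dual (set_val phi).
Proof. by have [] := set_valP phi. Qed.

Definition real_symbol (phi : DR) (p : MN) : R := complex.Re (symbol (set_val phi) p).

Lemma real_symbolE (phi : DR) p : (real_symbol phi p)%:C = symbol (set_val phi) p.
Proof.
have := symbol_real p (set_valP phi); rewrite /real_symbol.
by case: (symbol _ _) => a b /= ->.
Qed.

Lemma smooth_real_symbol (phi : DR) : @smooth_real R MN (real_symbol phi).
Proof. exact: smooth_symbol_Re (dual_real_is_dual phi). Qed.

Definition real_hat (h : MN -> R) (sh : @smooth_real R MN h) : DR :=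
  exist _ (hat sh) (mem_set (hat_real sh)).

Lemma real_symbol_hat h (sh : @smooth_real R MN h) p : real_symbol (real_hat sh) p = h p.
Proof. by rewrite /real_symbol /= symbol_hat. Qed.

Lemma dual_hat (phi : DR) u x :
  set_val phi u x = u (Cinf_of_real (smooth_real_symbol phi)) x.
Proof.
apply: dual_symbolE; first exact: dual_real_is_dual.
by move=> p; exact: real_symbolE.
Qed.

Lemma real_hatK (phi : DR) : real_hat (smooth_real_symbol phi) = phi.
Proof.
apply: val_inj; apply/funext => u /=; apply: Ccinf_ext => x.
by rewrite dual_hat.
Qed.

Lemma convolution_symbol (phi psi : DR) p :
  symbol (convolution (set_val phi) (set_val psi)) p =
  symbol (set_val phi) p * symbol (set_val psi) p.
Proof.
case: p => x y; rewrite {1}/symbol /=; set u := Defs.dirac _ _.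
pose F := Cinf_of_real (smooth_real_symbol phi).
pose G := Cinf_of_real (smooth_real_symbol psi).
have -> : convolution (set_val phi) (set_val psi) u = pairing F G (repr (comult u)).
  rewrite /convolution /pairing; apply: eq_bigr => q _; apply: Ccinf_ext => z /=.
  by rewrite !dual_hat.
rewrite pairing_repr_comult /= (nbhs_singleton (germ_oneP x)) mul1r.
by rewrite !real_symbolE.
Qed.

Definition evaluation (p : MN) (phi : DR) : R := real_symbol phi p.

Lemma evaluation_character p : is_character (evaluation p).
Proof.
have inj (a b : R) : a%:C = b%:C -> a = b by move=> [].
split.
- move=> phi psi theta H; apply: inj.
  by rewrite rmorphD /= /evaluation !real_symbolE /symbol H.
- move=> r phi theta H; apply: inj.
  by rewrite rmorphM /= /evaluation !real_symbolE /symbol H.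
- move=> phi psi theta H; apply: inj.
  by rewrite rmorphM /= /evaluation !real_symbolE H convolution_symbol.
- exists (real_hat (@smooth_real_cst R MN 1)).
  by rewrite /evaluation real_symbol_hat oner_eq0.
Qed.

Definition point (p : MN) : spec M N := exist _ (evaluation p) (mem_set (evaluation_character p)).

Lemma pointE p phi : spec_eval (point p) phi = real_symbol phi p.
Proof. by []. Qed.

Lemma point_inj : injective point.
Proof.
move=> p q pq; apply/eqP/negPn/negP => npq.
have [|g sg [gp g0]] := @separate_point R MN p [:: q]; first by rewrite inE.
have : spec_eval (point p) (real_hat sg) = spec_eval (point q) (real_hat sg) by rewrite pq.
by rewrite !pointE !real_symbol_hat gp g0 ?mem_head// => /eqP; rewrite oner_eq0.
Qed.

(** Through [real_symbol] and [real_hat] the real dual is the algebra of smooth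
    functions on the product, whose characters are evaluations. *)
Lemma point_surj (chi : spec M N) : exists p, chi = point p.
Proof.
have [chiD chiZ chiM [phi0 chi0]] := set_valP chi.
(* The character read on functions, with the default value zero on those which
   are not smooth. *)
pose X (h : MN -> R) : R := if pselect (@smooth_real R MN h) is left sh
  then set_val chi (real_hat sh) else 0.
have XE h (sh : @smooth_real R MN h) : X h = set_val chi (real_hat sh).
  by rewrite /X; case: pselect => // sh'; rewrite (Prop_irrelevance sh' sh).
have symE (phi : DR) : set_val chi phi = X (real_symbol phi).
  by rewrite (XE _ (smooth_real_symbol phi)) real_hatK.
have valE (phi : DR) u x : set_val phi u x =
    \sum_(p <- Dirac_repr u) p.2 x * (real_symbol phi (x, p.1))%:C.
  rewrite dual_hat; have [_ {1}->] := Dirac_reprP u.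
  by rewrite dirac_sumE.
have [p Hp] : exists p, forall h, @smooth_real R MN h -> X h = h p.
  apply: (@character_is_evaluation R MN).
  - move=> h k sh sk; rewrite (XE _ sh) (XE _ sk) (XE _ (smooth_realD sh sk)).
    apply: chiD => u; apply: Ccinf_ext => x; rewrite CcinfDE !valE -big_split /=.
    by apply: eq_bigr => q _; rewrite !real_symbol_hat rmorphD mulrDr.
  - move=> r h sh; rewrite (XE _ sh) (XE _ (smooth_realM (@smooth_real_cst R MN r) sh)).
    apply: chiZ => u; apply: Ccinf_ext => x.
    rewrite -[r%:C *: _]addr0 CcinfE addr0 !valE mulr_sumr.
    by apply: eq_bigr => q _; rewrite !real_symbol_hat rmorphM /= mulrCA.
  - move=> h k sh sk; rewrite (XE _ sh) (XE _ sk) (XE _ (smooth_realM sh sk)).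
    apply: chiM; apply/funext => u; apply: Ccinf_ext => x /=.
    change (hat (smooth_realM sh sk) u x =
      pairing (Cinf_of_real sh) (Cinf_of_real sk) (repr (comult u)) x).
    rewrite pairing_repr_comult /hat; congr (u _ x).
    by apply: Cinf_ext => q /=; rewrite -rmorphM.
  - by exists (real_symbol phi0); [exact: smooth_real_symbol|rewrite -symE].
exists p; apply: val_inj; apply/funext => phi.
transitivity (X (real_symbol phi)); first exact: symE.
exact: Hp _ (smooth_real_symbol phi).
Qed.

Definition unpoint (chi : spec M N) : MN := projT1 (cid (point_surj chi)).

Lemma unpointK : cancel unpoint point.
Proof. by move=> chi; rewrite /unpoint; case: cid => p /= ->. Qed.

Lemma pointK : cancel point unpoint.
Proof. by move=> p; apply: point_inj; rewrite unpointK. Qed.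

Lemma point_continuous : continuous point.
Proof.
apply: continuous_comp_initial => p; apply/cvg_sup => phi.
apply: (@continuous_comp_initial _ MN R (fun chi : {ptws DR -> R} => chi phi)).
exact: (smooth_real_continuous (smooth_real_symbol phi)).
Qed.

Lemma spec_eval_continuous (phi : DR) : continuous (fun chi : spec M N => spec_eval chi phi).
Proof.
move=> chi.
have c1 : {for chi, continuous (@spec_eval R M N : spec M N -> {ptws DR -> R})}.
  exact: initial_continuous.
exact: (continuous_comp c1 (@proj_continuous DR (fun=> R) phi _)).
Qed.

(** Bump functions belong to the real dual, so the weak topology is as fine as
    that of the product. *)
Lemma unpoint_continuous : continuous unpoint.
Proof.
move=> chi V; rewrite -{1}[chi]unpointK pointK => /exists_bump[b [K [sb _ b1 [_ KV] b0]]].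
set p := unpoint chi in b1.
have : nbhs chi [set chi' : spec M N | 0 < spec_eval chi' (real_hat sb)].
  have chib : 0 < spec_eval chi (real_hat sb).
    by rewrite -[chi]unpointK pointE real_symbol_hat (nbhs_singleton b1).
  have c := @spec_eval_continuous (real_hat sb) chi.
  exact: (c _ (lt_nbhsr chib)).
apply: filterS => chi' /=; rewrite -{1}[chi']unpointK pointE real_symbol_hat => bp.
by apply: KV; apply: contrapT => /b0 bp0; rewrite bp0 ltxx in bp.
Qed.

Lemma natural_atlas_exists : natural_atlas (transport_atlas point unpoint).
Proof.
split.
  exact: transport_manifold pointK unpointK point_continuous unpoint_continuous.
move=> h; split.
  move=> /(transport_smooth pointK) sh; exists (real_hat sh) => chi.
  by rewrite -[chi]unpointK pointE real_symbol_hat.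
move=> [phi hphi]; apply/(transport_smooth pointK).
rewrite (_ : h \o point = real_symbol phi); first exact: smooth_real_symbol.
by apply/funext => p; rewrite /= hphi.
Qed.

Lemma Esp_val_inj : injective (@Esp_val R M N).
Proof.
move=> [x xi] [x' xi'] /= E; have xx' : x = x' by exact: (congr1 (@projT1 _ _) E).
subst x'; congr existT; apply: val_inj.
exact: (@eq_from_Tagged M (fun x => @fiber R M N x) x _ _) E.
Qed.

Lemma Esp_dirac (e : Esp M N) : exists y f, germ_is_one (pi_sp e) f /\
  Esp_val e = existT (fun x => @fiber R M N x) (pi_sp e) (fiber_class (pi_sp e) (Defs.dirac y f)).
Proof.
case: e => x xi; have [y [f [f1 E]]] := grouplike_dirac (set_valP xi).
by exists y, f; split=> //; exact: (congr1 (existT _ _) E).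
Qed.

Definition Esp_point (p : MN) : Esp M N :=
  existT _ p.1 (exist _ (fiber_class p.1 (Defs.dirac p.2 (germ_one p.1)))
    (mem_set (dirac_grouplike p.2 (germ_oneP p.1)))).

Lemma Esp_point_spec : Phi_spec Esp_point.
Proof.
move=> x; split; first exact: exists_germ_one.
move=> y f f1; rewrite /Esp_val /=; congr existT.
exact: dirac_class_eq (germ_oneP x) f1.
Qed.

Lemma existT_fiber_inj (x : M) (xi xi' : @fiber R M N x) :
  existT (fun x => @fiber R M N x) x xi = existT (fun x => @fiber R M N x) x xi' -> xi = xi'.
Proof. exact: (@eq_from_Tagged M (fun x => @fiber R M N x) x _ _). Qed.

(** Each group-like class is that of a Dirac element, at a point which is
    unique by [dirac_class_inj]. *)
Lemma Theta_exists : exists Theta : Esp M N -> spec M N, Theta_spec Theta.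
Proof.
have [y Hy] := choice Esp_dirac.
exists (fun e => point (pi_sp e, y e)) => e y' f' f'1 E phi.
have [f [f1 E']] := Hy e; rewrite E' in E.
have /dirac_class_inj : _ := existT_fiber_inj E; move=> /(_ f1 f'1) ->.
rewrite pointE real_symbolE; apply: symbol_germ f'1.
exact: dual_real_is_dual.
Qed.

Section Bundle.
Variables (Theta : Esp M N -> spec M N) (Phi : MN -> Esp M N).
Hypotheses (HTheta : Theta_spec Theta) (HPhi : Phi_spec Phi).

Lemma Phi_val p : Esp_val (Phi p) =
  existT (fun x => @fiber R M N x) p.1 (fiber_class p.1 (Defs.dirac p.2 (germ_one p.1))).
Proof. by case: p => x y; have [_ H] := HPhi x; apply: H; exact: germ_oneP. Qed.

Lemma pi_sp_Phi p : pi_sp (Phi p) = p.1.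
Proof. exact: (congr1 (@projT1 _ _) (Phi_val p)). Qed.

Lemma Phi_surj e : exists p, e = Phi p.
Proof.
have [y [f [f1 E]]] := Esp_dirac e; exists (pi_sp e, y).
by apply: Esp_val_inj; rewrite E; have [_ H] := HPhi (pi_sp e); rewrite (H y f f1).
Qed.

(** Both sides send [phi] to the value at [p] of its symbol; this identity
    reduces the statements on [Phi] to statements on [point]. *)
Lemma Theta_Phi p : Theta (Phi p) = point p.
Proof.
case: p => x y; have := Phi_val (x, y); move: (Phi (x, y)) => [x' xi] /= E.
have xx' : x' = x by exact: (congr1 (@projT1 _ _) E).
subst x'; apply: val_inj; apply/funext => phi.
have inj (a b : R) : a%:C = b%:C -> a = b by move=> [].
apply: inj; rewrite (HTheta (germ_oneP x : germ_is_one (pi_sp (existT _ x xi)) _) E).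
exact: (esym (real_symbolE phi (x, y))).
Qed.

Lemma Theta_bijective : bijective Theta.
Proof.
exists (Phi \o unpoint) => [e|chi] /=; last by rewrite Theta_Phi unpointK.
by have [p ->] := Phi_surj e; rewrite Theta_Phi pointK.
Qed.

Variables (n : nat) (S : set (chart R (spec M N) n)).
Hypothesis HS : natural_atlas S.

Let X := Manifold HS.1.

(** In any natural atlas the smooth functions are those given by the real dual,
    and they determine the smooth maps by [smooth_map_pullback]. *)
Lemma point_smooth : @smooth_map R MN (ChartedSpace S) point.
Proof.
apply: (@smooth_map_pullback R MN X) => h /HS.2[phi hphi].
rewrite (_ : h \o point = real_symbol phi); first exact: smooth_real_symbol.
by apply/funext => p; rewrite /= hphi.
Qed.

Lemma unpoint_smooth : @smooth_map R (ChartedSpace S) MN unpoint.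
Proof.
apply: (@smooth_map_pullback R X MN) => h sh; apply/HS.2.
by exists (real_hat sh) => chi; rewrite /= -[chi in RHS]unpointK pointE real_symbol_hat.
Qed.

Lemma Phi_smooth : @smooth_map R MN (spectral_bundle Theta S) Phi.
Proof.
have TP : Theta \o Phi = point by apply/funext => p; exact: Theta_Phi.
split; first by apply: continuous_comp_initial; rewrite TP; exact: point_continuous.
move=> c e MNc [d Sd [domE mapE _]] j.
have := point_smooth.2 c d MNc Sd j.
by rewrite -TP domE mapE.
Qed.

Lemma unPhi_smooth : @smooth_map R (spectral_bundle Theta S) MN (unpoint \o Theta).
Proof.
have ThetaK : cancel (Phi \o unpoint) Theta by move=> chi; rewrite /= Theta_Phi unpointK.
split.
  move=> e; apply: continuous_comp; last exact: unpoint_continuous.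
  exact: initial_continuous.
move=> e c [d Sd [domE mapE invE]] MNc j.
have := unpoint_smooth.2 d c Sd MNc j.
rewrite (_ : e @` _ = d @` (chart_dom d `&` unpoint @^-1` chart_dom c)).
  rewrite (_ : local_rep e _ = local_rep d (fun chi => c (unpoint chi) ord0 j))//.
  by rewrite /local_rep -invE.
rewrite domE mapE; apply/seteqP; split=> [_ [t ct <-]|_ [chi cchi <-]].
  by exists (Theta t).
by exists ((Phi \o unpoint) chi); rewrite /= ?ThetaK// Theta_Phi unpointK.
Qed.

Lemma Phi_diffeomorphism : @diffeomorphism R MN (spectral_bundle Theta S) Phi.
Proof.
exists (unpoint \o Theta); split.
- by move=> p; rewrite /= Theta_Phi pointK.
- by move=> e; have [p ->] := Phi_surj e; rewrite /= Theta_Phi pointK.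
- exact: Phi_smooth.
- exact: unPhi_smooth.
Qed.

End Bundle.
End Spectrum.

Theorem theorem4p4 (R : realType) (M N : manifold R) :
  [/\
      exists2 Theta : Esp M N -> spec M N, Theta_spec Theta & bijective Theta,
      exists n (S : set (chart R (spec M N) n)), natural_atlas S,
      exists Phi : prod_manifold M N -> Esp M N, Phi_spec Phi &
      forall (Theta : Esp M N -> spec M N) n (S : set (chart R (spec M N) n))
        (Phi : prod_manifold M N -> Esp M N),
        Theta_spec Theta -> natural_atlas S -> Phi_spec Phi ->
        @diffeomorphism R (prod_manifold M N) (spectral_bundle Theta S) Phi /\
        (forall p, pi_sp (Phi p) = p.1)].
Proof.
split.
- have [T HT] := Theta_exists M N; exists T => //.
  exact: Theta_bijective HT (@Esp_point_spec R M N).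
- exists (Defs.dim (prod_manifold M N)), (transport_atlas (@point R M N) (@unpoint R M N)).
  exact: natural_atlas_exists.
- by exists (@Esp_point R M N); exact: Esp_point_spec.
- move=> Theta n S Phi HTheta HS HPhi; split; first exact: Phi_diffeomorphism.
  exact: pi_sp_Phi.
Qed.
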